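(* Let $N\in\{2,3,5,7\}$ and let $p\neq N$ be a prime. Then every root of $ss_p^{(N* )}(X)$ lies in $\mathbb{F}_{p^2}$; that is, for every supersingular $j$-invariant $j\in\overline{\mathbb{F}}_p$, every root $Y\in\overline{\mathbb{F}}_p$ of $R_N(j,Y)=0$ lies in $\mathbb{F}_{p^2}$.
   Context: Define polynomials in $\mathbb{Z}[X,Y]$: $R_2(X,Y)=X^2-X(Y^2-207Y+3456)+(Y+144)^3$; $R_3(X,Y)=X^2-XY(Y^2-126Y+2944)+Y(Y+192)^3$; $R_5(X,Y)=X^2-X(Y^5-80Y^4+1890Y^3-12600Y^2+7776Y+3456)+(Y^2+216Y+144)^3$; $R_7(X,Y)=X^2-XY(Y^2-21Y+8)(Y^4-42Y^3+454Y^2-1008Y-1280)+Y^2(Y^2+224Y+448)^3$. (These are the relations $R_N(j(\tau),j_N^*(\tau))=0$ between the $j$-function and a Hauptmodul $j_N^*$ of the Fricke group $\Gamma_0^*(N)$.) The supersingular polynomial for $\Gamma_0^*(N)$ is $ss_p^{(N* )}(X)=\prod(X-j_N^* )\in\mathbb{F}_p[X]$, where $j_N^*$ runs over the distinct roots in $\overline{\mathbb{F}}_p$ of $R_N(j,Y)\equiv 0$ as $j$ runs over the supersingular $j$-invariants in characteristic $p$. *)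

(* Defs.v *)
From HB Require Import structures.
From mathcomp Require Import all_boot all_order all_algebra all_field.
Set Implicit Arguments. Unset Strict Implicit. Unset Printing Implicit Defensive.
Import GRing.Theory.
Local Open Scope ring_scope.

Section Defs.
Variable F : fieldType.

Definition R_N (N : nat) (X Y : F) : F :=
  match N with
  | 2%N => X ^+ 2 - X * (Y ^+ 2 - 207%:R * Y + 3456%:R) + (Y + 144%:R) ^+ 3
  | 3%N => X ^+ 2 - X * Y * (Y ^+ 2 - 126%:R * Y + 2944%:R)
           + Y * (Y + 192%:R) ^+ 3
  | 5%N => X ^+ 2 - X * (Y ^+ 5 - 80%:R * Y ^+ 4 + 1890%:R * Y ^+ 3
                          - 12600%:R * Y ^+ 2 + 7776%:R * Y + 3456%:R)
           + (Y ^+ 2 + 216%:R * Y + 144%:R) ^+ 3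
  | 7%N => X ^+ 2 - X * Y * (Y ^+ 2 - 21%:R * Y + 8%:R)
                  * (Y ^+ 4 - 42%:R * Y ^+ 3 + 454%:R * Y ^+ 2 - 1008%:R * Y - 1280%:R)
           + Y ^+ 2 * (Y ^+ 2 + 224%:R * Y + 448%:R) ^+ 3
  | _ => 0
  end.

(* Standard quantities of the Weierstrass curve
   E : y^2 + a1 x y + a3 y = x^3 + a2 x^2 + a4 x + a6. *)
Definition wb2 (a1 a2 a3 a4 a6 : F) : F := a1 ^+ 2 + 4%:R * a2.
Definition wb4 (a1 a2 a3 a4 a6 : F) : F := 2%:R * a4 + a1 * a3.
Definition wb6 (a1 a2 a3 a4 a6 : F) : F := a3 ^+ 2 + 4%:R * a6.
Definition wb8 (a1 a2 a3 a4 a6 : F) : F :=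
  a1 ^+ 2 * a6 + 4%:R * a2 * a6 - a1 * a3 * a4 + a2 * a3 ^+ 2 - a4 ^+ 2.
Definition wc4 (a1 a2 a3 a4 a6 : F) : F :=
  (wb2 a1 a2 a3 a4 a6) ^+ 2 - 24%:R * wb4 a1 a2 a3 a4 a6.
Definition wdisc (a1 a2 a3 a4 a6 : F) : F :=
  let b2 := wb2 a1 a2 a3 a4 a6 in let b4 := wb4 a1 a2 a3 a4 a6 in
  let b6 := wb6 a1 a2 a3 a4 a6 in let b8 := wb8 a1 a2 a3 a4 a6 in
  - b2 ^+ 2 * b8 - 8%:R * b4 ^+ 3 - 27%:R * b6 ^+ 2 + 9%:R * b2 * b4 * b6.
Definition wj (a1 a2 a3 a4 a6 : F) : F :=
  (wc4 a1 a2 a3 a4 a6) ^+ 3 / wdisc a1 a2 a3 a4 a6.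

(* f(x,y) = y^2 + a1 x y + a3 y - x^3 - a2 x^2 - a4 x - a6, as a polynomial in
   y (outer) with coefficients polynomials in x (inner). *)
Definition weier_poly (a1 a2 a3 a4 a6 : F) : {poly {poly F}} :=
  'X ^+ 2 + (a1 *: 'X + a3%:P)%:P * 'X
  - ('X ^+ 3 + a2 *: 'X ^+ 2 + a4 *: 'X + a6%:P)%:P.

Definition hasse_invariant (p : nat) (a1 a2 a3 a4 a6 : F) : F :=
  (((weier_poly a1 a2 a3 a4 a6) ^+ p.-1)`_p.-1)`_p.-1.

Definition supersingular_j (p : nat) (j : F) : Prop :=
  exists a1 a2 a3 a4 a6 : F,
    [/\ wdisc a1 a2 a3 a4 a6 != 0, wj a1 a2 a3 a4 a6 = j
      & hasse_invariant p a1 a2 a3 a4 a6 = 0].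

End Defs.

(* Main.v *)
(** Write [Y = t + c/t + d] with [t] a Hauptmodul of Gamma_0(N) and [c], [d] integers:
    then [R_N(X, Y) = (X - h(t)) (X - h(c/t))], where [h(t)] is the [j]-invariant of a
    curve with a marked cyclic subgroup of order [N].  So it suffices to show
    [t^(p^2) = t] whenever [h(t)] is supersingular.

    Take [p > 3] and a supersingular curve [y^2 = f(x) = x^3 + a x^2 + b x].
    Multiplication by [p] acts on the [x]-line by a reduced fraction [A/B] with
    [deg A = p^2]; this follows from the quadratic equation satisfied by [x(P+Q)] and
    [x(P-Q)], as in Manin's proof of the Hasse bound.  Its derivative is divisible by
    [p], so [A/B] is the [p]-th power of some [S].  If [S] were separable, it would be
    the [x]-coordinate of an isogeny multiplying [dx/y] by a nonzero constant, and
    [S dx/y] would be, up to a multiple of [dx/y], the derivative of a logarithmic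
    derivative.  As the Hasse invariant vanishes, [dx/y] is exact, hence so is
    [S dx/y]; comparing coefficients of [x^(p-1)], the coefficients of [x^(p-2)] and
    [x^(p-1)] in [f^((p-1)/2)] both vanish (up to a Frobenius twist), and the
    three-term recurrence of these coefficients would kill the leading one.  Hence
    [A/B = x^(p^2)/e] for a constant [e].

    Then [a^(p^2) = e a] and [b^(p^2) = e^2 b], while the [x]-coordinates of a cyclic
    subgroup of order [N] are permuted up to the factor [e].  Since [t] is a function
    of these data that is homogeneous of weight 0 and invariant under the permutation,
    it is fixed.

    For [p = 2] or [3] the only supersingular [j]-invariant is 0, and [R_N(0, Y)] has
    its roots in the prime field. *)

(* The fraction [S] is the [x]-coordinate of the Verschiebung: multiplication by [p] factors through
   Frobenius, and a vanishing Hasse invariant should force the other factor to kill [dx/y]. To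
   obtain this without a theory of isogenies, everything is stated for rational functions of [x]. On
   the twist by [f(x)] the generic point is [(x, 1)], so its multiples are rational over [F(x)] and
   [y] is never adjoined. Associativity of the group law is avoided too: only chords through
   [(x, 1)] are drawn, and the step back to the previous multiple is read off from the same line.
   The constant [e] cannot be normalized to 1: the square of Frobenius returns to the curve only up
   to the isomorphism [x -> e x]. Hence each level needs its own expression of [t] by quantities of
   known weight. Supersingularity is given by the Hasse invariant of some Weierstrass model, whereas
   the marked subgroup lives on another model with the same [j], and the torsion argument needs a
   third one with a 2-torsion point at the origin; the changes of model connect the three. *)
Require Import Defs.
From HB Require Import structures.
From mathcomp Require Import all_boot all_order all_algebra all_field.
From mathcomp Require Import ring zify.
Set Implicit Arguments. Unset Strict Implicit. Unset Printing Implicit Defensive.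
Import GRing.Theory.
Local Open Scope ring_scope.

(** * Addition on the twisted curve *)

(* [(P, Q)] is a point of [f(x) Q^2 = f(P)], the twist of the curve by [f(x)]; it is
   added to the point [(x, 1)], giving [(P', Q')]. *)
Section ChordAddition.
Variables (L : fieldType) (a b x P Q lam : L).
Let f (z : L) := z ^+ 3 + a * z ^+ 2 + b * z.
Let f' (z : L) := 3%:R * z ^+ 2 + 2%:R * a * z + b.
Hypothesis onP : f P = f x * Q ^+ 2.
Hypothesis Px : P != x.
Hypothesis lamE : lam * (P - x) = Q - 1.
Let P' := f x * lam ^+ 2 - a - P - x.
Let Q' := - (lam * (P' - x)) - 1.

Lemma chord_slope :
  P ^+ 2 + P * x + x ^+ 2 + a * (P + x) + b = f x * lam * (Q + 1).
Proof.
apply: (mulIf (x := P - x)); first by rewrite subr_eq0.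
transitivity (f P - f x); first by rewrite /f; ring.
by rewrite onP -!mulrA [(Q + 1) * _]mulrC [lam * _]mulrA lamE; ring.
Qed.

(** By Vieta, [P'] is the third root of the monic cubic [f z - f x * (lam * (z - x) + 1) ^+ 2],
    whose other roots are [x] and [P]. *)
Lemma chord_on_curve : f P' = f x * Q' ^+ 2.
Proof.
have QE : Q = lam * (P - x) + 1 by rewrite lamE subrK.
have E1 := chord_slope; rewrite QE in E1.
have E2 : f x * lam ^+ 2 = P' + P + x + a by rewrite /P'; ring.
apply/eqP; rewrite -subr_eq0; apply/eqP.
pose G := P ^+ 2 + P * x + x ^+ 2 + a * (P + x) + b.
transitivity ((P' - x) * ((P' - P) * (P' + P + x + a - f x * lam ^+ 2)
  + (G - f x * lam * (lam * (P - x) + 1 + 1)))).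
  by rewrite /Q' /G /f; ring.
by rewrite E2 /G E1; ring.
Qed.

Section Derivative.
Variables (m dQ dlam : L).
Hypothesis Q0 : Q != 0.
(* [m] is the multiplier: the derivative of [P] is [m Q], that of [x] is 1. *)
Hypothesis dlamE : dlam * (P - x) + lam * (m * Q - 1) = dQ.
Hypothesis dQE : f' P * (m * Q) = f' x * Q ^+ 2 + f x * (2%:R * Q * dQ).

(** Invariance of the differential [dP / Q] under translation: adding [(x, 1)] raises the multiplier
    by 1. For the [p]-th multiple this makes the derivative vanish. *)
Lemma chord_derivative :
  f' x * lam ^+ 2 + f x * (2%:R * lam * dlam) - m * Q - 1 = (m + 1) * Q'.
Proof.
have D0 : P - x != 0 by rewrite subr_eq0.
have dQ2 : 2%:R * f x * dQ = m * f' P - f' x * Q.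
  apply: (mulfI Q0); apply/eqP; rewrite -subr_eq0; apply/eqP.
  transitivity (f' x * Q ^+ 2 + f x * (2%:R * Q * dQ) - f' P * (m * Q)).
    by ring.
  by rewrite dQE subrr.
apply: (mulIf D0); apply/eqP; rewrite -subr_eq0; apply/eqP.
have QE : Q = lam * (P - x) + 1 by rewrite lamE subrK.
have E1 := chord_slope.
pose G := P ^+ 2 + P * x + x ^+ 2 + a * (P + x) + b.
transitivity ((1 - m) * lam * (f x * lam * (Q + 1) - G)
  + lam * (2%:R * f x * dQ - (m * f' P - f' x * Q))).
  by rewrite -dlamE QE /Q' /P' /G /f /f'; ring.
by rewrite dQ2 -E1 /G !subrr !mulr0 addr0.
Qed.
End Derivative.

Section Difference.
(* [M] is the first coordinate of [(P, Q) - (x, 1)]. *)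
Variable lam' : L.
Hypothesis lam'E : lam' * (P - x) = - (Q + 1).
Let M := f x * lam' ^+ 2 - a - P - x.

(** Changing the sign of [Q] exchanges [P'] and [M], so their product and sum are rational in [P]
    and [x] alone; this gives a recurrence without [Q]. *)
Lemma chord_product : P' * M * (P - x) ^+ 2 = (P * x - b) ^+ 2.
Proof.
have D0 : (P - x) ^+ 2 != 0 by rewrite expf_neq0 // subr_eq0.
pose S := f P + f x - (a + P + x) * (P - x) ^+ 2.
have E1 : P' * (P - x) ^+ 2 = S - 2%:R * f x * Q.
  rewrite /P' /S onP.
  transitivity (f x * (lam * (P - x)) ^+ 2 - (a + P + x) * (P - x) ^+ 2).
    by ring.
  by rewrite lamE; ring.
have E2 : M * (P - x) ^+ 2 = S + 2%:R * f x * Q.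
  rewrite /M /S onP.
  transitivity (f x * (lam' * (P - x)) ^+ 2 - (a + P + x) * (P - x) ^+ 2).
    by ring.
  by rewrite lam'E; ring.
apply: (mulIf D0); rewrite -mulrA.
transitivity ((P' * (P - x) ^+ 2) * (M * (P - x) ^+ 2)); first by ring.
rewrite E1 E2; transitivity (S ^+ 2 - 4%:R * f x * (f x * Q ^+ 2)).
  by ring.
by rewrite -onP /S /f; ring.
Qed.

Lemma chord_sum : (P' + M) * (P - x) ^+ 2 =
  2%:R * ((P + x) * (P * x + b) + 2%:R * a * P * x).
Proof.
transitivity (f x * (lam * (P - x)) ^+ 2 + f x * (lam' * (P - x)) ^+ 2
  - 2%:R * (a + P + x) * (P - x) ^+ 2); first by rewrite /P' /M; ring.
rewrite lamE lam'E.
transitivity (2%:R * (f x * Q ^+ 2) + 2%:R * f x - 2%:R * (a + P + x) * (P - x) ^+ 2).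
  by ring.
by rewrite -onP /f; ring.
Qed.

End Difference.
End ChordAddition.

Section TangentDoubling.
Variables (L : fieldType) (a b x lam : L).
Let f (z : L) := z ^+ 3 + a * z ^+ 2 + b * z.
Let f' (z : L) := 3%:R * z ^+ 2 + 2%:R * a * z + b.
Hypothesis two0 : (2%:R : L) != 0.
Hypothesis fx0 : f x != 0.
Hypothesis lamE : lam * (2%:R * f x) = f' x.
Let P := f x * lam ^+ 2 - a - x - x.
Let Q := - (lam * (P - x)) - 1.

Lemma double_num : P * (4%:R * f x) = (x ^+ 2 - b) ^+ 2.
Proof.
transitivity ((lam * (2%:R * f x)) ^+ 2 - (a + x + x) * (4%:R * f x)).
  by rewrite /P; ring.
by rewrite lamE /f /f'; ring.
Qed.

Lemma double_Q : 8%:R * f x ^+ 2 * Q =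
  - (f' x * ((x ^+ 2 - b) ^+ 2 - 4%:R * f x * x) + 8%:R * f x ^+ 2).
Proof. by rewrite -double_num -lamE /Q; ring. Qed.

Lemma double_on_curve : f P = f x * Q ^+ 2.
Proof.
have c0 : (8%:R * f x ^+ 2) ^+ 2 != 0.
  by rewrite expf_neq0 // (natrM _ 2 4) (natrM _ 2 2) !mulf_neq0 // expf_neq0.
apply: (mulIf c0).
transitivity (f x * ((P * (4%:R * f x)) ^+ 3
    + a * (P * (4%:R * f x)) ^+ 2 * (4%:R * f x)
    + b * (P * (4%:R * f x)) * (4%:R * f x) ^+ 2)).
  by rewrite {1}/f; ring.
transitivity (f x * (8%:R * f x ^+ 2 * Q) ^+ 2); last by ring.
by rewrite double_Q double_num /f /f'; ring.
Qed.
End TangentDoubling.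

(** * Derivation on rational functions *)

Local Open Scope quotient_scope.

Local Notation "p %:F" := (tofrac p).

Lemma pi_ratioE (R : idomainType) (r : {ratio R}) :
  \pi_({fraction R}) r * (\d_r)%:F = (\n_r)%:F.
Proof.
unlock FracField.tofrac; rewrite -[LHS]FracField.pi_mul.
apply/eqP; rewrite FracField.equivf_def /FracField.mulf.
by rewrite !numden_Ratio ?mulr1 ?oner_neq0 ?denom_ratioP // mulrC.
Qed.

Section FractionDerivation.
Variable F : fieldType.
Implicit Types (n d : {poly F}) (z w : {fraction {poly F}}).

Definition fnum z : {poly F} := \n_(repr z).
Definition fden z : {poly F} := \d_(repr z).

Lemma fden_neq0 z : fden z != 0. Proof. exact: denom_ratioP. Qed.

Lemma fracE z : z * (fden z)%:F = (fnum z)%:F.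
Proof. by rewrite -{1}[z]reprK pi_ratioE. Qed.

Definition fderiv z : {fraction {poly F}} :=
  ((fnum z)^`() * fden z - fnum z * (fden z)^`())%:F / ((fden z)%:F ^+ 2).

(** Independence of the representative: the relation between two fractions for [z],
    cross-multiplied, is differentiated. *)
Lemma fderivE z n d : d != 0 -> z * d%:F = n%:F ->
  fderiv z * d%:F ^+ 2 = (n^`() * d - n * d^`())%:F.
Proof.
move=> d0 zE; rewrite /fderiv.
have e0 := fden_neq0 z; have eE := fracE z.
move: (fnum z) (fden z) e0 eE => m e e0 eE.
have cross : n * e = m * d.
  by apply/eqP; rewrite -tofrac_eq !tofracM -zE -eE mulrAC.
have dcross : n^`() * e + n * e^`() = m^`() * d + m * d^`().
  by rewrite -!derivM cross.
have e0' : e%:F != 0 by rewrite tofrac_eq0.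
apply: (mulIf (expf_neq0 2 e0')).
rewrite mulrAC divfK ?expf_neq0 // -!tofracXn -!tofracM; congr (_%:F).
apply/eqP; rewrite -subr_eq0; apply/eqP.
transitivity ((n * e - m * d) * (d * e^`() + d^`() * e)
  - d * e * (n^`() * e + n * e^`() - (m^`() * d + m * d^`()))); first by ring.
by rewrite cross dcross !subrr mul0r mulr0 subrr.
Qed.

Lemma fderivD z w : fderiv (z + w) = fderiv z + fderiv w.
Proof.
have [e0 d0] := (fden_neq0 z, fden_neq0 w).
have [eE dE] := (fracE z, fracE w).
move: (fden z) (fnum z) (fden w) (fnum w) e0 d0 eE dE => e m d n e0 d0 eE dE.
have ed0 : e * d != 0 by rewrite mulf_neq0.
have ed0' : (e * d)%:F != 0 by rewrite tofrac_eq0.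
apply: (mulIf (expf_neq0 2 ed0')).
rewrite (@fderivE _ (m * d + n * e)) //; last first.
  by rewrite tofracD !tofracM -eE -dE; ring.
rewrite tofracM; transitivity (fderiv z * e%:F ^+ 2 * d%:F ^+ 2
  + fderiv w * d%:F ^+ 2 * e%:F ^+ 2); last by ring.
rewrite (fderivE e0 eE) (fderivE d0 dE) -!tofracXn -!tofracM -tofracD.
by congr (_%:F); rewrite !derivE; ring.
Qed.

Lemma fderivM z w : fderiv (z * w) = fderiv z * w + z * fderiv w.
Proof.
have [e0 d0] := (fden_neq0 z, fden_neq0 w).
have [eE dE] := (fracE z, fracE w).
move: (fden z) (fnum z) (fden w) (fnum w) e0 d0 eE dE => e m d n e0 d0 eE dE.
have ed0 : e * d != 0 by rewrite mulf_neq0.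
have ed0' : (e * d)%:F != 0 by rewrite tofrac_eq0.
apply: (mulIf (expf_neq0 2 ed0')).
rewrite (@fderivE _ (m * n)) //; last by rewrite !tofracM -eE -dE; ring.
rewrite tofracM; transitivity (fderiv z * e%:F ^+ 2 * (w * d%:F) * d%:F
  + fderiv w * d%:F ^+ 2 * (z * e%:F) * e%:F); last by ring.
rewrite (fderivE e0 eE) (fderivE d0 dE) eE dE -!tofracM -tofracD.
by congr (_%:F); rewrite !derivE; ring.
Qed.

Lemma frac_coprime z : exists n d,
  [/\ d != 0, coprimep n d & z * d%:F = n%:F].
Proof.
have [d0 zE] := (fden_neq0 z, fracE z).
move: (fnum z) (fden z) d0 zE => n d d0 zE.
have g0 : gcdp n d != 0 by rewrite gcdp_eq0 negb_and d0 orbT.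
have nE := divpK (dvdp_gcdl n d); have dE := divpK (dvdp_gcdr n d).
exists (n %/ gcdp n d), (d %/ gcdp n d); split.
- by apply: contraNneq d0 => h; rewrite -dE h mul0r.
- by rewrite coprimep_div_gcd // d0 orbT.
apply: (mulIf (x := (gcdp n d)%:F)); first by rewrite tofrac_eq0.
by rewrite -mulrA -!tofracM dE nE.
Qed.

End FractionDerivation.

(** * Polynomial preliminaries: squares and primitive triples *)

Section Characteristic.
Variables (F : fieldType) (p : nat).
Hypothesis charF : p \in [pchar F].

Lemma natr_pchar_neq0 k : (0 < k < p)%N -> (k%:R : F) != 0.
Proof. by case/andP => k0 kp; rewrite -(dvdn_pcharf charF) gtnNdvd. Qed.

Lemma pchar_half : (2 < p)%N -> p = p./2.*2.+1.
Proof.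
move=> p2; rewrite -[LHS]odd_double_half; suff -> : odd p by [].
apply: contraTT p2 => /negbTE h.
by have := even_prime (pcharf_prime charF); rewrite h => -[->|].
Qed.

End Characteristic.

Section PolyPrelim.
Variable F : fieldType.
Implicit Types (p q r : {poly F}).

Lemma coefM_top p q i j : (size p <= i.+1)%N -> (size q <= j.+1)%N ->
  (p * q)`_(i + j) = p`_i * q`_j.
Proof.
move=> sp sq; rewrite coefM.
have ij : (i < (i + j).+1)%N by rewrite ltnS leq_addr.
rewrite (bigD1 (Ordinal ij)) //= addKn big1 ?addr0 // => k /eqP ki.
have [ltki|] := ltnP k i.
  by rewrite [q`__]nth_default ?mulr0 // (leq_trans sq) //; lia.
rewrite leq_eqVlt => /orP [/eqP ik|ltik]; first by case: ki; apply: val_inj.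
by rewrite nth_default ?mul0r // (leq_trans sp).
Qed.

Lemma sqr_cofactor p q r : r != 0 -> p * r ^+ 2 = q ^+ 2 ->
  exists s, p = s ^+ 2 /\ q = s * r.
Proof.
move=> r0 e.
have /dvdpP [s qE] : r %| q by rewrite -(@dvdp_pexp2r _ r q 2) // -e dvdp_mull.
exists s; split=> //.
by apply: (mulIf (expf_neq0 2 r0)); rewrite e qE exprMn.
Qed.

Lemma Xsqr_cofactor p q r : r != 0 -> 'X * p * r ^+ 2 = q ^+ 2 ->
  exists s, p = 'X * s ^+ 2.
Proof.
move=> r0 /(sqr_cofactor r0) [s [e _]].
have /dvdpP [u sE] : 'X %| s.
  rewrite -['X]subr0 dvdp_XsubCl /root -sqrf_eq0 -horner_exp -e.
  by rewrite hornerM hornerX mul0r.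
exists u; apply: (mulfI (x := 'X)); first by rewrite polyX_eq0.
by rewrite e sE; ring.
Qed.

Lemma coprimep_root_absurd p q : coprimep p q ->
  forall x, p.[x] = 0 -> q.[x] = 0 -> False.
Proof. by move=> /coprimep_root h x /rootP/h /eqP h1 /h1. Qed.

End PolyPrelim.

Section Closed.
Variable F : closedFieldType.
Implicit Types (U V W : {poly F}).

Lemma nth_root_ex n (c : F) : (0 < n)%N -> exists u, u ^+ n = c.
Proof.
move=> n0; have /closed_rootP [r /rootP] : size ('X ^+ n - c%:P) != 1%N.
  by rewrite size_XnsubC //; case: n n0.
by rewrite !hornerE => /eqP; rewrite subr_eq0 => /eqP; exists r.
Qed.

Lemma no_common_root_coprimep U V :
  (forall r, U.[r] = 0 -> V.[r] = 0 -> False) -> coprimep U V.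
Proof.
move=> h; apply/Pdiv.ClosedField.coprimepP => r /rootP ur.
by apply/eqP => vr; apply: h ur vr.
Qed.

Definition primitive3 U V W :=
  forall r, U.[r] = 0 -> V.[r] = 0 -> W.[r] = 0 -> False.

Lemma primitive3_dvdp U V W x y z : primitive3 U V W ->
  x * V = y * U -> x * W = z * U -> U %| x.
Proof.
move=> prim e1 e2.
have cop : coprimep U (gcdp V W).
  apply/Pdiv.ClosedField.coprimepP => r /rootP Ur.
  apply/negP; rewrite -rootE root_gcd => /andP [/rootP Vr /rootP Wr].
  exact: prim Ur Vr Wr.
rewrite -(Gauss_dvdpl _ cop) (eqp_dvdr _ (mulp_gcdr _ _ _)) dvdp_gcd.
by rewrite e1 e2 !dvdp_mull.
Qed.

(** Each first entry divides the other by [primitive3_dvdp], so they are associates. This is what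
    makes the divisions in [mul_state] exact. *)
Lemma primitive3_proportional U V W x y z : U != 0 -> x != 0 ->
  primitive3 U V W -> primitive3 x y z ->
  x * V = y * U -> x * W = z * U ->
  exists2 e : F, e != 0 & [/\ x = e *: U, y = e *: V & z = e *: W].
Proof.
move=> U0 x0 pU px e1 e2.
have d1 := primitive3_dvdp pU e1 e2.
have d2 : x %| U.
  by apply: (primitive3_dvdp px (y := V) (z := W));
    rewrite mulrC -?e1 -?e2 mulrC.
have /eqpP [[c1 c2] /= /andP [c10 c20] e] : x %= U by rewrite /eqp d1 d2.
have xE : x = (c1^-1 * c2) *: U.
  by rewrite -scalerA -e scalerA mulVf // scale1r.
exists (c1^-1 * c2); first by rewrite mulf_neq0 ?invr_eq0.
split=> //; apply: (mulIf U0).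
  by rewrite -e1 {1}xE -!scalerAl [U * _]mulrC.
by rewrite -e2 {1}xE -!scalerAl [U * _]mulrC.
Qed.

(** Gauss's lemma: up to sign these are the coefficients of [(q z - p) (s z - r)]. *)
Lemma primitive3_coprime p q r s : coprimep p q -> coprimep r s ->
  primitive3 (q * s) (p * s + r * q) (p * r).
Proof.
move=> /coprimep_root_absurd c1 /coprimep_root_absurd c2 x; rewrite !hornerE.
move=> /eqP; rewrite mulf_eq0 => /orP [] /eqP h.
  rewrite h mulr0 addr0 => /eqP; rewrite mulf_eq0 => /orP [] /eqP h2.
    by move: (c1 x h2 h).
  move=> /eqP; rewrite mulf_eq0 => /orP [] /eqP h3; first exact: (c1 x h3 h).
  exact: (c2 x h3 h2).
rewrite h mulr0 add0r => /eqP; rewrite mulf_eq0 => /orP [] /eqP h2.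
  by move: (c2 x h2 h).
move=> /eqP; rewrite mulf_eq0 => /orP [] /eqP h3; first exact: (c1 x h3 h2).
exact: (c2 x h3 h).
Qed.

End Closed.

(* [qU z^2 - qV z + qW] has roots [x(P+Q)] and [x(P-Q)] when [x(P) = x] and
   [x(Q) = A/B]. *)
Section Forms.
Variable R : comRingType.
Definition qU (x A B : R) := (A - x * B) ^+ 2.
Definition qV (a b x A B : R) :=
  2%:R * ((A + x * B) * (A * x + b * B) + 2%:R * a * A * x * B).
Definition qW (b x A B : R) := (A * x - b * B) ^+ 2.
End Forms.

(** Where [qU] vanishes, [A = r B], and [qV], [qW] become [B ^+ 2] times the denominator [4 f(r)]
    and the numerator [(r^2 - b)^2] of the duplication formula, which have no common zero on a
    nonsingular curve. *)
Lemma forms_primitive (F : closedFieldType) (a b : F) (A B : {poly F}) :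
  (2%:R : F) != 0 -> b != 0 -> a ^+ 2 - 4%:R * b != 0 -> coprimep A B ->
  primitive3 (qU 'X A B) (qV a%:P b%:P 'X A B) (qW b%:P 'X A B).
Proof.
move=> two0 b0 disc0 /coprimep_root_absurd cop r; rewrite /qU /qV /qW !hornerE.
move: (cop r) => {}cop /eqP; rewrite sqrf_eq0 subr_eq0 => /eqP e1.
have [Br|Br] := eqVneq B.[r] 0; first by case: cop => //; rewrite e1 Br mulr0.
move=> e2 /eqP; rewrite sqrf_eq0 subr_eq0 => /eqP e3.
have rr : r ^+ 2 = b by apply: (mulIf Br); rewrite -e3 e1; ring.
move: e2; rewrite e1 => e2.
have : 2%:R ^+ 1 * 2%:R * B.[r] ^+ 2 * b * (2%:R * r + a) = 0.
  by rewrite -[RHS]e2 -rr; ring.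
move/eqP; rewrite !mulf_eq0 ?sqrf_eq0 (negbTE two0) (negbTE Br) (negbTE b0) /=.
move=> /eqP h; case/eqP: disc0; rewrite -rr -[a](addrK (2%:R * r)) [a + _]addrC h.
by ring.
Qed.

(** * Multiplication by [n] *)

(* [L] is the fraction field of [{poly F}]; it is kept abstract because unification
   diverges on the concrete quotient type. *)
Section Sequence.
Variables (F : closedFieldType) (p : nat) (a b : F).
Variables (L : fieldType) (iota : {rmorphism {poly F} -> L}) (der : L -> L).
Hypothesis iota_inj : injective iota.
Hypothesis derE : forall z (n d : {poly F}), d != 0 -> z * iota d = iota n ->
  der z * iota d ^+ 2 = iota (n^`() * d - n * d^`()).
Hypothesis derM : forall z w, der (z * w) = der z * w + z * der w.
Hypothesis derD : forall z w, der (z + w) = der z + der w.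
Hypothesis frac_red : forall z, exists n d,
  [/\ d != 0, coprimep n d & z * iota d = iota n].
Local Notation "p %:F" := (iota p).
Hypothesis charF : p \in [pchar F].
Hypothesis p2 : (2 < p)%N.
Hypothesis b0 : b != 0.
Hypothesis disc0 : a ^+ 2 - 4%:R * b != 0.

Definition fcub : {poly F} := 'X ^+ 3 + a%:P * 'X ^+ 2 + b%:P * 'X.
Definition fcub' : {poly F} := 3%:R * 'X ^+ 2 + 2%:R * a%:P * 'X + b%:P.

Lemma deriv_fcub : fcub^`() = fcub'.
Proof. by rewrite /fcub /fcub' !derivE; ring. Qed.

(* [mul_state n] holds numerator and denominator of [x(nP)] and of [x((n+1)P)], where
   [x(P) = 'X].  The divisions are exact for multiples up to [p] ([mul_recP]);
   beyond that the values are meaningless. *)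
Fixpoint mul_state (n : nat) : ({poly F} * {poly F}) * ({poly F} * {poly F}) :=
  match n with
  | 0%N => ((1, 0), ('X, 1))
  | 1%N => (('X, 1), (('X ^+ 2 - b%:P) ^+ 2, 4%:R * fcub))
  | m.+1 => let: (u, v) := mul_state m in
      (v, (qW b%:P 'X v.1 v.2 %/ u.1, qU 'X v.1 v.2 %/ u.2))
  end.
Definition mnum n := (mul_state n).1.1.
Definition mden n := (mul_state n).1.2.

Lemma mul_stateSS n : mul_state n.+2 = ((mul_state n.+1).2,
  (qW b%:P 'X (mul_state n.+1).2.1 (mul_state n.+1).2.2 %/ (mul_state n.+1).1.1,
   qU 'X (mul_state n.+1).2.1 (mul_state n.+1).2.2 %/ (mul_state n.+1).1.2)).
Proof.
rewrite -[LHS]/(let: (u, v) := mul_state n.+1 in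
  (v, (qW b%:P 'X v.1 v.2 %/ u.1, qU 'X v.1 v.2 %/ u.2))).
by case: (mul_state n.+1).
Qed.

Lemma mul_stateS n : (mul_state n).2 = (mnum n.+1, mden n.+1).
Proof.
rewrite /mnum /mden; case: n => [//|n].
by rewrite mul_stateSS; case: ((mul_state n.+1).2).
Qed.

Lemma mnumSS n : (0 < n)%N ->
  mnum n.+2 = qW b%:P 'X (mnum n.+1) (mden n.+1) %/ mnum n.
Proof.
case: n => // n _; have -> : mnum n.+3 = (mul_state n.+2).2.1 by rewrite mul_stateS.
by rewrite mul_stateSS mul_stateS.
Qed.

Lemma mdenSS n : (0 < n)%N ->
  mden n.+2 = qU 'X (mnum n.+1) (mden n.+1) %/ mden n.
Proof.
case: n => // n _; have -> : mden n.+3 = (mul_state n.+2).2.2 by rewrite mul_stateS.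
by rewrite mul_stateSS mul_stateS.
Qed.

Let natr_neq0 := natr_pchar_neq0 charF.

(** The denominator is the square of the division polynomial, with leading coefficient [n^2]. Only a
    formal degree is asserted for it because this coefficient vanishes for [n = p]. *)
Definition mul_shape n :=
  [/\ coprimep (mnum n) (mden n), mden n != 0,
      (mnum n \is monic) /\ size (mnum n) = (n ^ 2).+1
    & (size (mden n) <= n ^ 2)%N /\ (mden n)`_(n ^ 2).-1 = (n ^ 2)%:R].

(* [(P, Q) = (n+1) (x, 1)] on the twist; the last two clauses say that the first
   coordinate of [(P, Q) - (x, 1)] is [mnum n / mden n]. *)
Definition mul_point n := exists P Q lam : L,
  let x := ('X : {poly F})%:F in
  let f (z : L) := z ^+ 3 + a%:P%:F * z ^+ 2 + b%:P%:F * z in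
  [/\ P * (mden n.+1)%:F = (mnum n.+1)%:F, f P = f x * Q ^+ 2,
      der P = n.+1%:R * Q, lam * (P - x) = - (Q + 1)
    & (f x * lam ^+ 2 - a%:P%:F - P - x) * (mden n)%:F = (mnum n)%:F ].

Definition mul_rec n :=
  [/\ mden n.+2 * mden n = qU 'X (mnum n.+1) (mden n.+1),
      mnum n.+2 * mden n + mnum n * mden n.+2
        = qV a%:P b%:P 'X (mnum n.+1) (mden n.+1)
    & mnum n.+2 * mnum n = qW b%:P 'X (mnum n.+1) (mden n.+1)].

(** The origin is [1 / 0], so the double cannot be obtained by dividing by [mden 0]; it is entered
    by hand in [mul_state], and the recurrence is checked directly. *)
Lemma mul_rec0 : mul_rec 0.
Proof.
rewrite /mul_rec /mnum /mden /= /qU /qV /qW /fcub; split; ring.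
Qed.

Lemma mul_shape1 : mul_shape 1.
Proof.
rewrite /mul_shape /mnum /mden /=; split.
- exact: coprimep1.
- exact: oner_neq0.
- by rewrite monicX size_polyX.
- by rewrite size_poly1 coef1.
Qed.

Lemma size_fcub : size fcub = 4%N /\ fcub \is monic.
Proof.
have s : (size (a%:P * 'X ^+ 2 + b%:P * 'X)%R < size ('X ^+ 3 : {poly F})%R)%N.
  rewrite size_polyXn (leq_ltn_trans (size_polyD _ _)) // gtn_max.
  rewrite !mul_polyC.
  by rewrite !(leq_ltn_trans (size_scale_leq _ _)) ?size_polyXn ?size_polyX.
rewrite /fcub -addrA; split; first by rewrite size_polyDl // size_polyXn.
by rewrite monicE lead_coefDl // lead_coefXn.
Qed.

Lemma fcub_neq0 : fcub != 0.
Proof. by rewrite -size_poly_eq0 size_fcub.1. Qed.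

Lemma mul_shape2 : mul_shape 2.
Proof.
have four0 : (4%:R : F) != 0.
  by rewrite (natrM _ 2 2) mulf_neq0 // natr_neq0.
have [fs fm] := size_fcub.
have fourP : (4%:R : {poly F}) * fcub = 4%:R *: fcub.
  by rewrite -mul_polyC polyC_natr.
have mon : 'X ^+ 2 - b%:P \is monic by rewrite monicXnsubC.
have sz : size ('X ^+ 2 - b%:P) = 3%N by rewrite size_XnsubC.
rewrite /mul_shape /mnum /mden /= fourP; split.
- apply/Pdiv.ClosedField.coprimepP => r /rootP.
  rewrite !hornerE => /eqP; rewrite sqrf_eq0 subr_eq0 => /eqP e.
  rewrite /fcub mulf_neq0 //.
  rewrite (_ : _ + _ = b * (2%:R * r + a)); last by rewrite -e /=; ring.
  rewrite mulf_neq0 //; apply: contra_neq disc0 => h.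
  by rewrite -e -[a](addrK (2%:R * r)) [a + _]addrC h; ring.
- by rewrite scaler_eq0 negb_or four0 fcub_neq0.
- rewrite monic_exp // expr2 size_monicM ?monic_neq0 // sz.
  by [].
- rewrite size_scale // fs coefZ; split=> //=.
  by move: fm; rewrite monicE lead_coefE fs /= => /eqP ->; rewrite mulr1.
Qed.

Lemma iota_fcub : fcub%:F =
  'X%:F ^+ 3 + a%:P%:F * 'X%:F ^+ 2 + b%:P%:F * 'X%:F.
Proof. by rewrite /fcub !(rmorphD, rmorphXn, rmorphM). Qed.

Lemma iota_fcub' : fcub'%:F =
  3%:R * 'X%:F ^+ 2 + 2%:R * a%:P%:F * 'X%:F + b%:P%:F.
Proof. by rewrite /fcub' 2!rmorphD rmorphM rmorphXn 2!rmorphM !rmorph_nat. Qed.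

Lemma iota_eq0 (u : {poly F}) : (u%:F == 0) = (u == 0).
Proof. by rewrite -(inj_eq iota_inj) rmorph0. Qed.

Lemma iotaMn k (u : {poly F}) : (k%:R * u)%:F = k%:R * u%:F.
Proof. by rewrite rmorphM rmorph_nat. Qed.

Lemma natrL_neq0 m : (0 < m < p)%N -> (m%:R : L) != 0.
Proof.
move=> mp; have : (m%:R : {poly F})%:F != 0.
  by rewrite iota_eq0 -polyC_natr polyC_eq0 natr_neq0.
by rewrite rmorph_nat.
Qed.

Lemma double_deriv : (('X ^+ 2 - b%:P) ^+ 2)^`() * (4%:R * fcub)
    - ('X ^+ 2 - b%:P) ^+ 2 * (4%:R * fcub)^`() =
  - (4%:R * (fcub' * (('X ^+ 2 - b%:P) ^+ 2 - 4%:R * fcub * 'X)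
      + 8%:R * fcub ^+ 2)).
Proof.
have -> : (('X ^+ 2 - b%:P) ^+ 2)^`() = 4%:R * 'X * ('X ^+ 2 - b%:P).
  by rewrite !derivE; ring.
have -> : (4%:R * fcub)^`() = 4%:R * fcub'.
  by rewrite derivM -polyC_natr derivC mul0r add0r deriv_fcub.
by rewrite /fcub' /fcub; ring.
Qed.

Lemma mul_point1 : mul_point 1.
Proof.
have ff0 : fcub%:F != 0 by rewrite iota_eq0 fcub_neq0.
have two0 := @natrL_neq0 2 p2.
have ffE := iota_fcub; have ffE' := iota_fcub'.
pose x : L := ('X : {poly F})%:F; pose aL : L := a%:P%:F.
pose bL : L := b%:P%:F.
pose f (z : L) := z ^+ 3 + aL * z ^+ 2 + bL * z.
pose f' (z : L) := 3%:R * z ^+ 2 + 2%:R * aL * z + bL.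
have fx0 : f x != 0 by rewrite /f -ffE.
pose lam := f' x / (2%:R * f x).
have lamE : lam * (2%:R * f x) = f' x by rewrite divfK // mulf_neq0.
pose P := f x * lam ^+ 2 - aL - x - x; pose Q := - (lam * (P - x)) - 1.
have numE : P * (4%:R * f x) = (x ^+ 2 - bL) ^+ 2.
  exact: (double_num lamE).
have PE : P * (mden 2)%:F = (mnum 2)%:F.
  rewrite /mden /mnum /= rmorphM rmorph_nat ffE numE.
  by rewrite rmorphXn rmorphB rmorphXn.
exists P, Q, lam; split=> //.
- exact: (double_on_curve two0 fx0 lamE).
- have [_ den0 _ _] := mul_shape2.
  have den0' : (mden 2)%:F != 0 by rewrite iota_eq0.
  apply: (mulIf (expf_neq0 2 den0')); rewrite (derE den0 PE).
  have QE := @double_Q _ aL bL x lam lamE.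
  rewrite /mden /mnum /= rmorphM rmorph_nat ffE.
  transitivity (4%:R * (8%:R * f x ^+ 2 * Q)); last by rewrite /f; ring.
  rewrite [8%:R * _ * _]QE.
  rewrite (_ : _ - _ = - (4%:R * (fcub' * (('X ^+ 2 - b%:P) ^+ 2
             - 4%:R * fcub * 'X) + 8%:R * fcub ^+ 2))).
    rewrite rmorphN iotaMn rmorphD rmorphM rmorphB rmorphXn rmorphB rmorphXn.
    by rewrite rmorphM 2!iotaMn rmorphXn ffE ffE' mulrN.
  exact: double_deriv.
- by rewrite /Q; ring.
- rewrite /mden /mnum /= rmorph1 mulr1 -[LHS]/(f x * lam ^+ 2 - aL - P - x) /P.
  by rewrite -/x; ring.
Qed.

Lemma size_monic_sub (u v : {poly F}) : u \is monic -> (size v < size u)%N ->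
  u - v \is monic /\ size (u - v) = size u.
Proof.
move=> um svu; split; last by rewrite size_polyDl // size_polyN.
by rewrite monicE lead_coefDl ?size_polyN // (monicP um).
Qed.

Lemma mnum_neq_Xden n : (1 < n)%N -> mul_shape n ->
  mnum n - 'X * mden n != 0.
Proof.
move=> n1 [cop d0 [mon sz] _]; rewrite subr_eq0; apply/eqP => e.
have : size (mden n) == 1%N.
  by rewrite -(coprimepp (mden n)) (coprimep_dvdr _ cop) // e dvdp_mull.
case/size_poly1P => c c0 e2; move: sz.
rewrite e e2 mulrC mul_polyC size_scale // size_polyX => -[].
by case: n n1 {cop d0 mon e e2} => [|[|n]] //; rewrite expnS; lia.
Qed.

Lemma curve_neq0 n : (0 < n)%N -> mul_shape n ->
  mnum n * (mnum n ^+ 2 + a%:P * mnum n * mden n + b%:P * mden n ^+ 2) != 0.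
Proof.
move=> n0 [cop d0 [mon sz] [sd _]].
rewrite mulf_neq0 ?monic_neq0 //.
rewrite (_ : _ + _ = mnum n ^+ 2 - (- (a%:P * mnum n * mden n
                                       + b%:P * mden n ^+ 2))); last first.
  by rewrite opprK addrA.
apply: (size_monic_sub _ _).1; first exact: monic_exp.
rewrite size_polyN [ltnRHS]polySpred ?expf_neq0 ?monic_neq0 // ltnS size_exp sz /=.
apply: leq_trans (size_polyD _ _) _; rewrite geq_max; apply/andP; split.
  rewrite -mulrA mul_polyC (leq_trans (size_scale_leq _ _)) //.
  by rewrite (leq_trans (size_polyMleq _ _)) // sz; lia.
rewrite mul_polyC (leq_trans (size_scale_leq _ _)) //.
by rewrite expr2 (leq_trans (size_polyMleq _ _)) //; lia.
Qed.

Lemma der_iota u : der u%:F = (u^`())%:F.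
Proof.
have := @derE u%:F u 1 (oner_neq0 _); rewrite rmorph1 mulr1 expr1n mulr1.
by rewrite derivC mulr0 subr0 mulr1; apply.
Qed.

Lemma derB z w : der (z - w) = der z - der w.
Proof. by apply/eqP; rewrite eq_sym subr_eq -derD subrK. Qed.

Lemma der1 : der 1 = 0.
Proof. by rewrite -(rmorph1 iota) der_iota derivC rmorph0. Qed.

Let x : L := ('X : {poly F})%:F.
Let aL : L := a%:P%:F.
Let bL : L := b%:P%:F.
Let f (z : L) := z ^+ 3 + aL * z ^+ 2 + bL * z.
Let f' (z : L) := 3%:R * z ^+ 2 + 2%:R * aL * z + bL.

Lemma der_f z : der (f z) = f' z * der z.
Proof.
have da : der aL = 0 by rewrite der_iota derivC rmorph0.
have db : der bL = 0 by rewrite der_iota derivC rmorph0.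
by rewrite /f /f' !exprS expr0 mulr1 !(derD, derM) da db; ring.
Qed.

Lemma der_x : der x = 1.
Proof. by rewrite der_iota derivX rmorph1. Qed.

Lemma der_chord P Q lam m : f P = f x * Q ^+ 2 -> P != x -> Q != 0 ->
  lam * (P - x) = Q - 1 -> der P = m * Q ->
  let P' := f x * lam ^+ 2 - aL - P - x in
  der P' = (m + 1) * (- (lam * (P' - x)) - 1).
Proof.
move=> onP Px Q0 lamE dP P'.
have da : der aL = 0 by rewrite der_iota derivC rmorph0.
rewrite -(@chord_derivative _ aL bL x P Q lam onP Px lamE m (der Q) (der lam)) //.
- rewrite /P' !derB derM !exprS expr0 mulr1 derM (der_f x) der_x da dP.
  by rewrite /f /f'; ring.
- have : der (lam * (P - x)) = der (Q - 1) by rewrite lamE.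
  by rewrite derM !derB der1 der_x dP subr0.
- have : der (f P) = der (f x * Q ^+ 2) by rewrite onP.
  rewrite derM !der_f der_x dP exprS expr1 derM => e.
  by rewrite -[LHS]/(f' P * (m * Q)) e /f /f'; ring.
Qed.

(** The next multiple [P'] is written as a reduced fraction [a' / b']. The quadratic with roots
    [a' / b'] and [mnum n / mden n] is primitive and proportional to the form [qU], [qV], [qW],
    which is primitive too, so they differ by a constant [e]; hence [qU] and [qW] are divisible by
    [mden n] and [mnum n]. *)
Lemma mul_next n : (0 < n)%N -> mul_shape n -> mul_shape n.+1 -> mul_point n ->
  mul_rec n /\ coprimep (mnum n.+2) (mden n.+2) /\ mul_point n.+1.
Proof.
move=> n0 [cn dn [mn sn] [sdn cdn]] sh1.
have [c d [mon sz] [sd cd]] := sh1.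
case=> P [Q [lam []]]; rewrite -/x -/aL -/bL => PE onP dP lamE ME.
have n1 : (1 < n.+1)%N by rewrite ltnS.
have aXb := mnum_neq_Xden n1 sh1.
have fAB := curve_neq0 (ltn0Sn n) sh1.
pose A := mnum n.+1; pose B := mden n.+1.
pose A0 := mnum n; pose B0 := mden n.
rewrite -/A -/B -/A0 -/B0 in cn dn mn sn sdn cdn c d mon sz sd cd PE ME aXb fAB *.
have iB : B%:F != 0 by rewrite iota_eq0.
have iB0 : B0%:F != 0 by rewrite iota_eq0.
rewrite -/(f P) -/(f x) in onP ME.
have AxB : (A - 'X * B)%:F = (P - x) * B%:F.
  by rewrite rmorphB rmorphM -PE; ring.
have Px : P != x.
  by apply: contraNneq aXb => e; rewrite -iota_eq0 AxB e subrr mul0r.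
have Q0 : Q != 0.
  apply: contraNneq fAB => e; rewrite -iota_eq0 !(rmorphM, rmorphD, rmorphXn) -PE.
  move: onP; rewrite e expr0n mulr0 => fP0.
  apply/eqP; transitivity (f P * B%:F ^+ 3); last by rewrite fP0 mul0r.
  by rewrite /f -/aL -/bL; ring.
have Px' : P - x != 0 by rewrite subr_eq0.
pose lam1 := (Q - 1) / (P - x).
have lam1E : lam1 * (P - x) = Q - 1 by rewrite divfK.
pose P' := f x * lam1 ^+ 2 - aL - P - x.
pose Q' := - (lam1 * (P' - x)) - 1.
pose M := f x * lam ^+ 2 - aL - P - x.
have prodE : P' * M * (P - x) ^+ 2 = (P * x - bL) ^+ 2.
  exact: (chord_product onP Px lam1E lamE).
have sumE : (P' + M) * (P - x) ^+ 2 =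
    2%:R * ((P + x) * (P * x + bL) + 2%:R * aL * P * x).
  exact: (chord_sum onP lam1E lamE).
have AX : A * 'X - b%:P * B \is monic /\ size (A * 'X - b%:P * B) = (n.+1 ^ 2).+2.
  have [||h1 h2] := @size_monic_sub (A * 'X) (b%:P * B).
  - by rewrite monicMl // monicX.
  - rewrite size_mulX ?monic_neq0 // sz mul_polyC ltnS.
    by rewrite (leq_trans (size_scale_leq _ _)) // (leq_trans sd).
  by rewrite h2 size_mulX ?monic_neq0 // sz.
have U0 : qU 'X A B != 0 by rewrite expf_neq0.
have W0 : qW b%:P 'X A B != 0 by rewrite expf_neq0 // monic_neq0 // AX.1.
have iU : (qU 'X A B)%:F = (P - x) ^+ 2 * B%:F ^+ 2.
  by rewrite /qU rmorphXn AxB exprMn.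
have iV : (qV a%:P b%:P 'X A B)%:F =
    2%:R * ((P + x) * (P * x + bL) + 2%:R * aL * P * x) * B%:F ^+ 2.
  rewrite /qV iotaMn rmorphD 4!rmorphM iotaMn 2!rmorphD 3!rmorphM -PE -/x -/aL -/bL.
  by ring.
have iW : (qW b%:P 'X A B)%:F = (P * x - bL) ^+ 2 * B%:F ^+ 2.
  by rewrite /qW rmorphXn rmorphB 2!rmorphM -PE -/x -/bL; ring.
have [a' [b' [b'0 cop' P'E]]] := frac_red P'.
have e1 : b' * B0 * qV a%:P b%:P 'X A B = (a' * B0 + A0 * b') * qU 'X A B.
  apply: iota_inj; rewrite 2!rmorphM iV -sumE rmorphM rmorphD 2!rmorphM.
  by rewrite -P'E -ME -/M iU; ring.
have e2 : b' * B0 * qW b%:P 'X A B = (a' * A0) * qU 'X A B.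
  apply: iota_inj; rewrite 2!rmorphM iW -prodE rmorphM rmorphM.
  by rewrite -P'E -ME -/M iU; ring.
have two0 : (2%:R : F) != 0 by rewrite natr_neq0.
have primF := forms_primitive two0 b0 disc0 c.
have [e e0 [eU eV eW]] := primitive3_proportional U0 (mulf_neq0 b'0 dn)
  primF (primitive3_coprime cop' cn) e1 e2.
have eK (u v : {poly F}) : u = e *: v -> e^-1 *: u = v.
  by move=> ->; rewrite scalerA mulVf // scale1r.
have numE : mnum n.+2 = e^-1 *: a'.
  by rewrite mnumSS // -/A -/B -/A0 -(eK _ _ eW) scalerAl mulpK // monic_neq0.
have denE : mden n.+2 = e^-1 *: b'.
  by rewrite mdenSS // -/A -/B -/B0 -(eK _ _ eU) scalerAl mulpK.
have ei0 : e^-1 != 0 by rewrite invr_eq0.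
split; first split.
- by rewrite denE -scalerAl (eK _ _ eU).
- by rewrite denE numE -scalerAl -scalerAr -scalerDr
    (eK _ _ eV).
- by rewrite numE -scalerAl (eK _ _ eW).
split; first by rewrite numE denE coprimepZl // coprimepZr.
exists P', Q', lam1; rewrite -/x -/aL -/bL -/(f x) -/(f P'); split.
- by rewrite numE denE -!mul_polyC !rmorphM mulrCA P'E.
- exact: (chord_on_curve onP Px lam1E).
- rewrite -(natr1 n.+1); exact: (der_chord onP Px Q0 lam1E dP).
(* The line that produced [P'] passes through [(P', - Q')] and [(x, 1)], so its slope also serves to
   subtract [(x, 1)] from the new point. *)
- by rewrite /Q'; ring.
- rewrite -/A -/B -PE; congr (_ * _).
  by rewrite /P' /f; ring.
Qed.

Lemma mul_shape_next n : (0 < n)%N -> (n.+2 <= p)%N ->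
  mul_shape n -> mul_shape n.+1 -> mul_rec n ->
  coprimep (mnum n.+2) (mden n.+2) -> mul_shape n.+2.
Proof.
move=> n0 n2p [cn dn [mn sn] [sdn cdn]] sh1 [eU _ eW] c2.
have sq1 : (n.+1 ^ 2 = n ^ 2 + 2 * n + 1)%N by rewrite -addn1 sqrnD; lia.
have sq2 : (n.+2 ^ 2 = n ^ 2 + 4 * n + 4)%N by rewrite -addn2 sqrnD; lia.
have [c d [mon sz] [sd cd]] := sh1.
have n1 : (1 < n.+1)%N by rewrite ltnS.
have aXb := mnum_neq_Xden n1 sh1.
pose A := mnum n.+1; pose B := mden n.+1.
rewrite -/A -/B in eU eW c d mon sz sd cd aXb.
have U0 : qU 'X A B != 0 by rewrite expf_neq0.
have AX : A * 'X - b%:P * B \is monic /\ size (A * 'X - b%:P * B) = (n.+1 ^ 2).+2.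
  have [||h1 h2] := @size_monic_sub (A * 'X) (b%:P * B).
  - by rewrite monicMl // monicX.
  - rewrite size_mulX ?monic_neq0 // sz mul_polyC ltnS.
    by rewrite (leq_trans (size_scale_leq _ _)) // (leq_trans sd).
  by rewrite h2 size_mulX ?monic_neq0 // sz.
have Wm : qW b%:P 'X A B \is monic by rewrite monic_exp // AX.1.
have d2 : mden n.+2 != 0.
  by apply: contraNneq U0 => h; rewrite -eU h mul0r.
have a2 : mnum n.+2 != 0.
  by apply: contraTneq Wm => h; rewrite -eW h mul0r monicE lead_coef0 eq_sym oner_eq0.
have an0 := monic_neq0 mn.
have m2 : mnum n.+2 \is monic.
  by move: Wm; rewrite -eW !monicE lead_coefM (monicP mn) mulr1.
have s2 : size (mnum n.+2) = (n.+2 ^ 2).+1.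
  have := size_mul a2 an0; rewrite eW /qW expr2.
  rewrite size_mul ?monic_neq0 ?AX.1 // AX.2 sn sq1 sq2.
  by clear; move: (n ^ 2)%N (size _) => k l; lia.
have nF : (n%:R : F) != 0 by rewrite natr_neq0 // n0 (leq_trans _ n2p).
have sB : size (mden n) = (n ^ 2)%N.
  apply/eqP; rewrite eqn_leq sdn -[(n ^ 2)%N]prednK ?expn_gt0 ?n0 //.
  by rewrite ltnNge; apply/negP => /leq_sizeP /(_ _ (leqnn _)) /eqP;
    rewrite cdn natrX expf_eq0 (negbTE nF) andbF.
have sAB : (size (A - 'X * B)%R <= (n.+1 ^ 2).+1)%N.
  apply: leq_trans (size_polyD _ _) _; rewrite size_polyN geq_max sz leqnn /=.
  by rewrite mulrC size_mulX // ltnS.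
have sd2 : (size (mden n.+2) <= n.+2 ^ 2)%N.
  have := size_mul d2 dn; rewrite eU /qU expr2 size_mul // sB.
  move: (polySpred d2) (n0) sAB; rewrite sq1 sq2; clear.
  by move: (n ^ 2)%N (size _) (size _) => k l l'; lia.
split=> //; split=> //.
have n20 : (0 < n ^ 2)%N by rewrite expn_gt0 n0.
have cAB : (A - 'X * B)`_(n.+1 ^ 2) = 1 - (n.+1 ^ 2)%:R.
  rewrite coefB coefXM -cd expn_eq0 /=; congr (_ - _).
  by rewrite -(monicP mon) lead_coefE sz.
(* Top coefficients in [eU]; since [(1 - (n+1)^2)^2 = n^2 (n+2)^2] and [n] is invertible below [p],
   the factor [n^2] cancels. *)
have topE : (mden n.+2)`_(n.+2 ^ 2).-1 * (n ^ 2)%:R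
    = (1 - (n.+1 ^ 2)%:R) * (1 - (n.+1 ^ 2)%:R).
  rewrite -cdn -coefM_top ?prednK ?expn_gt0 ?n0 //.
  rewrite eU /qU expr2 -cAB -coefM_top //; congr (_ `_ _).
  by rewrite sq1 sq2; move: n20; clear; move: (n ^ 2)%N; lia.
apply: (mulIf (x := (n ^ 2)%:R)); first by rewrite natrX expf_neq0.
by rewrite topE !natrX -!natr1; ring.
Qed.

Lemma mul_all n : (0 < n)%N -> (n.+1 <= p)%N ->
  [/\ mul_shape n, mul_shape n.+1 & mul_point n].
Proof.
elim: n => [//|[|n] IH] _ np.
  split; [exact: mul_shape1 | exact: mul_shape2 | exact: mul_point1].
have [|sh1 sh2 pt] := IH isT; first exact: ltnW.
have [rec [cop pt2]] := mul_next (ltn0Sn n) sh1 sh2 pt.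
by split=> //; apply: mul_shape_next.
Qed.

Lemma mul_recP n : (n.+2 <= p)%N -> mul_rec n.
Proof.
case: n => [_|n np]; first exact: mul_rec0.
have [|sh1 sh2 pt] := mul_all (ltn0Sn n); first exact: ltnW.
by have [] := mul_next (ltn0Sn n) sh1 sh2 pt.
Qed.

(** By [mul_rec], the product of the terms of index [n] and [n+2] is a square, so the shape at index
    1 is inherited by all odd indices. Geometrically, odd multiples fix the 2-torsion point
    [(0, 0)]. *)
Lemma mnum_odd k : (k.*2.+1 <= p)%N ->
  (exists2 c, c != 0 & mnum k.*2.+1 = 'X * c ^+ 2)
  /\ (exists2 d, d != 0 & mden k.*2.+1 = d ^+ 2).
Proof.
elim: k => [_|k IH kp].
  by split; exists 1; rewrite ?oner_neq0 // /mnum /mden /= expr1n ?mulr1.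
have [|[c c0 cE] [d d0 dE]] := IH; first by move: kp; rewrite doubleS; lia.
have [eU _ eW] := @mul_recP k.*2.+1 kp.
have [_ dn0 [mon _] _] : mul_shape k.+1.*2.+1.
  by have [|_] := @mul_all k.+1.*2 _ kp; first by rewrite doubleS.
rewrite doubleS in dn0 mon *; split.
  move: eW; rewrite cE /qW => eW.
  have [|s sE] := @Xsqr_cofactor _ (mnum k.*2.+3)
      (mnum k.*2.+2 * 'X - b%:P * mden k.*2.+2) c c0.
    by rewrite -eW; ring.
  exists s => //; apply: contraTneq mon => s0.
  by rewrite sE s0 expr0n mulr0 monicE lead_coef0 eq_sym oner_eq0.
move: eU; rewrite dE /qU => eU.
have [s [sE _]] := sqr_cofactor d0 eU.
by exists s => //; apply: contraNneq dn0 => s0; rewrite sE s0 expr0n.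
Qed.

Lemma mul_p : exists y : L,
  [/\ (mnum p)^`() = 0, (mden p)^`() = 0 &
   (mnum p * (mnum p ^+ 2 + a%:P * mnum p * mden p + b%:P * mden p ^+ 2)
     * mden p)%:F = fcub%:F * y ^+ 2].
Proof.
have pE : p.-1.+1 = p by rewrite prednK // ltnW // ltnW.
have [||_] := @mul_all p.-1; rewrite ?pE //; first by move: p2; case: (p) => [|[]].
case=> cop d0 [mon sz] _; case=> P [Q [lam []]]; rewrite -/x -/aL -/bL pE.
move=> PE onP dP _ _.
have der0 : (mnum p)^`() * mden p = mnum p * (mden p)^`().
  apply/eqP; rewrite -subr_eq0 -iota_eq0 -(derE d0 PE) dP.
  by rewrite -(rmorph_nat iota) -polyC_natr pcharf0 // rmorph0 !mul0r.
have a'0 : (mnum p)^`() = 0.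
  apply/eqP/negP => /negP a'0.
  have : mnum p %| (mnum p)^`() by rewrite -(Gauss_dvdpl _ cop) der0 dvdp_mulr.
  move=> /(dvdp_leq a'0); rewrite leqNgt lt_size_deriv //.
  exact: monic_neq0.
exists (Q * (mden p)%:F ^+ 2); split=> //.
  apply: (mulfI (monic_neq0 mon)).
  by rewrite -der0 a'0 mul0r mulr0.
rewrite iota_fcub !(rmorphM, rmorphD, rmorphXn) -PE -/x -/aL -/bL.
transitivity (f P * (mden p)%:F ^+ 4); first by rewrite /f; ring.
by rewrite /f onP /f; ring.
Qed.

Definition qquad : {poly F} := 'X ^+ 2 + a%:P * 'X + b%:P.

Lemma fcubE : fcub = 'X * qquad.
Proof. by rewrite /fcub /qquad; ring. Qed.

Lemma qquad_dvdp_sqr s : qquad %| s ^+ 2 -> qquad %| s.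
Proof.
have : size qquad != 1%N.
  rewrite /qquad -addrA size_polyDl ?size_polyXn //.
  rewrite (leq_ltn_trans (size_polyD _ _)) // gtn_max mul_polyC.
  rewrite (leq_ltn_trans (size_scale_leq _ _)) ?size_polyX //.
  by rewrite (leq_ltn_trans (size_polyC_leq1 _)).
case/closed_rootP => r /rootP rE.
have {}rE : r ^+ 2 + a * r + b = 0 by rewrite -[RHS]rE /qquad !hornerE.
have qE : qquad = ('X - r%:P) * ('X - (- a - r)%:P).
  have bE : b = - (r ^+ 2 + a * r) by apply/eqP; rewrite -addr_eq0 addrC rE.
  by rewrite /qquad bE !(polyCN, polyCD, polyCM, polyC_exp); ring.
have rr : coprimep ('X - r%:P) ('X - (- a - r)%:P).
  rewrite coprimep_XsubC2 //; apply: contra_neq disc0 => e.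
  have aE : a = - (2%:R * r) by rewrite -[RHS]subr0 -e; ring.
  have bE : b = r ^+ 2.
    by apply/eqP; rewrite -subr_eq0 -rE aE; apply/eqP; ring.
  by rewrite bE aE; ring.
have rt u : ('X - u%:P) %| s ^+ 2 -> ('X - u%:P) %| s.
  by rewrite !dvdp_XsubCl /root horner_exp sqrf_eq0.
rewrite qE !Gauss_dvdp // => /andP [h1 h2].
by apply/andP; split; apply: rt.
Qed.

Lemma pth_root_ex (c : F) : exists r, r ^+ p == c.
Proof.
by have [|r <-] := @nth_root_ex F p c; [rewrite (ltn_trans _ p2) | exists r].
Qed.

Lemma pthrootP (u : {poly F}) : u^`() = 0 -> exists v, u = v ^+ p.
Proof.
move=> u'0.
have charP : p \in [pchar {poly F}] by rewrite pchar_poly.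
exists (\poly_(i < size u) xchoose (pth_root_ex u`_(i * p))).
rewrite -(pFrobenius_autE charP) poly_def rmorph_sum /=.
have p0 : (0 < p)%N by rewrite (ltn_trans _ p2).
apply/polyP => i; rewrite coef_sum.
under eq_bigr => j _.
  rewrite -mul_polyC rmorphM /= !pFrobenius_autE -polyC_exp.
  rewrite (eqP (xchooseP (pth_root_ex _))) mul_polyC -exprM coefZ coefXn.
  over.
have [pi|pi] := boolP (p %| i)%N.
  case/dvdnP: pi => k ->.
  have [ks|ks] := ltnP k (size u).
    rewrite (bigD1 (Ordinal ks)) //= eqxx mulr1 big1 ?addr0 // => j jk.
    by rewrite eqn_pmul2r // eq_sym -[j == k :> nat]/(j == Ordinal ks) (negbTE jk) mulr0.
  rewrite big1 ?nth_default // => [|j _].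
    by rewrite (leq_trans ks) // leq_pmulr.
  rewrite eqn_pmul2r // gtn_eqF ?mulr0 //.
  exact: leq_trans (ltn_ord j) ks.
rewrite big1 => [|j _]; last first.
  by case: eqP => [e|]; rewrite ?mulr0 //; move: pi; rewrite e dvdn_mull.
case: i pi => [|i] pi; first by rewrite dvdn0 in pi.
have := congr1 (fun v : {poly F} => v`_i) u'0.
rewrite coef_deriv coef0 => /eqP; rewrite -mulr_natr mulf_eq0.
by rewrite -(dvdn_pcharf charF) (negbTE pi) orbF => /eqP.
Qed.

(* By [mul_p] numerator and denominator are [p]-th powers; the curve equation forces
   the [p]-th roots to be ['X] times a square and a square. *)
Lemma frob_data : odd p -> exists N0 D0 K0 : {poly F}, exists at_ bt : F,
  let N := 'X * N0 ^+ 2 in let D := D0 ^+ 2 in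
  [/\ at_ ^+ p = a /\ bt ^+ p = b, mnum p = N ^+ p /\ mden p = D ^+ p,
      coprimep N D /\ N \is monic,
      size N = p.+1 /\ (size D <= p)%N &
      N ^+ 2 + at_%:P * N * D + bt%:P * D ^+ 2 = qquad * K0 ^+ 2].
Proof.
move=> oddp; have p0 : (0 < p)%N by rewrite (ltn_trans _ p2).
have [y [A'0 B'0 curveE]] := mul_p.
have pE : p.-1.+1 = p by rewrite prednK.
have [||_] := @mul_all p.-1; rewrite ?pE //; first by move: p2; case: (p) => [|[]].
move=> shp _; have [cop d0 [mon sz] [sd _]] := shp.
have cu0 := curve_neq0 p0 shp.
have [m pm] : exists m, p = m.*2.+1.
  by exists p./2; rewrite -[LHS]odd_double_half oddp.
have [[c c0 cE] [d dn0 dE]] : (exists2 c, c != 0 & mnum p = 'X * c ^+ 2)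
  /\ (exists2 d, d != 0 & mden p = d ^+ 2).
  by have := @mnum_odd m; rewrite -pm; apply.
have [N NE] := pthrootP A'0; have [D DE] := pthrootP B'0.
have N0 : N != 0 by apply: contraTneq mon => h;
    rewrite NE h expr0n gtn_eqF // monicE lead_coef0 eq_sym oner_eq0.
have D0 : D != 0 by apply: contraNneq d0 => h; rewrite DE h expr0n gtn_eqF.
(* As [p] is odd, a polynomial and its [p]-th power differ by a square factor, so the shapes given
   by [mnum_odd] pass to the [p]-th roots [N] and [D]. *)
have powE (u : {poly F}) : u ^+ p = u * (u ^+ m) ^+ 2.
  by rewrite pm exprS -exprM muln2.
have [||n nE] := @Xsqr_cofactor _ N ('X * c) (N ^+ m).
- by rewrite expf_neq0.
- by rewrite -mulrA -powE -NE cE; ring.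
have [||e [eE _]] := @sqr_cofactor _ D d (D ^+ m).
- by rewrite expf_neq0.
- by rewrite -powE -DE.
have [/eqP rta /eqP rtb] := (xchooseP (pth_root_ex a), xchooseP (pth_root_ex b)).
set at_ := xchoose (pth_root_ex a) in rta.
set bt := xchoose (pth_root_ex b) in rtb.
pose Z := N ^+ 2 + at_%:P * N * D + bt%:P * D ^+ 2.
have charP : p \in [pchar {poly F}] by rewrite pchar_poly.
have ZE : Z ^+ p = mnum p ^+ 2 + a%:P * mnum p * mden p + b%:P * mden p ^+ 2.
  rewrite -(pFrobenius_autE charP) /Z !(rmorphD, rmorphM, rmorphXn) /=.
  by rewrite !pFrobenius_autE -!polyC_exp rta rtb NE DE.
have Z0 : Z != 0.
  apply: contraNneq cu0 => h; rewrite -ZE h expr0n gtn_eqF // mulr0 //.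
rewrite -ZE cE dE fcubE in curveE.
(* The curve equation reads [Z * r ^+ 2 = qquad * y ^+ 2]. Thus [qquad * Z] is the square of the
   rational function [qquad * y / r], hence of a polynomial. *)
pose r := Z ^+ m * c * d.
have r0 : r != 0 by rewrite !mulf_neq0 // expf_neq0.
have ir0 : r%:F != 0 by rewrite iota_eq0.
have x0 : 'X%:F != 0 by rewrite iota_eq0 polyX_eq0.
have wE : (qquad%:F * y / r%:F) ^+ 2 = (qquad * Z)%:F.
  rewrite exprMn exprVn; apply: (mulIf (expf_neq0 2 ir0)).
  rewrite divfK ?expf_neq0 //; apply: (mulfI x0).
  transitivity (qquad%:F * ('X * qquad)%:F * y ^+ 2).
    by rewrite rmorphM; ring.
  rewrite -mulrA -curveE -!rmorphXn -!rmorphM; congr (_%:F).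
  by rewrite powE /r; ring.
have [s [t [t0 _ wtE]]] := frac_red (qquad%:F * y / r%:F).
have [|u [uE _]] := @sqr_cofactor _ (qquad * Z) s t t0.
  by apply: iota_inj; rewrite rmorphXn -wtE exprMn wE rmorphM rmorphXn.
have q0 : qquad != 0 by apply: contraNneq fcub_neq0 => h; rewrite fcubE h mulr0.
have /dvdpP [K uK] : qquad %| u by apply: qquad_dvdp_sqr; rewrite -uE dvdp_mulr.
have lcN : lead_coef N ^+ p = 1 by rewrite -lead_coef_exp -NE (monicP mon).
have lN : lead_coef N = 1.
  have cF := charF; apply/eqP; rewrite -subr_eq0.
  have : (lead_coef N - 1) ^+ p == 0.
    by rewrite -(pFrobenius_autE cF) rmorphB rmorph1 /= pFrobenius_autE lcN subrr.
  by rewrite expf_eq0 p0.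
exists n, e, K, at_, bt; rewrite /= -nE -eE; split=> //.
- split; last by rewrite monicE lN.
  by move: cop; rewrite NE DE coprimep_pexpl // coprimep_pexpr.
- have sN : (size N).-1 = p.
    apply/eqP; rewrite -(eqn_pmul2r p0) -size_exp -NE sz; apply/eqP.
    by rewrite /= mulnn.
  split; first by rewrite (polySpred N0) sN.
  have := size_exp D p; rewrite -DE => h.
  have := sd; rewrite (polySpred d0) h => h2.
  rewrite (polySpred D0) ltnNge; apply/negP => h3.
  by move: h2; rewrite ltnNge -[(p ^ 2)%N]/(p * p)%N leq_mul2r h3 orbT.
- apply: (mulfI q0); rewrite -[X in _ * X]/Z uE uK; ring.
Qed.
End Sequence.

(** * Formal degrees, exact polynomials and homogenization in characteristic [p] *)

Section TopCoef.
Variable F : fieldType.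
Implicit Types (u v : {poly F}).

(* [n] is a formal degree: [t = 0] is allowed. *)
Definition top u n t := (size u <= n.+1)%N /\ u`_n = t.

Lemma topM u v i j s t : top u i s -> top v j t -> top (u * v) (i + j) (s * t).
Proof.
move=> [su <-] [sv <-]; split; last exact: coefM_top.
rewrite (leq_trans (size_polyMleq _ _)) //.
by move: (size u) (size v) su sv => k l; lia.
Qed.

Lemma topD u v i s t : top u i s -> top v i t -> top (u + v) i (s + t).
Proof.
move=> [su <-] [sv <-]; split; last exact: coefD.
by rewrite (leq_trans (size_polyD _ _)) // geq_max su sv.
Qed.

Lemma topN u i s : top u i s -> top (- u) i (- s).
Proof. by move=> [su <-]; split; rewrite ?size_polyN ?coefN. Qed.

Lemma topZ c u i s : top u i s -> top (c *: u) i (c * s).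
Proof.
by move=> [su <-]; split; rewrite ?coefZ // (leq_trans (size_scale_leq _ _)).
Qed.

Lemma topX : top 'X 1 1.
Proof. by split; rewrite ?size_polyX ?coefX. Qed.

Lemma topMn u i s k : top u i s -> top (k%:R * u) i (k%:R * s).
Proof. by move=> h; rewrite -polyC_natr mul_polyC; apply: topZ. Qed.

Lemma top_deriv u i s : top u i.+1 s -> top u^`() i (i.+1%:R * s).
Proof.
move=> [su <-]; split; last by rewrite coef_deriv mulr_natl.
apply/leq_sizeP => j ij; rewrite coef_deriv nth_default ?mul0rn //.
by rewrite (leq_trans su).
Qed.

Lemma topX2 u i s : top u i s -> top (u ^+ 2) (i + i) (s ^+ 2).
Proof. by move=> h; rewrite !expr2; apply: topM. Qed.

Lemma top_uniq u i s t : top u i s -> top u i t -> s = t.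
Proof. by move=> [_ <-] [_ <-]. Qed.

Lemma deriv_powMpow (u v w : {poly F}) k l :
  (u ^+ k.+1 * v * w ^+ l.+1)^`() =
  k.+1%:R * u ^+ k * u^`() * v * w ^+ l.+1 + u ^+ k.+1 * v^`() * w ^+ l.+1
  + l.+1%:R * u ^+ k.+1 * v * w ^+ l * w^`().
Proof.
rewrite derivM [(_ * v)^`()]derivM !deriv_exp [_.+1.-1]/= [l.+1.-1]/=.
rewrite -[_ *+ k.+1]mulr_natl -[_ *+ l.+1]mulr_natl.
move: (u ^+ k.+1) (u ^+ k) (w ^+ l.+1) (w ^+ l) => a b c d.
by ring.
Qed.

End TopCoef.

Section CharP.
Variables (F : fieldType) (p : nat).
Hypothesis charF : p \in [pchar F].
Implicit Types (u v : {poly F}).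

Lemma deriv_pth_powM u v : (u ^+ p * v)^`() = u ^+ p * v^`().
Proof.
rewrite derivM deriv_exp -mulr_natr -polyC_natr pcharf0 //.
by rewrite !(mulr0, mul0r) add0r.
Qed.

(** This coefficient plays the part of the Cartier operator: it detects forms that are not exact. *)
Lemma coef_deriv_pred u : u^`()`_p.-1 = 0.
Proof.
have p0 : (0 < p)%N by rewrite prime_gt0 // (pcharf_prime charF).
by rewrite coef_deriv prednK // -mulr_natr pcharf0 // mulr0.
Qed.

Lemma coef_pth_power_deriv u v : (u ^+ p * v^`())`_p.-1 = 0.
Proof. by rewrite -deriv_pth_powM coef_deriv_pred. Qed.

(** Integration fails only at exponents congruent to [-1] modulo [p]; the bound excludes the second
    one, [2p - 1]. *)
Lemma antideriv u : (size u < p.*2)%N -> u`_p.-1 = 0 ->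
  exists v, u = v^`().
Proof.
have pp : (0 < p)%N by rewrite prime_gt0 // (pcharf_prime charF).
move=> su up; exists (\poly_(i < (size u).+1) (u`_i.-1 / i%:R)).
apply/polyP => i; rewrite coef_deriv coef_poly ltnS.
case: ltnP => [iu|ui]; last by rewrite nth_default // mul0rn.
have [e|ne] := eqVneq i p.-1; first by rewrite e up mul0r mul0rn.
rewrite -[RHS]mulr_natr divfK // -(dvdn_pcharf charF).
apply/negP => /dvdnP [[|[|k]] ke] //.
  by case/eqP: ne; rewrite -[i]/(i.+1.-1) ke mul1n.
by move: (leq_ltn_trans iu su); rewrite ke ltnNge -mul2n leq_pmul2r.
Qed.

(* [hom n u] is [D^n u(N/D)]. *)
Variables (N D : {poly F}).
Definition hom n u := \sum_(i < n.+1) u`_i *: (N ^+ i * D ^+ (n - i)).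

Lemma homD n u v : hom n (u + v) = hom n u + hom n v.
Proof.
by rewrite /hom -big_split; apply: eq_bigr => i _; rewrite coefD scalerDl.
Qed.

Lemma homZ n c u : hom n (c *: u) = c *: hom n u.
Proof.
by rewrite /hom scaler_sumr; apply: eq_bigr => i _; rewrite coefZ scalerA.
Qed.

Lemma homX n u : hom n.+1 ('X * u) = N * hom n u.
Proof.
rewrite /hom big_ord_recl coefXM scale0r add0r mulr_sumr.
by apply: eq_bigr => i _; rewrite coefXM /= subSS exprS -scalerAr mulrA.
Qed.

Lemma homS n u : (size u <= n.+1)%N -> hom n.+1 u = D * hom n u.
Proof.
move=> su; rewrite /hom big_ord_recr /= nth_default // scale0r addr0 mulr_sumr.
apply: eq_bigr => i _; rewrite subSn; last by rewrite -ltnS.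
by rewrite exprS -scalerAr mulrCA.
Qed.

Variables (a b : F).
Let f : {poly F} := 'X ^+ 3 + a%:P * 'X ^+ 2 + b%:P * 'X.

Lemma top_cubic_exp m : top (f ^+ m) (3 * m) 1.
Proof.
have sf : top f 3 1.
  split; last by rewrite /f !coefD !coefXn !mul_polyC !coefZ coefXn coefX /=; ring.
  rewrite /f -addrA (leq_trans (size_polyD _ _)) // geq_max size_polyXn leqnn.
  rewrite (leq_trans (size_polyD _ _)) // geq_max !mul_polyC.
  rewrite (leq_trans (size_scale_leq _ _)) ?size_polyXn //.
  by rewrite (leq_trans (size_scale_leq _ _)) ?size_polyX.
elim: m => [|m IH]; first by rewrite expr0 muln0; split; rewrite ?size_poly1 ?coef1.
by rewrite exprS mulnS -[1](mul1r 1); apply: topM.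
Qed.

Lemma hom_cubic_exp m : hom (3 * m) (f ^+ m) =
  (N * (N ^+ 2 + a%:P * N * D + b%:P * D ^+ 2)) ^+ m.
Proof.
elim: m => [|m IH].
  rewrite muln0 !expr0 /hom big_ord_recl big_ord0 coef1 expr0 subnn expr0.
  by rewrite mulr1 scale1r addr0.
have [sz _] := top_cubic_exp m.
rewrite mulnS !add3n ![_ ^+ m.+1]exprS -IH.
set u := f ^+ m in sz *.
have -> : f * u = 'X * ('X * ('X * u)) + (a *: ('X * ('X * u)) + b *: ('X * u)).
  by rewrite /f -!mul_polyC; ring.
rewrite !homD !homZ !homX [hom (3 * m).+1 u]homS // [hom _.+2 u]homS; last first.
  by rewrite (leq_trans sz).
rewrite [hom _.+1 u]homS // -!mul_polyC.
by ring.
Qed.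

End CharP.

(** * A supersingular isogeny is inseparable *)

(* [N / D] is the [x]-coordinate of an isogeny of degree [p] onto the Frobenius untwist
   [y^2 = ft(x)], whose [y]-coordinate is [y N0 K0 / D0^3]. *)
Section Descent.
Variables (F : closedFieldType) (m : nat).
Let p := m.*2.+1.
Hypothesis charF : p \in [pchar F].
Hypothesis m2 : (1 < m)%N.
Variables (a b at_ bt : F).
Hypothesis b0 : b != 0.
Hypothesis disc0 : a ^+ 2 - 4%:R * b != 0.
Hypothesis atE : at_ ^+ p = a.
Hypothesis btE : bt ^+ p = b.
Variables (N0 D0 K0 : {poly F}).
Let N := 'X * N0 ^+ 2.
Let D := D0 ^+ 2.
Let q : {poly F} := 'X ^+ 2 + a%:P * 'X + b%:P.
Let f : {poly F} := 'X ^+ 3 + a%:P * 'X ^+ 2 + b%:P * 'X.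
Let ft : {poly F} := 'X ^+ 3 + at_%:P * 'X ^+ 2 + bt%:P * 'X.
Hypothesis copND : coprimep N D.
Hypothesis Nmonic : N \is monic.
Hypothesis sizeN : size N = p.+1.
Hypothesis sizeD : (size D <= p)%N.
Hypothesis curveE : N ^+ 2 + at_%:P * N * D + bt%:P * D ^+ 2 = q * K0 ^+ 2.

(** The derivative of [N / D] is [N0 * K1 / D0 ^+ 3]. Compared with the [y]-coordinate of the
    isogeny, [K1 / K0] is the factor by which it multiplies [dx/y]. *)
Let K1 := (N0 + 2%:R * 'X * N0^`()) * D0 - 2%:R * 'X * N0 * D0^`().
Let J := N^`() * D - N * D^`().

Lemma wronskE : J = N0 * D0 * K1.
Proof. by rewrite /J /K1 /N /D !derivE /=; ring. Qed.

Lemma p_natr0 : (p%:R : F) = 0. Proof. exact: pcharf0 charF. Qed.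

Let natr_ne0 := natr_pchar_neq0 charF.

Lemma two_ne0 : (2%:R : F) != 0. Proof. by rewrite natr_ne0 // /p; lia. Qed.

Lemma frobB (u v : F) : (u - v) ^+ p = u ^+ p - v ^+ p.
Proof. by rewrite -!(pFrobenius_autE charF) rmorphB. Qed.

Lemma bt0 : bt != 0.
Proof. by apply: contraNneq b0 => h; rewrite -btE h expr0n. Qed.

Lemma disct0 : at_ ^+ 2 - 4%:R * bt != 0.
Proof.
apply: contraNneq disc0 => h.
have : (at_ ^+ 2 - 4%:R * bt) ^+ p = 0 by rewrite h expr0n.
have e1 : (at_ ^+ 2) ^+ p = a ^+ 2 by rewrite -exprM mulnC exprM atE.
have e2 : (4%:R : F) ^+ p = 4%:R.
  by rewrite -(pFrobenius_autE charF 4%:R) rmorph_nat.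
by rewrite frobB e1 [(4%:R * bt) ^+ p]exprMn e2 btE => ->.
Qed.

Lemma N0_neq0 : N0 != 0.
Proof.
apply: contraTneq Nmonic => h.
by rewrite /N h expr0n mulr0 monicE lead_coef0 eq_sym oner_eq0.
Qed.

Lemma D0_neq0 : D0 != 0.
Proof.
apply/eqP => h; have := copND; rewrite /D h expr0n coprimep0 => e.
by have := eqp_size e; rewrite sizeN size_poly1.
Qed.

Lemma sizeN0 : size N0 = m.+1.
Proof.
have := sizeN; rewrite /N mulrC size_mulX ?expf_neq0 ?N0_neq0 //.
rewrite (polySpred (expf_neq0 2 N0_neq0)) size_exp (polySpred N0_neq0) /= /p.
by move: (size N0).-1 => k; lia.
Qed.

Lemma sizeD0 : (size D0 <= m.+1)%N.
Proof.
have := sizeD; rewrite /D [size (D0 ^+ 2)]polySpred ?expf_neq0 ?D0_neq0 //.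
rewrite size_exp (polySpred D0_neq0) /= /p.
by move: (size D0).-1 => k; lia.
Qed.

Let nu := lead_coef N0.

Lemma nu2 : nu ^+ 2 = 1.
Proof.
have := monicP Nmonic; rewrite /N lead_coefM lead_coefX mul1r.
by rewrite lead_coef_exp.
Qed.

Lemma topN0 : top N0 m nu.
Proof. by split; rewrite ?sizeN0 // /nu lead_coefE sizeN0. Qed.

Lemma topD0 : top D0 m D0`_m.
Proof. by split; rewrite ?sizeD0. Qed.

Lemma topNp : top N p 1.
Proof. by split; rewrite ?sizeN // -(monicP Nmonic) lead_coefE sizeN. Qed.

Lemma topDp : top D p 0.
Proof. by split; rewrite ?nth_default // leqW. Qed.

Lemma topq : top q 2 1.
Proof.
split; last by rewrite /q !coefD coefXn coefC !mul_polyC !coefZ coefX /=; ring.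
rewrite /q -addrA (leq_trans (size_polyD _ _)) // geq_max size_polyXn leqnn.
rewrite (leq_trans (size_polyD _ _)) // geq_max !mul_polyC.
rewrite (leq_trans (size_scale_leq _ _)) ?size_polyX //.
by rewrite (leq_trans (size_polyC_leq1 _)).
Qed.

Lemma fE : f = 'X * q. Proof. by rewrite /f /q; ring. Qed.

Lemma topf : top f 3 1.
Proof. by rewrite fE -[1](mul1r 1); apply: (topM (topX F) topq). Qed.

Lemma topR : top (q * K0 ^+ 2) (p + p) 1.
Proof.
rewrite -curveE.
have -> : (1 : F) = 1 ^+ 2 + at_ * (1 * 0) + bt * 0 ^+ 2 by ring.
apply: topD; last by rewrite mul_polyC; apply/topZ/topX2/topDp.
apply: topD; first exact/topX2/topNp.
by rewrite -mulrA mul_polyC; apply/topZ/(topM topNp topDp).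
Qed.

Lemma K0_neq0 : K0 != 0.
Proof.
apply: contra_eqN (topR.2) => /eqP ->.
by rewrite expr0n mulr0 coef0 eq_sym oner_eq0.
Qed.

Lemma q_neq0 : q != 0.
Proof. by apply: contra_eqN (topq.2) => /eqP ->; rewrite coef0 eq_sym oner_eq0. Qed.

Lemma sizeR : size (q * K0 ^+ 2) = (p + p).+1.
Proof.
have [s t] := topR; apply/eqP; rewrite eqn_leq s ltnNge; apply/negP.
by move=> /leq_sizeP /(_ _ (leqnn _)) /eqP; rewrite t oner_eq0.
Qed.

Lemma sizeq : size q = 3%N.
Proof.
have [s t] := topq; apply/eqP; rewrite eqn_leq s ltnNge; apply/negP.
by move=> /leq_sizeP /(_ _ (leqnn _)) /eqP; rewrite t oner_eq0.
Qed.

Lemma sizeK0 : size K0 = p.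
Proof.
have := sizeR; rewrite size_mul ?q_neq0 ?expf_neq0 ?K0_neq0 // sizeq.
rewrite [size (K0 ^+ 2)]polySpred ?expf_neq0 ?K0_neq0 // size_exp.
by rewrite (polySpred K0_neq0) /= /p; move: (size K0).-1 => k; lia.
Qed.

Lemma topK0 : top K0 m.*2 (lead_coef K0).
Proof. by split; rewrite ?sizeK0 // lead_coefE sizeK0. Qed.

Lemma kappa2 : lead_coef K0 ^+ 2 = 1.
Proof.
have h := topM topq (topX2 topK0); rewrite mul1r in h.
by apply: (top_uniq h); have := topR; rewrite /p; congr top; lia.
Qed.

Lemma curve_at r : N.[r] ^+ 2 + at_ * N.[r] * D.[r] + bt * D.[r] ^+ 2
  = q.[r] * K0.[r] ^+ 2.
Proof.
have := congr1 (fun u : {poly F} => u.[r]) curveE.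
by rewrite /= !(hornerD, hornerM, horner_exp, hornerC).
Qed.

Lemma copK0D0 : coprimep K0 D0.
Proof.
apply: no_common_root_coprimep => r Kr Dr; have := curve_at r.
have Dr0 : D.[r] = 0 by rewrite /D horner_exp Dr expr0n.
rewrite Kr Dr0 expr0n !mulr0 !addr0 => /eqP; rewrite expf_eq0 => /eqP Nr.
exact: coprimep_root_absurd copND r Nr Dr0.
Qed.

Lemma copK0N0 : coprimep K0 N0.
Proof.
apply: no_common_root_coprimep => r Kr Nr; have := curve_at r.
have Nr0 : N.[r] = 0 by rewrite /N hornerM horner_exp Nr expr0n mulr0.
rewrite Kr Nr0 expr0n !(mulr0, mul0r) !add0r => /eqP.
rewrite mulf_eq0 (negbTE bt0) expf_eq0 => /eqP Dr.
exact: coprimep_root_absurd copND r Nr0 Dr.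
Qed.

Lemma copK0T : coprimep K0 (2%:R *: N + at_ *: D).
Proof.
apply: no_common_root_coprimep => r Kr; rewrite hornerD !hornerZ => Tr; have := curve_at r.
rewrite Kr expr0n !mulr0 => Rr.
have Dr : (at_ ^+ 2 - 4%:R * bt) * D.[r] ^+ 2 = 0.
  transitivity ((2%:R * N.[r] + at_ * D.[r]) ^+ 2
    - 4%:R * (N.[r] ^+ 2 + at_ * N.[r] * D.[r] + bt * D.[r] ^+ 2)).
    by ring.
  by rewrite Rr Tr expr0n mulr0 subr0.
have {}Dr : D.[r] = 0.
  by apply/eqP; move/eqP: Dr; rewrite mulf_eq0 (negbTE disct0) expf_eq0.
have Nr : N.[r] = 0.
  apply/eqP; move/eqP: Tr; rewrite Dr mulr0 addr0 mulf_eq0.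
  by rewrite (negbTE two_ne0).
exact: coprimep_root_absurd copND r Nr Dr.
Qed.

(* A root of [K0] maps to a 2-torsion point, where the derivative of [N/D] vanishes. *)
Lemma K0_dvd_K1 : K0 %| K1.
Proof.
have e : (2%:R *: N + at_ *: D) * J = D * (q * K0 ^+ 2)^`()
     - 2%:R * D^`() * (q * K0 ^+ 2).
  rewrite -curveE /J -!mul_polyC !derivE /= polyC_natr.
  by ring.
have h1 : K0 %| (2%:R *: N + at_ *: D) * J.
  have -> : (2%:R *: N + at_ *: D) * J = (D * (q^`() * K0 + 2%:R * q * K0^`())
     - 2%:R * D^`() * q * K0) * K0.
    by rewrite e !derivM; ring.
  exact: dvdp_mulIr.
have h2 : K0 %| J by rewrite -(Gauss_dvdpr _ copK0T).
have h3 : K0 %| N0 * (D0 * K1) by rewrite mulrA -wronskE.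
by move: h3; rewrite (Gauss_dvdpr _ copK0N0) (Gauss_dvdpr _ copK0D0).
Qed.

Lemma topK1 : top K1 m.*2 (nu * D0`_m).
Proof.
have mE : m = m.-1.+1 by rewrite prednK // ltnW.
have [tN tD] := (topN0, topD0).
have tN' : top N0^`() m.-1 (m%:R * nu) by rewrite [X in X%:R]mE; apply: top_deriv; rewrite -mE.
have tD' : top D0^`() m.-1 (m%:R * D0`_m) by rewrite [X in X%:R]mE; apply: top_deriv; rewrite -mE.
have t1 : top (2%:R * 'X * N0^`()) m (2%:R * (m%:R * nu)).
  rewrite -mulrA; apply: topMn; rewrite -[m%:R * nu]mul1r.
  by have := topM (topX F) tN'; rewrite add1n -mE.
have t2 : top (2%:R * 'X * N0 * D0^`()) (m + m) (2%:R * (nu * (m%:R * D0`_m))).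
  rewrite -!mulrA; apply: topMn; rewrite -[nu * _]mul1r.
  by have := topM (topX F) (topM tN tD'); congr top; rewrite {3}mE; lia.
have := topD (topM (topD tN t1) tD) (topN t2).
rewrite addnn; congr top.
transitivity ((p%:R - (m%:R + m%:R)) * nu * D0`_m).
  by rewrite /p -[m.*2.+1]addn1 -addnn !natrD; ring.
by rewrite /p -[m.*2.+1]addn1 -addnn !natrD; ring.
Qed.

(** [K0] divides [K1] and has degree [p - 1], the bound for [K1]: an invariant differential pulls
    back to a constant multiple of an invariant differential. *)
Lemma K1E : exists c, K1 = c *: K0.
Proof.
have /dvdpP [u uE] := K0_dvd_K1; have [s _] := topK1.
have [u0|u0] := eqVneq u 0; first by exists 0; rewrite uE u0 mul0r scale0r.
have su : (size u <= 1)%N.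
  move: s; rewrite uE size_mul ?K0_neq0 // sizeK0 /p.
  by rewrite (polySpred u0); move: (size u).-1 => k; lia.
by exists u`_0; rewrite uE {1}(size1_polyC su) mul_polyC.
Qed.

(** [N] and [D] have zero derivative, hence involve only exponents divisible by [p]; the degrees are
    [p] and less than [p], and [N] has no constant term. *)
Lemma wronsk0_insep : K1 = 0 -> N = 'X ^+ p /\ exists2 d, d != 0 & D = d%:P.
Proof.
move=> K10; have : N^`() * D = N * D^`().
  by apply/eqP; rewrite -subr_eq0 -/J wronskE K10 mulr0.
move=> e.
have N'0 : N^`() = 0.
  apply/eqP/negP => /negP N'0.
  have : N %| N^`() by rewrite -(Gauss_dvdpl _ copND) e dvdp_mulr.
  by move=> /(dvdp_leq N'0); rewrite leqNgt lt_size_deriv ?monic_neq0.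
have D'0 : D^`() = 0.
  by apply: (mulfI (monic_neq0 Nmonic)); rewrite -e N'0 mul0r mulr0.
have coef0' (u : {poly F}) i : u^`() = 0 -> ~~ (p %| i)%N -> u`_i = 0.
  case: i => [|i] u'0 pi; first by rewrite dvdn0 in pi.
  have := congr1 (fun v : {poly F} => v`_i) u'0.
  rewrite coef_deriv coef0 => /eqP; rewrite -mulr_natr mulf_eq0.
  by rewrite -(dvdn_pcharf charF) (negbTE pi) orbF => /eqP.
split.
  apply/polyP => i; rewrite coefXn.
  have [->|ip] := eqVneq i p; first by rewrite -(monicP Nmonic) lead_coefE sizeN.
  have [pi|] := boolP (p %| i)%N; last exact: coef0'.
  have [->|i0] := eqVneq i 0%N; first by rewrite /N coefXM.
  rewrite nth_default // sizeN ltn_neqAle eq_sym ip dvdn_leq // lt0n //.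
exists D`_0.
  apply: contraNneq D0_neq0 => h; suff: D == 0 by rewrite /D expf_eq0.
  apply/eqP/polyP => i; rewrite coef0.
  have [pi|] := boolP (p %| i)%N; last exact: coef0'.
  have [->|i0] := eqVneq i 0%N; first by [].
  by rewrite nth_default // (leq_trans sizeD) // dvdn_leq // lt0n.
apply/polyP => i; rewrite coefC.
have [->//|i0] := eqVneq i 0%N.
have [pi|] := boolP (p %| i)%N; last exact: coef0'.
by rewrite nth_default // (leq_trans sizeD) // dvdn_leq // lt0n.
Qed.

Section Separable.
Variable c : F.
Hypothesis c0 : c != 0.
Hypothesis K1c : K1 = c *: K0.

Let delta := D0`_m.

Lemma ckE : c * lead_coef K0 = nu * delta.
Proof. by have := topZ c topK0; rewrite -K1c => h; apply: top_uniq h topK1. Qed.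

(** [nu] and the leading coefficient of [K0] both square to 1. Hence [delta] is nonzero and [D0] has
    full degree [m]: the kernel consists of the origin and [m] pairs of opposite points. *)
Lemma delta2 : delta ^+ 2 = c ^+ 2.
Proof.
rewrite -[LHS]mul1r -nu2 -[RHS]mulr1 -kappa2.
by rewrite -!exprMn ckE.
Qed.

Lemma delta0 : delta != 0.
Proof.
apply: contraNneq c0 => h; move: delta2; rewrite h expr0n => /esym/eqP.
by rewrite expf_eq0.
Qed.

Lemma sizeD0E : size D0 = m.+1.
Proof.
apply/eqP; rewrite eqn_leq sizeD0 ltnNge; apply/negP.
by move=> /leq_sizeP /(_ _ (leqnn _)) /eqP; rewrite -/delta (negbTE delta0).
Qed.

Lemma copD0X : coprimep D0 'X.
Proof.
apply: no_common_root_coprimep => r Dr; rewrite hornerX => r0.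
apply: (coprimep_root_absurd copND (x := r)).
  by rewrite /N hornerM hornerX r0 mul0r.
by rewrite /D horner_exp Dr expr0n.
Qed.

Lemma copD0N0 : coprimep D0 N0.
Proof.
apply: no_common_root_coprimep => r Dr Nr; apply: (coprimep_root_absurd copND (x := r)).
  by rewrite /N hornerM horner_exp Nr expr0n mulr0.
by rewrite /D horner_exp Dr expr0n.
Qed.

Lemma copD0D0' : coprimep D0 D0^`().
Proof.
apply: no_common_root_coprimep => r Dr D'r; apply: (coprimep_root_absurd copK0D0 (x := r)) => //.
have : K1.[r] = 0 by rewrite /K1 hornerD hornerN !hornerM Dr D'r !mulr0 subr0.
by rewrite K1c hornerZ => /eqP; rewrite mulf_eq0 (negbTE c0) => /eqP.
Qed.

Lemma cop2 : coprimep D0 2%:R.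
Proof. by rewrite -polyC_natr -alg_polyC coprimepZr ?coprimep1 // two_ne0. Qed.

(* The divisibilities up to [D2_dvd_Lambda] express that
   [c^2 N/D + (4 f (D0'/D0)' + 2 f' D0'/D0)] has no pole, so that it is a constant [mu];
   the bracket is four times the second derivative of [log D0] along [y d/dx]. *)
Let alpha := N0 + 2%:R * 'X * N0^`().
Let G1 := - (at_%:P * 'X * N0 ^+ 2 + bt%:P * D0 ^+ 2).
Let c2 : {poly F} := (c ^+ 2)%:P.
Let Theta := c2 * 'X * N0 ^+ 3 - 4%:R * q * ('X * N0 * D0^`() ^+ 2 - alpha * D0^`() * D0).
Let Psi := c2 * N0 ^+ 2 - 4%:R * q * D0^`() ^+ 2.

Lemma N4E : 'X ^+ 2 * N0 ^+ 4 - q * K0 ^+ 2 = D0 ^+ 2 * G1.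
Proof. by rewrite -curveE /G1 /N /D; ring. Qed.

Lemma c2K0 : c2 * K0 ^+ 2 = K1 ^+ 2.
Proof. by rewrite K1c -mul_polyC /c2 polyC_exp; ring. Qed.

Lemma D2_dvd_Theta : D0 ^+ 2 %| Theta.
Proof.
have : D0 ^+ 2 %| 'X * (N0 * Theta).
  (* The curve equation [N4E] is multiplied by [c2], which turns [K0 ^+ 2] into [K1 ^+ 2]; expanding
     [K1] leaves [Theta] up to multiples of [D0 ^+ 2]. *)
  have -> : 'X * (N0 * Theta) = D0 ^+ 2 * (q * alpha ^+ 2 + c2 * G1).
    have -> : D0 ^+ 2 * (q * alpha ^+ 2 + c2 * G1)
      = q * (D0 ^+ 2 * alpha ^+ 2) + c2 * (D0 ^+ 2 * G1) by ring.
    rewrite -N4E.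
    transitivity (c2 * 'X ^+ 2 * N0 ^+ 4 - q * (c2 * K0 ^+ 2)
      + q * K1 ^+ 2 - q * (K1 ^+ 2 - D0 ^+ 2 * alpha ^+ 2)); last first.
      by rewrite -c2K0; ring.
    by rewrite c2K0 /K1 -/alpha /Theta; ring.
  exact: dvdp_mulIl.
by rewrite !Gauss_dvdpr ?coprimep_expl ?copD0X ?copD0N0.
Qed.

Lemma D_dvd_Psi : D0 %| Psi.
Proof.
have : D0 %| 'X * (N0 * Psi).
  have -> : 'X * (N0 * Psi) = Theta - D0 * (4%:R * q * alpha * D0^`()).
    by rewrite /Theta /Psi; ring.
  rewrite dvdp_add ?dvdpNr ?dvdp_mulIl //.
  by apply: dvdp_trans D2_dvd_Theta; rewrite expr2 dvdp_mulIl.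
by rewrite !Gauss_dvdpr ?copD0X ?copD0N0.
Qed.

Let q' : {poly F} := 2%:R * 'X + a%:P.
Let Phi := 4%:R * 'X * q * N0 * D0^`()^`() - 2%:R * q * N0 * D0^`()
  + 2%:R * 'X * q' * N0 * D0^`() - 8%:R * 'X * q * N0^`() * D0^`().

Lemma deriv_q : q^`() = q'.
Proof. by rewrite /q /q' !derivE; ring. Qed.

Lemma D_dvd_Phi : D0 %| Phi.
Proof.
(* The derivative of [E] is computed twice, from [E = D0 ^+ 2 * G1] and from the definition with
   [c2 * K0 ^+ 2 = K1 ^+ 2]. Modulo [D0] and [Psi] the comparison leaves [Phi] times factors prime
   to [D0]. *)
pose E := 'X ^+ 2 * N0 ^+ 4 - q * K0 ^+ 2.
have E' : E^`() = D0 * (2%:R * D0^`() * G1 + D0 * G1^`()).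
  by rewrite /E N4E expr2 derivM [(D0 * D0)^`()]derivM; ring.
have E'2 : c2 * E^`() = c2 * (2%:R * 'X * N0 ^+ 4 + 4%:R * 'X ^+ 2 * N0 ^+ 3 * N0^`())
   - q' * K1 ^+ 2 - 2%:R * q * K1 * K1^`().
  have -> : K1^`() = c%:P * K0^`() by rewrite K1c derivZ mul_polyC.
  have -> : 2%:R * q * K1 * (c%:P * K0^`()) = c2 * (2%:R * q * K0 * K0^`()).
    by rewrite K1c -mul_polyC /c2 polyC_exp; ring.
  have d1 : ('X ^+ 2 * N0 ^+ 4)^`() = 2%:R * 'X * N0 ^+ 4
      + 4%:R * 'X ^+ 2 * N0 ^+ 3 * N0^`().
    by rewrite derivM derivXn deriv_exp /=; ring.
  have d2 : (q * K0 ^+ 2)^`() = q' * K0 ^+ 2 + 2%:R * q * K0 * K0^`().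
    by rewrite derivM deriv_q deriv_exp /=; ring.
  by rewrite -c2K0 /E derivB d1 d2; ring.
pose k1 := - (2%:R * 'X * N0 * D0^`()).
pose k1' := - (N0 * D0^`() + 2%:R * 'X * N0 * D0^`()^`()).
have K1m : K1 = k1 + D0 * alpha by rewrite /K1 /k1 -/alpha; ring.
have K1'm : K1^`() = k1' + D0 * alpha^`().
  rewrite /K1 -/alpha derivB !derivM derivX -polyC_natr derivC polyC_natr.
  by rewrite /k1' /alpha; ring.
have : D0 %| 2%:R * ('X * (N0 * (D0^`() * Phi))).
  have -> : 2%:R * ('X * (N0 * (D0^`() * Phi))) =
    Psi * (2%:R * 'X * N0 ^+ 2 + 4%:R * 'X ^+ 2 * N0 * N0^`())
    - D0 * (c2 * (2%:R * D0^`() * G1 + D0 * G1^`())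
         + q' * alpha * (2%:R * k1 + D0 * alpha)
         + 2%:R * q * (k1 * alpha^`() + alpha * K1^`())).
    have -> : D0 * (c2 * (2%:R * D0^`() * G1 + D0 * G1^`())
         + q' * alpha * (2%:R * k1 + D0 * alpha)
         + 2%:R * q * (k1 * alpha^`() + alpha * K1^`())) =
       c2 * E^`() + D0 * (q' * alpha * (2%:R * k1 + D0 * alpha)
         + 2%:R * q * (k1 * alpha^`() + alpha * K1^`())) by rewrite E'; ring.
    by rewrite E'2 K1'm K1m /Psi /Phi /k1 /k1'; ring.
  by rewrite dvdp_add ?dvdpNr ?dvdp_mulIl // dvdp_mulr // D_dvd_Psi.
by rewrite !Gauss_dvdpr ?cop2 ?copD0X ?copD0N0 ?copD0D0'.
Qed.

Let f' : {poly F} := 3%:R * 'X ^+ 2 + 2%:R * a%:P * 'X + b%:P.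
Let Lambda := c2 * 'X * N0 ^+ 2 + 4%:R * f * (D0^`()^`() * D0 - D0^`() ^+ 2)
  + 2%:R * f' * D0^`() * D0.

Lemma deriv_f : f^`() = f'.
Proof. by rewrite /f /f' !derivE; ring. Qed.

Lemma D2_dvd_Lambda : D0 ^+ 2 %| Lambda.
Proof.
have : D0 ^+ 2 %| N0 * Lambda.
  have -> : N0 * Lambda = Theta + D0 * Phi.
    by rewrite /Lambda /Theta /Phi /alpha /f /f' /q /q'; ring.
  by rewrite dvdp_add ?D2_dvd_Theta // expr2 dvdp_mul2l ?D0_neq0 // D_dvd_Phi.
by rewrite Gauss_dvdpr // coprimep_expl // copD0N0.
Qed.

(** By degrees alone the quotient of [Lambda] by [D0 ^+ 2] could be linear. Its leading term
    vanishes because the coefficient found here is [(2m + 1) delta^2 = p delta^2]. *)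
Lemma topLambda : top Lambda m.*2.+1 0.
Proof.
have m1E : m = m.-1.+1 by rewrite prednK // ltnW.
have m2E : m.-1 = m.-2.+1 by move: m2; case: (m) => [|[]].
have [tN tD] := (topN0, topD0); rewrite -/delta in tD.
have tD' : top D0^`() m.-1 (m%:R * delta).
  by rewrite [X in X%:R]m1E; apply: top_deriv; rewrite -m1E.
have tD'' : top D0^`()^`() m.-2 (m.-1%:R * (m%:R * delta)).
  by rewrite [X in X%:R]m2E; apply: top_deriv; rewrite -m2E.
have tf' : top f' 2 3%:R.
  have := top_deriv topf; rewrite deriv_f mulr1; exact.
have t1 : top (c2 * 'X * N0 ^+ 2) m.*2.+1 (c ^+ 2 * (1 * nu ^+ 2)).
  rewrite -mulrA mul_polyC; apply: topZ.
  by have := topM (topX F) (topX2 tN); rewrite add1n addnn.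
have t2 : top (4%:R * f * (D0^`()^`() * D0 - D0^`() ^+ 2)) m.*2.+1
   (4%:R * (1 * (m.-1%:R * (m%:R * delta) * delta - (m%:R * delta) ^+ 2))).
  rewrite -mulrA; apply: topMn.
  have t : top (- D0^`() ^+ 2) (m.-2 + m) (- (m%:R * delta) ^+ 2).
    by have := topN (topX2 tD'); congr top; lia.
  have := topM topf (topD (topM tD'' tD) t).
  by congr top; lia.
have t3 : top (2%:R * f' * D0^`() * D0) m.*2.+1
    (2%:R * (3%:R * (m%:R * delta * delta))).
  have -> : 2%:R * f' * D0^`() * D0 = 2%:R * (f' * (D0^`() * D0)) by ring.
  apply: topMn; have := topM tf' (topM tD' tD).
  by congr top; lia.
have := topD (topD t1 t2) t3; rewrite -delta2 nu2 !mulr1 mul1r.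
congr top.
have pm : (m.-1%:R : F) = m%:R - 1 by rewrite [in RHS]m1E -natr1 addrK.
have := p_natr0; rewrite /p -addn1 -addnn !natrD => p0.
transitivity ((m%:R + m%:R + 1%:R) * delta ^+ 2); last by rewrite p0 mul0r.
by rewrite pm; ring.
Qed.

Lemma LambdaE : exists mu, Lambda = mu *: D0 ^+ 2.
Proof.
have /dvdpP [u uE] := D2_dvd_Lambda; have [s t] := topLambda.
have [u0|u0] := eqVneq u 0; first by exists 0; rewrite uE u0 mul0r scale0r.
have sL : (size Lambda <= m.*2.+1)%N.
  apply/leq_sizeP => j; rewrite leq_eqVlt => /orP [/eqP <- //|h].
  by rewrite nth_default // (leq_trans s).
have su : (size u <= 1)%N.
  move: sL; rewrite uE size_mul ?expf_neq0 ?D0_neq0 //.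
  rewrite (polySpred (expf_neq0 2 D0_neq0)) size_exp sizeD0E /=.
  by rewrite (polySpred u0); move: (size u).-1 => k; lia.
by exists u`_0; rewrite uE {1}(size1_polyC su) mul_polyC.
Qed.

Let H := f ^+ m.
Hypothesis hasse : H`_p.-1 = 0.

Lemma doublem1 : (m.*2%:R : {poly F}) = - 1.
Proof.
apply/eqP; rewrite -addr_eq0 natr1 -polyC_natr.
by rewrite p_natr0.
Qed.

Lemma four_mS : (4%:R * m.+1%:R : {poly F}) = 2%:R.
Proof.
have -> : (4%:R : {poly F}) * m.+1%:R = 2%:R * m.*2.+2%:R.
  by rewrite -!natrM; congr _%:R; lia.
by rewrite -[m.*2.+2]addn2 natrD doublem1; ring.
Qed.

(** As [2 (m + 1) = 1] in [F], the derivative of [4 f^(m+1) D0'/D0] is [f^m] times the bracket in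
    [Lambda], while [f^m] itself is a derivative since the Hasse invariant vanishes. The factor
    [D0 ^+ p] clears the denominators and is constant for the derivation. *)
Lemma residue_form : exists mu G,
  c2 * 'X * N0 ^+ 2 * D0 ^+ m.*2.-1 * H =
  mu *: (D0 ^+ p * G^`()) - 4%:R * (f ^+ m.+1 * D0^`() * D0 ^+ m.*2)^`().
Proof.
have [mu muE] := LambdaE.
have sH : (size H < p.*2)%N.
  by rewrite (leq_ltn_trans (top_cubic_exp a b m).1) // /p; lia.
have [G GE] := antideriv charF sH hasse.
exists mu, G; rewrite -GE.
have m1 : (m.*2 = m.*2.-1.+1)%N by rewrite prednK // double_gt0 ltnW.
set w := D0 ^+ m.*2.-1.
have w1 : D0 ^+ m.*2 = D0 * w by rewrite m1 exprS.
have w2 : D0 ^+ p = D0 ^+ 2 * w by rewrite /p exprS w1; ring.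
have dE : 4%:R * (f ^+ m.+1 * D0^`() * D0 ^+ m.*2)^`() =
   2%:R * H * f' * D0^`() * (D0 * w) + 4%:R * H * f * D0^`()^`() * (D0 * w)
   - 4%:R * H * f * D0^`() ^+ 2 * w.
  rewrite m1 deriv_powMpow -m1 deriv_f doublem1 -/w w1.
  rewrite exprS -/H.
  transitivity ((4%:R * m.+1%:R) * (H * f' * D0^`() * (D0 * w))
     + 4%:R * H * f * D0^`()^`() * (D0 * w) - 4%:R * H * f * D0^`() ^+ 2 * w).
    by ring.
  by rewrite four_mS; ring.
rewrite dE w2 -!mul_polyC.
have -> : c2 * 'X * N0 ^+ 2 = mu%:P * D0 ^+ 2
   - (4%:R * f * (D0^`()^`() * D0 - D0^`() ^+ 2) + 2%:R * f' * D0^`() * D0).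
  by rewrite [mu%:P * _]mul_polyC -muE /Lambda; ring.
by ring.
Qed.

(* [term i] with its coefficient [ht i] is a summand of the pullback by [N/D] of
   [x ft(x)^m dx], cleared of denominators by a power [D^(p+p)].  Taking the coefficient
   of ['X^(p-1)] kills every derivative, and a derivative times a [p]-th power; of all
   the terms only [i = p - 2] is not such a product. *)
Let ht i := (ft ^+ m)`_i.
Let term i := N ^+ i.+1 * D ^+ (p + p - 3 - i) * J.

(** On the target curve, with [y]-coordinate [Y], [x ft^m dx] is [Y^p] times [x dx/Y]. The pullback
    of [dx/Y] is [c dx/y], and that of [Y^p] contributes the [p]-th power of [N0 * K0 / D0 ^+ 3] and
    one factor [y^p], which turns [dx/y] into [f^m dx]. *)
Lemma term_sum : c *: (\sum_(i < (3 * m).+1) ht i *: term i) =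
  (N0 * K0) ^+ p * (c2 * 'X * N0 ^+ 2 * D0 ^+ m.*2.-1 * H).
Proof.
have -> : \sum_(i < (3 * m).+1) ht i *: term i =
    N * J * D ^+ m.-1 * hom N D (3 * m) (ft ^+ m).
  rewrite /hom mulr_sumr; apply: eq_bigr => i _; rewrite -!scalerAr /ht /term.
  congr (_ *: _).
  have -> : (p + p - 3 - i = m.-1 + (3 * m - i))%N.
    by have := ltn_ord i; rewrite /p; move: m2; clear; lia.
  by rewrite exprS exprD; ring.
rewrite hom_cubic_exp curveE.
have -> : N * (q * K0 ^+ 2) = f * (N0 * K0) ^+ 2 by rewrite fE /N; ring.
rewrite wronskE K1c [(f * _) ^+ m]exprMn -/H -!mul_polyC /c2 polyC_exp.
have -> : (N0 * K0) ^+ p = N0 * K0 * ((N0 * K0) ^+ 2) ^+ m.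
  by rewrite /p exprS -exprM mul2n.
have -> : D0 ^+ m.*2.-1 = D0 * D ^+ m.-1.
  rewrite /D -exprM -exprS mul2n; congr (_ ^+ _); move: m2; clear; lia.
by rewrite /N; ring.
Qed.

(** In [N^(i+2) D^(k+1)] the exponents add up to [2p], so they are opposite in [F] and the
    derivative is [i + 2] times [term i]. The range of [i] lets [p] divide [i + 2] only when they
    are equal. *)
Lemma term_coef0 i : (i <= 3 * m)%N -> i.+2 != p -> (term i)`_p.-1 = 0.
Proof.
move=> im ip; pose k := (p + p - 3 - i)%N.
have kE : (k.+1 + i.+2 = p + p)%N by rewrite /k /p; move: m2 im; clear; lia.
have kn : (k.+1%:R : {poly F}) = - i.+2%:R.
  apply/eqP; rewrite -addr_eq0 -natrD kE natrD -!polyC_natr p_natr0.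
  by rewrite addr0.
have dE : (N ^+ i.+2 * D ^+ k.+1)^`() = i.+2%:R *: term i.
  rewrite derivM [(N ^+ _)^`()]deriv_exp [(D ^+ _)^`()]deriv_exp /= -/k /term -/k.
  rewrite -[_ *+ i.+2]mulr_natl -[_ *+ k.+1]mulr_natl kn /J.
  by rewrite -mul_polyC polyC_natr !exprS; ring.
have := coef_deriv_pred charF (N ^+ i.+2 * D ^+ k.+1).
rewrite dE coefZ => /eqP; rewrite mulf_eq0 -(dvdn_pcharf charF) => /orP [|/eqP //].
case/dvdnP => [[|[|j]]] // je; first by rewrite je mul1n eqxx in ip.
by move: im je; rewrite /p; move: m2; clear; nia.
Qed.

Lemma term_coef_neq0 i : i.+2 = p -> (term i)`_p.-1 != 0.
Proof.
move=> ip; have iE : i.+1 = m.*2 by move: ip; rewrite /p => -[].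
rewrite /term iE wronskE K1c.
(* [m.*2] is [p.-1], so the factor ['X] of [N] supplies exactly ['X^(p.-1)], and the coefficient is
   the value of the cofactor at 0. *)
have -> : N ^+ m.*2 * D ^+ (p + p - 3 - i) * (N0 * D0 * (c *: K0)) =
   'X^(m.*2) * ((N0 ^+ 2) ^+ m.*2 * D ^+ (p + p - 3 - i) * N0 * D0 * (c *: K0)).
  by rewrite {1}/N exprMn -mul_polyC; ring.
rewrite coefXnM /p ltnn subnn -horner_coef0 3!hornerM hornerM
  !horner_exp hornerZ.
have Dr : D0.[0] != 0.
  apply/eqP => Dr; apply: (coprimep_root_absurd copD0X (x := 0)) => //.
  by rewrite hornerX.
have Kr : K0.[0] != 0.
  apply/eqP => Kr; have := curve_at 0.
  have -> : N.[0] = 0 by rewrite /N hornerM hornerX mul0r.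
  have -> : D.[0] = D0.[0] ^+ 2 by rewrite /D horner_exp.
  rewrite Kr !expr0n !(mulr0, mul0r) !add0r => /eqP.
  by rewrite mulf_eq0 (negbTE bt0) !expf_eq0 (negbTE Dr).
have Nr : N0.[0] != 0.
  apply/eqP => Nr; have : K1.[0] = 0.
    rewrite /K1 !hornerD !hornerN !hornerM !hornerD !hornerM hornerX Nr.
    by rewrite !(mulr0, mul0r, addr0, subr0).
  by rewrite K1c hornerZ => /eqP; rewrite mulf_eq0 (negbTE c0) (negbTE Kr).
have Dz : D.[0] != 0 by rewrite /D horner_exp expf_neq0.
by rewrite !mulf_neq0 ?expf_neq0 // mulf_neq0.
Qed.

Lemma ht_pred : ht m.*2.-1 = 0.
Proof.
have mE : m.*2.-1.+1 = m.*2 by rewrite prednK // double_gt0 ltnW.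
have [mu [G resE]] := residue_form.
have : (c *: (\sum_(i < (3 * m).+1) ht i *: term i))`_p.-1 = 0.
  rewrite term_sum resE mulrBr coefB.
  rewrite -scalerAr coefZ mulrA -exprMn coef_pth_power_deriv // mulr0.
  rewrite -polyC_natr mul_polyC -scalerAr coefZ coef_pth_power_deriv //.
  by rewrite mulr0 subr0.
rewrite coefZ => /eqP; rewrite mulf_eq0 (negbTE c0) /= coef_sum => /eqP.
have im : (m.*2.-1 < (3 * m).+1)%N by move: m2; clear; lia.
rewrite (bigD1 (Ordinal im)) //= big1 ?addr0 => [|i ii]; last first.
  rewrite coefZ term_coef0 ?mulr0 //; first by rewrite -ltnS.
  apply: contra ii => /eqP e; apply/eqP/val_inj => /=.
  by move: e; rewrite /p -{1}mE => -[].
rewrite coefZ => /eqP; rewrite mulf_eq0 => /orP [/eqP //|].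
by rewrite (negbTE (term_coef_neq0 _)) // /p mE.
Qed.

(** Frobenius on coefficients carries [ft] to [f], so the [p]-th power of this coefficient is the
    Hasse invariant. *)
Lemma ht_p : ht m.*2 = 0.
Proof.
have fft : map_poly (pFrobenius_aut charF) ft = f.
  have C u : map_poly (pFrobenius_aut charF) u%:P = (u ^+ p)%:P.
    by rewrite map_polyC /= pFrobenius_autE.
  rewrite /ft /f !exprS expr0 mulr1 !(rmorphD, rmorphM) /= !map_polyX !C.
  by rewrite atE btE.
have : (ht m.*2) ^+ p = 0.
  rewrite -(pFrobenius_autE charF) /ht -coef_map rmorphXn /= fft.
  exact: hasse.
by move/eqP; rewrite expf_eq0 => /andP [_ /eqP].
Qed.

(* Coefficient of ['X^(i+3)] in [ft u' = m ft' u] for [u = ft^m]. *)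
Lemma ht_rec i : (i.+1%:R - 3%:R * m%:R) * ht i.+1
  + at_ * (i.+2%:R - 2%:R * m%:R) * ht i.+2 + bt * (i.+3%:R - m%:R) * ht i.+3 = 0.
Proof.
pose ft' : {poly F} := 3%:R * 'X ^+ 2 + 2%:R * at_%:P * 'X + bt%:P.
have dft : ft^`() = ft' by rewrite /ft /ft' !derivE; ring.
have mE : m = m.-1.+1 by rewrite prednK // ltnW.
pose u := ft ^+ m.
have uE : ft * u^`() = m%:R * ft' * u.
  by rewrite /u deriv_exp dft mE /= !exprS -mulr_natl; ring.
have := congr1 (fun v : {poly F} => v`_i.+3) uE.
have -> : ft * u^`() = 'X^3 * u^`() + at_ *: ('X^2 * u^`()) + bt *: ('X * u^`()).
  by rewrite /ft -!mul_polyC; ring.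
have -> : m%:R * ft' * u =
    m%:R *: (3%:R *: ('X^2 * u) + (2%:R * at_) *: ('X * u) + bt *: u).
  by rewrite /ft' -!mul_polyC polyCM !polyC_natr; ring.
rewrite !(coefD, coefZ, coefXnM, coefXM) /= !subSS !subn0 !coef_deriv.
rewrite -/(ht i.+3) -/(ht i.+2) -/(ht i.+1).
rewrite -[_ *+ i.+1]mulr_natl -[_ *+ i.+2]mulr_natl -[_ *+ i.+3]mulr_natl => /eqP.
rewrite -subr_eq0 => /eqP e; rewrite -[RHS]e /ht -/u.
by ring.
Qed.

Lemma separable_absurd : False.
Proof.
(* [ht_rec] propagates two consecutive zeros upwards, because its last coefficient is [bt] times an
   integer strictly between 0 and [p]. The zeros reach index [3 * m], where the coefficient of
   [ft ^+ m] is 1. *)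
have all0 j : (m.*2.-1 + j < 3 * m)%N ->
    ht (m.*2.-1 + j) = 0 /\ ht (m.*2.-1 + j).+1 = 0.
  elim: j => [|j IH] jm.
    rewrite addn0; split; first exact: ht_pred.
    by rewrite prednK ?ht_p // double_gt0 ltnW.
  rewrite addnS in jm *; have [h1 h2] := IH (ltnW jm).
  split=> //; set i := (_ + _)%N in jm h1 h2 *.
  have iE : i = i.-1.+1 by rewrite prednK // /i; move: m2; clear; lia.
  have := ht_rec i.-1; rewrite -iE h1 h2 !mulr0 !add0r => /eqP.
  rewrite !mulf_eq0 (negbTE bt0) /= => /orP [|/eqP //].
  rewrite subr_eq0 => /eqP e.
  have im : (m <= i.+2)%N by rewrite /i; move: m2; clear; lia.
  have : ((i.+2 - m)%:R : F) == 0 by rewrite natrB // e subrr.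
  by rewrite (negbTE (natr_ne0 _)) // /p; move: jm; rewrite /i; move: m2; clear; lia.
have [_ /eqP] := top_cubic_exp at_ bt m.
have e : (3 * m = (m.*2.-1 + m).+1)%N by move: m2; clear; lia.
rewrite [X in _`_X]e; have [|_ h] := all0 m; first by rewrite e.
by rewrite -[_`_ _]/(ht _) h eq_sym oner_eq0.
Qed.
End Separable.
End Descent.

(** * Torsion points *)

Section Torsion.
Variable F : fieldType.
Implicit Types (a b x y z : F).

(* [s], [t], [u] are projective [x]-coordinates of [T - P], [T], [T + P], where
   [x(P) = x]. *)
Definition tstep a b x (s t u : F * F) := exists2 th : F, th != 0 &
  [/\ u.2 * s.2 = th * qU x t.1 t.2,
      u.1 * s.2 + s.1 * u.2 = th * qV a b x t.1 t.2
    & u.1 * s.1 = th * qW b x t.1 t.2].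

Definition doubles a b x y :=
  x ^+ 3 + a * x ^+ 2 + b * x != 0 /\
  4%:R * (x ^+ 3 + a * x ^+ 2 + b * x) * y = (x ^+ 2 - b) ^+ 2.

(* [y], [z] are the [x]-coordinates of the sum and the difference of points with
   [x]-coordinates [x1], [x2]. *)
Definition addsub a b x1 x2 y z :=
  [/\ x1 != x2, (x2 - x1) ^+ 2 * (y + z) = qV a b x1 x2 1
    & (x2 - x1) ^+ 2 * (y * z) = qW b x1 x2 1].

Lemma addsubC a b x1 x2 y z : addsub a b x1 x2 y z -> addsub a b x2 x1 y z.
Proof.
move=> [ne e1 e2]; split; first by rewrite eq_sym.
  by transitivity (qV a b x1 x2 1); [rewrite -e1 | rewrite /qV]; ring.
by transitivity (qW b x1 x2 1); [rewrite -e2 | rewrite /qW]; ring.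
Qed.

Lemma addsubS a b x1 x2 y z : addsub a b x1 x2 y z -> addsub a b x1 x2 z y.
Proof. by move=> [ne e1 e2]; split=> //; [rewrite -e1 | rewrite -e2]; ring. Qed.

Lemma tstepC a b x s t u : tstep a b x s t u -> tstep a b x u t s.
Proof.
move=> [th th0 [e1 e2 e3]]; exists th => //.
by split; [rewrite -e1 | rewrite -e2 | rewrite -e3]; ring.
Qed.

Lemma tstep_double a b x y : (2%:R : F) != 0 -> doubles a b x y ->
  tstep a b x (1, 0) (x, 1) (y, 1).
Proof.
move=> two0 [f0 e]; set f := _ + _ in f0 e.
have four0 : (4%:R * f : F) != 0 by rewrite (natrM _ 2 2) !mulf_neq0.
exists (4%:R * f)^-1; first by rewrite invr_eq0.
rewrite /qU /qV /qW /=; split.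
- by rewrite mulr0 mulr1 subrr expr0n mulr0.
- by apply: (mulfI four0); rewrite mulVKf // /f; ring.
- by apply: (mulfI four0); rewrite mulVKf // !mulr1 e; ring.
Qed.

Lemma tstep_origin a b x : tstep a b x (x, 1) (1, 0) (x, 1).
Proof. by exists 1; rewrite ?oner_neq0 // /qU /qV /qW /=; split; ring. Qed.

Lemma tstep_add a b x1 x2 y z : addsub a b x1 x2 y z ->
  tstep a b x1 (y, 1) (x2, 1) (z, 1).
Proof.
move=> [ne e1 e2].
have n0 : (x2 - x1) ^+ 2 != 0 by rewrite expf_neq0 // subr_eq0 eq_sym.
exists ((x2 - x1) ^+ 2)^-1; first by rewrite invr_eq0.
rewrite /=; split.
- by rewrite /qU !mulr1 mulVf.
- by apply: (mulfI n0); rewrite mulVKf // -e1; ring.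
- by apply: (mulfI n0); rewrite mulVKf // -e2; ring.
Qed.

Variables (a b x : F) (A B : nat -> F) (pi : nat -> F * F) (k : nat).
Hypothesis AB0 : forall n, (n <= k)%N -> A n != 0 \/ B n != 0.
Hypothesis A0 : A 0 = 1. Hypothesis B0 : B 0 = 0.
Hypothesis A1 : A 1 = x. Hypothesis B1 : B 1 = 1.
Hypothesis recAB : forall n, (n.+2 <= k)%N ->
  [/\ B n.+2 * B n = qU x (A n.+1) (B n.+1),
      A n.+2 * B n + A n * B n.+2 = qV a b x (A n.+1) (B n.+1)
    & A n.+2 * A n = qW b x (A n.+1) (B n.+1)].
Hypothesis pi0 : pi 0 = (1, 0).
Hypothesis pi1 : pi 1 = (x, 1).
Hypothesis pi_step : forall n, tstep a b x (pi n) (pi n.+1) (pi n.+2).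

Let related n := exists2 l : F, l != 0 & A n = l * (pi n).1 /\ B n = l * (pi n).2.

(** A point of the projective line is determined by another one and the quadratic form vanishing at
    both. One divides by whichever coordinate of [pi n] is nonzero. *)
Lemma related_step n : (n.+2 <= k)%N -> related n -> related n.+1 -> related n.+2.
Proof.
move=> nk [l l0 [aE bE]] [l1 l10 [a1E b1E]].
have [e1 e2 e3] := recAB nk; have [th th0] := pi_step n.
rewrite /related; move: (pi n.+2) (pi n.+1) (pi n) => [u2 w2] [u1 w1] [u w] /= in aE bE a1E b1E *.
rewrite a1E b1E in e1 e2 e3 => -[t1 t2 t3].
rewrite aE bE in e1 e2 e3.
have h1 : B n.+2 * w * (th * l) = l1 ^+ 2 * (w2 * w).
  by rewrite t1 mulrCA -mulrA [w * l]mulrC e1 /qU; ring.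
have h2 : (A n.+2 * w + u * B n.+2) * (th * l) = l1 ^+ 2 * (u2 * w + u * w2).
  transitivity (th * (A n.+2 * (l * w) + l * u * B n.+2)); first by ring.
  by rewrite t2 e2 /qV; ring.
have h3 : A n.+2 * u * (th * l) = l1 ^+ 2 * (u2 * u).
  by rewrite t3 mulrCA -mulrA [u * l]mulrC e3 /qW; ring.
have tl0 : th * l != 0 by rewrite mulf_neq0.
have uw : u != 0 \/ w != 0.
  have [h|h] := AB0 (ltnW (ltnW nk)).
    by left; apply: contraNneq h => u0; rewrite aE u0 mulr0.
  by right; apply: contraNneq h => w0; rewrite bE w0 mulr0.
exists (l1 ^+ 2 / (th * l)); first by rewrite mulf_neq0 ?invr_eq0 ?expf_neq0.
suff [g1 g2] : A n.+2 * (th * l) = l1 ^+ 2 * u2 /\ B n.+2 * (th * l) = l1 ^+ 2 * w2.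
  by split; apply: (mulIf tl0); rewrite ?g1 ?g2 [RHS]mulrAC divfK.
case: uw => [u0|w0].
  have g1 : A n.+2 * (th * l) = l1 ^+ 2 * u2.
    by apply: (mulIf u0); rewrite -[RHS]mulrA -h3; ring.
  split=> //; apply: (mulIf u0); apply: (addrI (l1 ^+ 2 * u2 * w)).
  rewrite -{1}g1; transitivity ((A n.+2 * w + u * B n.+2) * (th * l)); first by ring.
  by rewrite h2; ring.
have g2 : B n.+2 * (th * l) = l1 ^+ 2 * w2.
  by apply: (mulIf w0); rewrite -[RHS]mulrA -h1; ring.
split=> //; apply: (mulIf w0); apply: (addrI (l1 ^+ 2 * w2 * u)).
rewrite -{1}g2; transitivity ((A n.+2 * w + u * B n.+2) * (th * l)); first by ring.
by rewrite h2; ring.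
Qed.

Lemma torsion_related n : (n <= k)%N -> A n * (pi n).2 = B n * (pi n).1.
Proof.
suff h : (n <= k)%N -> related n.
  by move=> /h [l _ [-> ->]]; ring.
have r0 : related 0 by exists 1; rewrite ?oner_neq0 // A0 B0 pi0 /= !mul1r.
have r1 : related 1 by exists 1; rewrite ?oner_neq0 // A1 B1 pi1 /= !mul1r.
have : ((n <= k)%N -> related n) /\ ((n.+1 <= k)%N -> related n.+1).
  elim: n => [//|n [h1 h2]]; split=> // nk.
  apply: related_step => //; last exact: h2 (ltnW nk).
  exact: h1 (ltnW (ltnW nk)).
by case.
Qed.
End Torsion.

(** * Multiplication by [p] on a supersingular curve *)

Section Core.
Variables (F : closedFieldType) (p : nat) (a b : F).
Hypothesis charF : p \in [pchar F].
Hypothesis p4 : (4 < p)%N.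
Hypothesis b0 : b != 0.
Hypothesis disc0 : a ^+ 2 - 4%:R * b != 0.
Hypothesis hasse : (('X ^+ 3 + a%:P * 'X ^+ 2 + b%:P * 'X) ^+ p./2)`_p.-1 = 0.

Let p2 : (2 < p)%N. Proof. by rewrite (ltn_trans _ p4). Qed.

Let iota : {rmorphism {poly F} -> {fraction {poly F}}} := @tofrac _.

Lemma tofrac_inj : injective iota.
Proof. by move=> u v /eqP; rewrite tofrac_eq => /eqP. Qed.

Lemma mul_by_p : exists2 e : F, e != 0 &
  [/\ mnum a b p = 'X ^+ (p ^ 2), mden a b p = e%:P,
     a ^+ (p ^ 2) = a * e & b ^+ (p ^ 2) = b * e ^+ 2].
Proof.
have pE := pchar_half charF p2.
have oddp : odd p by rewrite pE /= odd_double.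
have := frob_data tofrac_inj (@fderivE F) (@fderivM F) (@fderivD F)
  (@frac_coprime F) charF p2 b0 disc0 oddp.
case=> N0 [D0 [K0 [at_ [bt]]]] /=.
move=> [[atE btE] [nE dE] [cop mon] [sN sD] cE].
have m2 : (1 < p./2)%N by move: p4; rewrite {1}pE; lia.
pose m := p./2; rewrite -/m in pE m2.
have cF := charF; have hs := hasse; rewrite -/m in hs.
rewrite pE in cF atE btE sN sD hs.
have [c cE1] := K1E cF m2 b0 disc0 atE btE cop mon sN sD cE.
have c0 : c = 0.
  apply/eqP/negP => /negP c0.
  exact: (separable_absurd cF m2 b0 disc0 atE btE cop mon sN sD cE c0 cE1 hs).
rewrite c0 scale0r in cE1.
have [NE [d d0 DE]] := wronsk0_insep cF cop mon sN sD cE1.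
rewrite -pE in atE btE NE.
rewrite NE DE in nE dE cE.
exists (d ^+ p); first by rewrite expf_neq0.
have frobD (u v : F) : (u + v) ^+ p = u ^+ p + v ^+ p.
  by rewrite -!(pFrobenius_autE charF) rmorphD.
have frobN (u : F) : (- u) ^+ p = - (u ^+ p).
  by rewrite -!(pFrobenius_autE charF) rmorphN.
have frob_inj (u v : F) : u ^+ p = v ^+ p -> u = v.
  by rewrite -!(pFrobenius_autE charF); apply: fmorph_inj.
(* With [N = 'X ^+ p] and [D] the constant [d], evaluating [cE] at the roots [r], [s] of [qquad]
   shows that [r ^+ p], [s ^+ p] are the two roots of [z^2 + at_ d z + bt d^2]. Vieta then gives the
   [p]-th powers of [a] and [b]. *)
have [r rE] : exists r, r ^+ 2 + a * r + b = 0.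
  have /closed_rootP [r /rootP] : size (qquad a b) != 1%N by rewrite [size _](sizeq a b).
  by rewrite /qquad !hornerE => e; exists r; rewrite -[RHS]e.
pose s := - a - r.
have aE : a = - (r + s) by rewrite /s; ring.
have bE : b = r * s by apply/eqP; rewrite -subr_eq0 -rE /s; apply/eqP; ring.
have rs : r != s.
  by apply: contraNneq disc0 => h; rewrite bE aE h; apply/eqP; ring.
have root_eq t : t ^+ 2 + a * t + b = 0 ->
    (t ^+ p) ^+ 2 + at_ * d * t ^+ p + bt * d ^+ 2 = 0.
  move=> tE; have := congr1 (fun u : {poly F} => u.[t]) cE.
  rewrite /= !(hornerD, hornerM, horner_exp, hornerC, hornerX) tE mul0r => <-.
  by ring.
have e1 := root_eq r rE.
have e2 : (s ^+ p) ^+ 2 + at_ * d * s ^+ p + bt * d ^+ 2 = 0.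
  by apply: root_eq; rewrite aE bE; ring.
have rsp : r ^+ p - s ^+ p != 0.
  by rewrite subr_eq0; apply: contra_neq rs; apply: frob_inj.
have atd : a ^+ p = at_ * d.
  rewrite {1}aE frobN frobD; apply: (mulIf rsp); apply/eqP.
  rewrite -subr_eq0; apply/eqP.
  transitivity (- (((r ^+ p) ^+ 2 + at_ * d * r ^+ p + bt * d ^+ 2)
    - ((s ^+ p) ^+ 2 + at_ * d * s ^+ p + bt * d ^+ 2))); first by ring.
  by rewrite e1 e2 subrr oppr0.
have btd : b ^+ p = bt * d ^+ 2.
  apply/eqP; rewrite -subr_eq0; apply/eqP.
  transitivity (- ((r ^+ p) ^+ 2 + at_ * d * r ^+ p + bt * d ^+ 2)
     + r ^+ p * (at_ * d + (r ^+ p + s ^+ p))).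
    by rewrite {1}bE exprMn; ring.
  by rewrite e1 -atd {1}aE frobN frobD addNr mulr0 oppr0 addr0.
split.
- by rewrite nE -exprM mulnn.
- by rewrite dE -polyC_exp.
- by rewrite -mulnn exprM atd exprMn atE.
- by rewrite -mulnn exprM btd exprMn btE -!exprM mulnC.
Qed.

Lemma mul_specialize (x : F) n : (n.+2 <= p)%N ->
  [/\ (mden a b n.+2).[x] * (mden a b n).[x] = qU x (mnum a b n.+1).[x] (mden a b n.+1).[x],
      (mnum a b n.+2).[x] * (mden a b n).[x] + (mnum a b n).[x] * (mden a b n.+2).[x]
        = qV a b x (mnum a b n.+1).[x] (mden a b n.+1).[x]
    & (mnum a b n.+2).[x] * (mnum a b n).[x] = qW b x (mnum a b n.+1).[x] (mden a b n.+1).[x]].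
Proof.
move=> np; have [e1 e2 e3] := mul_recP tofrac_inj (@fderivE F) (@fderivM F)
   (@fderivD F) (@frac_coprime F) charF p2 b0 disc0 np.
split.
- by rewrite -hornerM e1 /qU horner_exp hornerD hornerN hornerM hornerX.
- rewrite -!hornerM -hornerD e2 /qV -!polyC_natr.
  by rewrite !(hornerM, hornerD, hornerC, hornerX).
- by rewrite -hornerM e3 /qW horner_exp hornerD hornerN !hornerM hornerC hornerX.
Qed.

Lemma mul_nonzero (x : F) n : (n <= p)%N ->
  (mnum a b n).[x] != 0 \/ (mden a b n).[x] != 0.
Proof.
case: n => [_|n np]; first by left; rewrite /mnum /= hornerC oner_neq0.
have cop : coprimep (mnum a b n.+1) (mden a b n.+1).
  case: n np => [_|n np]; first exact: coprimep1.
  by have [_ []] := mul_all tofrac_inj (@fderivE F) (@fderivM F)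
   (@fderivD F) (@frac_coprime F) charF p2 b0 disc0 (ltn0Sn n) np.
have [h|h] := eqVneq (mnum a b n.+1).[x] 0; last by left.
by right; apply/eqP => h2; apply: coprimep_root_absurd cop x h h2.
Qed.

Lemma torsion_frob (e x : F) (pi : nat -> F * F) :
  mnum a b p = 'X ^+ (p ^ 2) -> mden a b p = e%:P ->
  pi 0 = (1, 0) -> pi 1 = (x, 1) ->
  (forall n, tstep a b x (pi n) (pi n.+1) (pi n.+2)) ->
  x ^+ (p ^ 2) * (pi p).2 = e * (pi p).1.
Proof.
move=> nE dE pi0 pi1 pis.
have := @torsion_related _ a b x (fun n => (mnum a b n).[x])
  (fun n => (mden a b n).[x]) pi p (@mul_nonzero x) _ _ _ _ (@mul_specialize x)
  pi0 pi1 pis p (leqnn p).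
rewrite nE dE hornerXn hornerC; apply; rewrite /mnum /mden /= ?hornerC ?hornerX //.
Qed.

End Core.

(** * The coefficient of ['X^(p.-1)] under affine substitution *)

Section AffinePowers.
Variables (R : comNzRingType) (p : nat).
Hypothesis charR : p \in [pchar R].
Implicit Types (u v : R) (P : {poly R}).

(** For [n = p + s], the factor [u^p X^p + v^p] contributes only its constant term, and the
    remaining power has degree [s < p - 1]. The coefficients form a ring because they are
    polynomials in [hasse_weier]. *)
Lemma coef_affine_pow u v n : (n < p + p.-1)%N ->
  ((u *: 'X + v%:P) ^+ n)`_p.-1 = if n == p.-1 then u ^+ n else 0.
Proof.
move=> np; have p0 : (0 < p)%N by rewrite prime_gt0 // (pcharf_prime charR).
have sz k : (size ((u *: 'X + v%:P) ^+ k) <= k.+1)%N.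
  apply: leq_trans (size_poly_exp_leq _ _) _; rewrite ltnS.
  have : (size (u *: 'X + v%:P)%R <= 2)%N.
    rewrite (leq_trans (size_polyD _ _)) // geq_max.
    rewrite (leq_trans (size_scale_leq _ _)) ?size_polyX //.
    by rewrite (leq_trans (size_polyC_leq1 _)).
  by case: (size _) => [|[|[|s]]] //= _; rewrite ?mul0n ?mul1n.
case: (ltngtP n p.-1) => [h|h|->].
- by rewrite nth_default // (leq_trans (sz n)).
- have [s sE] : exists s, n = (p + s)%N.
    by exists (n - p)%N; rewrite subnKC // -(prednK p0).
  have sp : (s < p.-1)%N by rewrite -(ltn_add2l p) -sE.
  have charP : p \in [pchar {poly R}] by rewrite pchar_poly.
  rewrite sE exprD -(pFrobenius_autE charP) rmorphD /= !pFrobenius_autE.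
  rewrite exprZn mulrDl -scalerAl coefD coefZ coefXnM ltn_predL p0 mulr0 add0r.
  by rewrite -polyC_exp mul_polyC coefZ nth_default ?mulr0 // (leq_trans (sz s)).
- elim: (p.-1) => [|k IH]; first by rewrite !expr0 coef1.
  rewrite !exprS mulrDl -scalerAl coefD coefZ coefXM IH mul_polyC coefZ /=.
  by rewrite [in _ `_ _]nth_default ?mulr0 ?addr0.
Qed.

Lemma coef_affine_comp u v P : (size P < p.*2)%N ->
  (P \Po (u *: 'X + v%:P))`_p.-1 = u ^+ p.-1 * P`_p.-1.
Proof.
move=> sP; have p0 : (0 < p)%N by rewrite prime_gt0 // (pcharf_prime charR).
rewrite comp_polyE coef_sum.
have E (i : 'I_(size P)) : (P`_i *: (u *: 'X + v%:P) ^+ i)`_p.-1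
   = if i == p.-1 :> nat then u ^+ p.-1 * P`_p.-1 else 0.
  rewrite coefZ coef_affine_pow; last first.
    by rewrite (leq_trans (ltn_ord i)) // -ltnS -addnS prednK // addnn.
  by case: eqP => [->|]; rewrite ?mulr0 // mulrC.
rewrite (eq_bigr _ (fun i _ => E i)) -big_mkcond /=.
have [h|h] := ltnP p.-1 (size P).
  by rewrite (big_pred1 (Ordinal h)).
by rewrite nth_default // mulr0 big1.
Qed.

End AffinePowers.

(** * Change of Weierstrass model *)

Section Hasse.
Variables (F : closedFieldType) (p : nat).
Hypothesis charF : p \in [pchar F].
Hypothesis p4 : (4 < p)%N.

Let m := p./2.
Let p2 : (2 < p)%N. Proof. by rewrite (ltn_trans _ p4). Qed.
Let pE2 : p = m.*2.+1 := pchar_half charF p2.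
Let natF_neq0 := natr_pchar_neq0 charF.

Lemma two_neq0 : (2%:R : F) != 0. Proof. by rewrite natF_neq0 // (ltn_trans _ p4). Qed.
Lemma three_neq0 : (3%:R : F) != 0. Proof. by rewrite natF_neq0 // (ltn_trans _ p4). Qed.

Definition hasse_cubic (g : {poly F}) := (g ^+ m)`_p.-1.

Section Weier.
Variables a1 a2 a3 a4 a6 : F.
Definition wg2 := wb2 a1 a2 a3 a4 a6 / 4%:R.
Definition wg4 := wb4 a1 a2 a3 a4 a6 / 2%:R.
Definition wg6 := wb6 a1 a2 a3 a4 a6 / 4%:R.
Definition wcubic : {poly F} := 'X ^+ 3 + wg2 *: 'X ^+ 2 + wg4 *: 'X + wg6%:P.

Lemma weier_square : weier_poly a1 a2 a3 a4 a6 =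
  ('X + (2%:R^-1 *: (a1 *: 'X + a3%:P))%:P) ^+ 2 - wcubic%:P.
Proof.
have two0 := two_neq0; have four0 : (4%:R : F) != 0 by rewrite (natrM _ 2 2) mulf_neq0.
rewrite /weier_poly; set l := a1 *: 'X + a3%:P.
set h := 'X ^+ 3 + _ + _ + _.
have -> : wcubic = h + (2%:R^-1 *: l) ^+ 2.
  have lE : (2%:R^-1 *: l) ^+ 2 = 4%:R^-1 *: l ^+ 2.
    by rewrite exprZn exprVn -natrX.
  have g2 : wg2 = a2 + 4%:R^-1 * a1 ^+ 2 by rewrite /wg2 /wb2; field.
  have g4 : wg4 = a4 + 4%:R^-1 * (a1 * a3 + a1 * a3).
    by rewrite /wg4 /wb4; field; rewrite ?two0 ?four0.
  have g6 : wg6 = a6 + 4%:R^-1 * a3 ^+ 2 by rewrite /wg6 /wb6; field.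
  rewrite lE /wcubic g2 g4 g6 /h /l -!mul_polyC !(polyCD, polyCM, polyC_exp).
  by ring.
have l2 : l = 2%:R * (2%:R^-1 *: l).
  by rewrite -polyC_natr mul_polyC scalerA divff // scale1r.
have sq (u k : {poly F}) : 'X ^+ 2 + (2%:R * k)%:P * 'X - u%:P
    = ('X + k%:P) ^+ 2 - (u + k ^+ 2)%:P.
  by rewrite polyCD polyC_exp polyCM polyC_natr; ring.
by rewrite {1}l2 sq.
Qed.

(** Expand the [(p-1)]-st power of the completed square minus [wcubic]: by [coef_affine_pow] only
    the middle term contributes, and its binomial coefficient is prime to [p]. *)
Lemma hasse_weier : hasse_invariant p a1 a2 a3 a4 a6 = 0 ->
  hasse_cubic wcubic = 0.
Proof.
rewrite /hasse_invariant weier_square; set l := (2%:R^-1 *: _)%:P.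
have charP : p \in [pchar {poly F}] by rewrite pchar_poly.
have p1 : p.-1 = m.*2 by rewrite {1}pE2.
rewrite exprDn coef_sum.
have mp : (m < p.-1.+1)%N by rewrite p1 -addnn ltnS leq_addr.
rewrite (bigD1 (Ordinal mp)) //= big1 ?addr0 => [|i im]; last first.
  rewrite coefMn -polyCN -polyC_exp coefMC -exprM -['X]scale1r.
  rewrite coef_affine_pow //; last first.
    move: (ltn_ord i); move: (nat_of_ord i) => j; rewrite p1; move: pE2.
    by move: (m) => k; lia.
  case: eqP => [e|_]; last by rewrite mul0r mul0rn.
  case/eqP: im; apply: val_inj => /=; move: e (ltn_ord i).
  by move: (nat_of_ord i) => j; rewrite p1; move: (m) => k; lia.
rewrite coefMn -polyCN -polyC_exp coefMC -exprM -['X]scale1r.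
rewrite coef_affine_pow //; last first.
  by rewrite p1; move: pE2; move: (m) => k; lia.
have -> : (2 * (p.-1 - m) == p.-1)%N by rewrite p1; apply/eqP; move: (m) => k; lia.
rewrite expr1n mul1r exprNn coefMn -mulr_natr -signr_odd.
have -> : ((-1) ^+ odd m * wcubic ^+ m)`_p.-1 = (-1) ^+ odd m * (wcubic ^+ m)`_p.-1.
  by rewrite -!polyC1 -polyCN -polyC_exp mul_polyC coefZ.
move/eqP; rewrite !mulf_eq0 signr_eq0 /= => /orP [/eqP //|].
rewrite -(dvdn_pcharf charF) => h.
have pr := pcharf_prime charF.
have : (p %| (p.-1)`!)%N.
  by rewrite -(@bin_fact p.-1 m) ?dvdn_mulr // p1 -addnn leq_addr.
have nfact n : (n < p)%N -> ~~ (p %| n`!)%N.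
  elim: n => [_|n IH np]; first by rewrite dvdn1 gtn_eqF // prime_gt1.
  by rewrite factS Euclid_dvdM // negb_or gtnNdvd //= IH // ltnW.
by rewrite (negbTE (nfact _ _)) // p1 [X in (_ < X)%N]pE2.
Qed.

End Weier.

Definition depressed (P Q : F) : {poly F} := 'X ^+ 3 + P *: 'X + Q%:P.

Lemma size_depressed P Q : (size (depressed P Q) <= 4)%N.
Proof.
rewrite /depressed (leq_trans (size_polyD _ _)) // geq_max.
rewrite (leq_trans (size_polyD _ _)) ?geq_max ?size_polyXn /=.
  by rewrite (leq_trans (size_polyC_leq1 _)).
by rewrite (leq_trans (size_scale_leq _ _)) ?size_polyX.
Qed.

Lemma hasse_cubic_comp (u v : F) (g : {poly F}) : (size g <= 4)%N ->
  hasse_cubic (g \Po (u *: 'X + v%:P)) = u ^+ p.-1 * hasse_cubic g.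
Proof.
move=> sg; rewrite /hasse_cubic -rmorphXn /= coef_affine_comp //.
apply: leq_ltn_trans (size_poly_exp_leq _ _) _.
have : ((size g).-1 * m <= 3 * m)%N.
  have s3 : ((size g).-1 <= 3)%N by rewrite -subn1 leq_subLR.
  by rewrite leq_mul2r s3 orbT.
by move: ((size g).-1 * m)%N => t; move: pE2; move: (m) => k; lia.
Qed.

Lemma hasse_cubicZ (c : F) (g : {poly F}) : hasse_cubic (c *: g) = c ^+ m * hasse_cubic g.
Proof. by rewrite /hasse_cubic exprZn coefZ. Qed.

Lemma depressed_comp (P Q u v : F) :
  depressed P Q \Po (u *: 'X + v%:P) = u ^+ 3 *: 'X ^+ 3
  + (3%:R * u ^+ 2 * v) *: 'X ^+ 2 + (3%:R * u * v ^+ 2 + P * u) *: 'X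
  + (v ^+ 3 + P * v + Q)%:P.
Proof.
rewrite /depressed !comp_polyD comp_polyZ comp_polyC rmorphXn /= comp_polyX.
rewrite -!mul_polyC.
have -> : (3%:R * u ^+ 2 * v)%:P = 3%:R * u%:P ^+ 2 * v%:P.
  by rewrite polyCM polyCM polyC_natr polyC_exp.
have -> : (3%:R * u * v ^+ 2 + P * u)%:P = 3%:R * u%:P * v%:P ^+ 2 + P%:P * u%:P.
  by rewrite polyCD polyCM polyCM [(P * u)%:P]polyCM polyC_natr polyC_exp.
by rewrite !(polyCD, polyC_exp) polyCM; ring.
Qed.

(** [u] scales the [x]-coordinate, whence the weights 2 and 3. It is rational in the coefficients
    except when [P] or [Q] vanishes ([j] equal to 0 or 1728), where a cube or square root is
    taken. *)
Lemma depressed_iso (P Q P' Q' : F) :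
  4%:R * P ^+ 3 + 27%:R * Q ^+ 2 != 0 -> 4%:R * P' ^+ 3 + 27%:R * Q' ^+ 2 != 0 ->
  P ^+ 3 * Q' ^+ 2 = P' ^+ 3 * Q ^+ 2 ->
  exists2 u, u != 0 & P' = u ^+ 2 * P /\ Q' = u ^+ 3 * Q.
Proof.
move=> d d' e.
have [P0|P0] := eqVneq P 0.
  have Q0 : Q != 0 by apply: contraNneq d => ->; rewrite P0 !expr0n !mulr0 addr0.
  have P'0 : P' = 0.
    move/eqP: e; rewrite P0 expr0n mul0r eq_sym mulf_eq0 !expf_eq0 (negbTE Q0).
    by rewrite orbF => /eqP.
  have Q'0 : Q' != 0 by apply: contraNneq d' => ->; rewrite P'0 !expr0n !mulr0 addr0.
  have [u uE] := @nth_root_ex F 3 (Q' / Q) isT; exists u.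
    by apply: contraNneq (mulf_neq0 Q'0 (invr_neq0 Q0)) => h; rewrite -uE h expr0n.
  by rewrite uE divfK // P0 mulr0.
have [Q0|Q0] := eqVneq Q 0.
  have Q'0 : Q' = 0.
    move/eqP: e; rewrite Q0 expr0n mulr0 mulf_eq0 !expf_eq0 (negbTE P0).
    by move/eqP.
  have P'0 : P' != 0 by apply: contraNneq d' => ->; rewrite Q'0 !expr0n !mulr0 addr0.
  have [u uE] := @nth_root_ex F 2 (P' / P) isT; exists u.
    by apply: contraNneq (mulf_neq0 P'0 (invr_neq0 P0)) => h; rewrite -uE h expr0n.
  by rewrite uE divfK // Q0 mulr0.
have P'0 : P' != 0.
  apply: contraNneq d' => h; move/eqP: e; rewrite h expr0n mul0r mulf_eq0 !expf_eq0.
  by rewrite (negbTE P0) /= => /eqP ->; rewrite expr0n !mulr0 addr0.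
have Q'0 : Q' != 0.
  apply: contraNneq P'0 => h; move/eqP: e; rewrite h expr0n mulr0 eq_sym mulf_eq0.
  by rewrite !expf_eq0 (negbTE Q0) /= orbF.
exists (Q' / Q * (P / P')); first by rewrite !mulf_neq0 ?invr_eq0.
split.
  apply/esym; transitivity (P ^+ 3 * Q' ^+ 2 / (P' ^+ 2 * Q ^+ 2)).
    by field; rewrite Q0 P'0.
  by rewrite e; field; rewrite Q0 P'0.
apply/esym; transitivity (P ^+ 3 * Q' ^+ 2 * Q' / (P' ^+ 3 * Q ^+ 2)).
  by field; rewrite Q0 P'0.
by rewrite e; field; rewrite Q0 P'0.
Qed.

Lemma hasse_depressed_iso (P Q u : F) : u != 0 ->
  hasse_cubic (depressed P Q) = 0 ->
  hasse_cubic (depressed (u ^+ 2 * P) (u ^+ 3 * Q)) = 0.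
Proof.
move=> u0 h0.
have := hasse_cubic_comp u 0 (size_depressed (u ^+ 2 * P) (u ^+ 3 * Q)).
have -> : depressed (u ^+ 2 * P) (u ^+ 3 * Q) \Po (u *: 'X + 0%:P)
    = u ^+ 3 *: depressed P Q.
  rewrite depressed_comp /depressed 2!scalerDr scalerA.
  rewrite (_ : 3%:R * u ^+ 2 * 0 = 0) ?scale0r ?addr0; last by ring.
  rewrite (_ : _ + u ^+ 2 * P * u = u ^+ 3 * P); last by ring.
  rewrite (_ : _ + u ^+ 3 * Q = u ^+ 3 * Q); last by ring.
  by rewrite -[u ^+ 3 *: Q%:P]mul_polyC -polyCM.
rewrite hasse_cubicZ h0 mulr0 => /esym/eqP.
by rewrite mulf_eq0 expf_eq0 (negbTE u0) andbF => /eqP.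
Qed.

Section Model.
Variables a1 a2 a3 a4 a6 : F.
Notation g2 := (wg2 a1 a2 a3 a4 a6).
Notation g4 := (wg4 a1 a2 a3 a4 a6).
Notation g6 := (wg6 a1 a2 a3 a4 a6).
Definition wP := g4 - g2 ^+ 2 / 3%:R.
Definition wQ := g6 - g2 * g4 / 3%:R + 2%:R * g2 ^+ 3 / 27%:R.

Let four0 : (4%:R : F) != 0. Proof. by rewrite (natrM _ 2 2) mulf_neq0 ?two_neq0. Qed.
Let t27 : (27%:R : F) != 0. Proof. by rewrite (natrX _ 3 3) expf_neq0 ?three_neq0. Qed.

Lemma wcubicE : wcubic a1 a2 a3 a4 a6 = depressed wP wQ \Po (1 *: 'X + (g2 / 3%:R)%:P).
Proof.
rewrite depressed_comp /wcubic /wP /wQ !expr1n !scale1r !mulr1.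
congr (_ + _ *: _ + _ *: _ + _%:P).
- by field; rewrite three_neq0.
- by field; rewrite three_neq0.
- by field; rewrite three_neq0 t27.
Qed.

Lemma wc4E : wc4 a1 a2 a3 a4 a6 = - (48%:R * wP).
Proof.
rewrite /wc4 /wP /wg2 /wg4.
by field; rewrite three_neq0 two_neq0 four0.
Qed.

Lemma wdiscE : wdisc a1 a2 a3 a4 a6 =
  - (16%:R * (4%:R * wP ^+ 3 + 27%:R * wQ ^+ 2)).
Proof.
rewrite /wdisc /wP /wQ /wg2 /wg4 /wg6 /wb2 /wb4 /wb6 /wb8.
by field; rewrite three_neq0 two_neq0 four0 t27.
Qed.

Lemma hasse_wcubic : hasse_cubic (wcubic a1 a2 a3 a4 a6) = hasse_cubic (depressed wP wQ).
Proof. by rewrite wcubicE hasse_cubic_comp ?size_depressed // expr1n mul1r. Qed.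

Lemma two_torsion_model e : wdisc a1 a2 a3 a4 a6 != 0 ->
  hasse_cubic (wcubic a1 a2 a3 a4 a6) = 0 ->
  e ^+ 3 + g2 * e ^+ 2 + g4 * e + g6 = 0 ->
  let a := g2 + 3%:R * e in let b := g4 + 2%:R * g2 * e + 3%:R * e ^+ 2 in
  [/\ b != 0, a ^+ 2 - 4%:R * b != 0 &
     (('X ^+ 3 + a%:P * 'X ^+ 2 + b%:P * 'X) ^+ p./2)`_p.-1 = 0].
Proof.
move=> d0 h0 e0 a b.
have g6E : g6 = - (e ^+ 3 + g2 * e ^+ 2 + g4 * e).
  by apply/eqP; rewrite -addr_eq0 addrC e0.
have dE : wdisc a1 a2 a3 a4 a6 = 16%:R * (b ^+ 2 * (a ^+ 2 - 4%:R * b)).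
  by rewrite wdiscE /wP /wQ g6E /a /b; field; rewrite three_neq0 t27.
have : b ^+ 2 * (a ^+ 2 - 4%:R * b) != 0.
  by apply: contraNneq d0 => h; rewrite dE h mulr0.
rewrite mulf_eq0 negb_or expf_eq0 /= => /andP [b0 ab0]; split=> //.
rewrite -[LHS]/(hasse_cubic _).
have sw : (size (wcubic a1 a2 a3 a4 a6) <= 4)%N.
  rewrite /wcubic (leq_trans (size_polyD _ _)) // geq_max.
  rewrite (leq_trans (size_polyD _ _)) ?geq_max /=; last first.
    rewrite (leq_trans (size_scale_leq _ _)) ?size_polyX // andbT.
    rewrite (leq_trans (size_polyD _ _)) ?geq_max // size_polyXn /=.
    by rewrite (leq_trans (size_scale_leq _ _)) ?size_polyXn.
  by rewrite (leq_trans (size_polyC_leq1 _)).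
have := hasse_cubic_comp 1 e sw; rewrite h0 mulr0 => <-; congr hasse_cubic.
rewrite /wcubic g6E /a /b !comp_polyD !comp_polyZ comp_polyC !rmorphXn /=.
rewrite comp_polyX scale1r -!mul_polyC.
have -> : (g4 + 2%:R * g2 * e + 3%:R * e ^+ 2)%:P
   = g4%:P + 2%:R * g2%:P * e%:P + 3%:R * e%:P ^+ 2.
  rewrite polyCD polyCD [(3%:R * _)%:P]polyCM [(_ * e)%:P]polyCM.
  by rewrite [(2%:R * _)%:P]polyCM !polyC_natr polyC_exp.
have -> : (g2 + 3%:R * e)%:P = g2%:P + 3%:R * e%:P.
  by rewrite polyCD [(3%:R * _)%:P]polyCM polyC_natr.
have C3 (u v w : F) : (- (u ^+ 3 + v * u ^+ 2 + w * u))%:P =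
   - (u%:P ^+ 3 + v%:P * u%:P ^+ 2 + w%:P * u%:P).
  by rewrite polyCN 2!polyCD [(w * u)%:P]polyCM [(v * _)%:P]polyCM !polyC_exp.
rewrite C3.
by ring.
Qed.

End Model.

(** [supersingular_j] only provides some curve with the given [j]; this transfers the vanishing to
    the model that carries the marked subgroup. *)
Lemma hasse_same_j a1 a2 a3 a4 a6 a1' a2' a3' a4' a6' :
  wdisc a1 a2 a3 a4 a6 != 0 -> wdisc a1' a2' a3' a4' a6' != 0 ->
  wj a1 a2 a3 a4 a6 = wj a1' a2' a3' a4' a6' ->
  hasse_invariant p a1 a2 a3 a4 a6 = 0 ->
  hasse_cubic (wcubic a1' a2' a3' a4' a6') = 0.
Proof.
move=> d d' jj /hasse_weier; rewrite !hasse_wcubic => h0.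
have four0 : (4%:R : F) != 0 by rewrite (natrM _ 2 2) mulf_neq0 ?two_neq0.
have t27 : (27%:R : F) != 0 by rewrite (natrX _ 3 3) expf_neq0 ?three_neq0.
have t16 : (16%:R : F) != 0 by rewrite (natrX _ 4 2) expf_neq0.
have t48 : (48%:R : F) != 0 by rewrite (natrM _ 3 16) mulf_neq0 ?three_neq0.
have e : wc4 a1 a2 a3 a4 a6 ^+ 3 * wdisc a1' a2' a3' a4' a6' =
         wc4 a1' a2' a3' a4' a6' ^+ 3 * wdisc a1 a2 a3 a4 a6.
  apply/eqP; rewrite -eqr_div //; exact/eqP.
move: d d'; rewrite !wdiscE !oppr_eq0 !mulf_eq0 !negb_or => /andP [_ d] /andP [_ d'].
rewrite !wdiscE !wc4E in e.
set P := wP a1 a2 a3 a4 a6 in d e h0; set Q := wQ a1 a2 a3 a4 a6 in d e h0.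
set P' := wP a1' a2' a3' a4' a6' in d' e *.
set Q' := wQ a1' a2' a3' a4' a6' in d' e *.
have PQ : P ^+ 3 * Q' ^+ 2 = P' ^+ 3 * Q ^+ 2.
  have c0 : 48%:R ^+ 3 * 16%:R * 27%:R != 0 :> F by rewrite !mulf_neq0 ?expf_neq0.
  apply: (mulfI c0); apply/eqP; rewrite -subr_eq0; apply/eqP.
  move/eqP: e; rewrite -subr_eq0 => /eqP e; rewrite -[RHS]e.
  by ring.
have [u u0 [-> ->]] := depressed_iso d d' PQ.
exact: hasse_depressed_iso.
Qed.
End Hasse.

Section Shift.
Variables (F : fieldType) (g2 g4 g6 e : F).
Hypothesis root_e : e ^+ 3 + g2 * e ^+ 2 + g4 * e + g6 = 0.
Let a := g2 + 3%:R * e.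
Let b := g4 + 2%:R * g2 * e + 3%:R * e ^+ 2.

Let g6E : g6 = - (e ^+ 3 + g2 * e ^+ 2 + g4 * e).
Proof. by apply/eqP; rewrite -addr_eq0 addrC root_e. Qed.

Lemma cubic_shift X : (X - e) ^+ 3 + a * (X - e) ^+ 2 + b * (X - e) =
  X ^+ 3 + g2 * X ^+ 2 + g4 * X + g6.
Proof. by rewrite g6E /a /b; ring. Qed.

(** The root [e] is not explicit in the applications, so the duplication formula is checked on the
    unshifted cubic. *)
Lemma doubles_shift X Y : X ^+ 3 + g2 * X ^+ 2 + g4 * X + g6 != 0 ->
  4%:R * (X ^+ 3 + g2 * X ^+ 2 + g4 * X + g6) * Y =
    X ^+ 4 - 2%:R * g4 * X ^+ 2 - 8%:R * g6 * X + g4 ^+ 2 - 4%:R * g2 * g6 ->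
  doubles a b (X - e) (Y - e).
Proof.
move=> n0 h; split; rewrite cubic_shift // mulrBr h.
by rewrite g6E /a /b; ring.
Qed.

Lemma addsub_shift X1 X2 Y Z : X1 != X2 ->
  (X2 - X1) ^+ 2 * (Y + Z) =
    2%:R * ((X1 + X2) * (X1 * X2 + g4) + 2%:R * g2 * X1 * X2 + 2%:R * g6) ->
  (X2 - X1) ^+ 2 * (Y * Z) =
    (X1 * X2 - g4) ^+ 2 - 4%:R * g6 * (X1 + X2 + g2) ->
  addsub a b (X1 - e) (X2 - e) (Y - e) (Z - e).
Proof.
move=> ne h1 h2; split.
- by rewrite (inj_eq (addIr _)).
- transitivity ((X2 - X1) ^+ 2 * (Y + Z) - 2%:R * e * (X2 - X1) ^+ 2); first by ring.
  by rewrite h1 g6E /qV /a /b; ring.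
- transitivity ((X2 - X1) ^+ 2 * (Y * Z) - e * ((X2 - X1) ^+ 2 * (Y + Z))
     + e ^+ 2 * (X2 - X1) ^+ 2); first by ring.
  by rewrite h1 h2 g6E /qW /a /b; ring.
Qed.
End Shift.

(** * Curves with a cyclic subgroup of order 2, 3, 5, 7 *)

Section Family.
Variables (F : closedFieldType) (p : nat).
Hypothesis charF : p \in [pchar F].
Hypothesis p4 : (4 < p)%N.

(** [s] lists the [x]-coordinates of the multiples of a point of order [size s], starting with the
    origin [(1, 0)]. *)
Definition periodic (s : seq (F * F)) n := nth (1, 0) s (n %% size s).

Lemma periodic_step a b x s :
  (forall r, (r < size s)%N -> tstep a b x (nth (1, 0) s r)
     (nth (1, 0) s (r.+1 %% size s)) (nth (1, 0) s (r.+2 %% size s))) ->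
  (0 < size s)%N ->
  forall n, tstep a b x (periodic s n) (periodic s n.+1) (periodic s n.+2).
Proof.
move=> h s0 n; have := h (n %% size s)%N (ltn_pmod _ s0).
by rewrite /periodic -[(n %% _).+2]addn2 -[(n %% _).+1]addn1 !modnDml addn1 addn2.
Qed.

Lemma frobq_morph : exists phi : {rmorphism F -> F}, forall x, phi x = x ^+ (p ^ 2).
Proof.
pose phi : {rmorphism F -> F} := pFrobenius_aut charF \o pFrobenius_aut charF.
exists phi => x; rewrite -mulnn exprM -!(pFrobenius_autE charF).
reflexivity.
Qed.

Let two_ne0 : (2%:R : F) != 0 := two_neq0 charF p4.

Let four_ne0 : (4%:R : F) != 0.
Proof. by rewrite (natrM _ 2 2) mulf_neq0 // two_ne0. Qed.

Lemma two_torsion_ex a1 a2 a3 a4 a6 : exists e,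
  e ^+ 3 + wg2 a1 a2 a3 a4 a6 * e ^+ 2 + wg4 a1 a2 a3 a4 a6 * e
  + wg6 a1 a2 a3 a4 a6 = 0 :> F.
Proof.
have sw : size (wcubic a1 a2 a3 a4 a6) = 4%N.
  rewrite /wcubic -!addrA size_polyDl ?size_polyXn //.
  rewrite (leq_ltn_trans (size_polyD _ _)) // gtn_max.
  rewrite (leq_ltn_trans (size_scale_leq _ _)) ?size_polyXn //.
  rewrite (leq_ltn_trans (size_polyD _ _)) // gtn_max.
  rewrite (leq_ltn_trans (size_scale_leq _ _)) ?size_polyX //.
  by rewrite (leq_ltn_trans (size_polyC_leq1 _)).
have /closed_rootP [r /rootP] : size (wcubic a1 a2 a3 a4 a6) != 1%N by rewrite sw.
by rewrite /wcubic !(hornerD, hornerZ, hornerXn, hornerX, hornerC); exists r.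
Qed.

Lemma frobenius_model a1 a2 a3 a4 a6 e :
  let g2 := wg2 a1 a2 a3 a4 a6 in let g4 := wg4 a1 a2 a3 a4 a6 in
  let g6 := wg6 a1 a2 a3 a4 a6 in
  e ^+ 3 + g2 * e ^+ 2 + g4 * e + g6 = 0 ->
  wdisc a1 a2 a3 a4 a6 != 0 -> supersingular_j p (wj a1 a2 a3 a4 a6) ->
  let a := g2 + 3%:R * e in let b := g4 + 2%:R * g2 * e + 3%:R * e ^+ 2 in
  exists2 l : F, l != 0 & [/\ a ^+ (p ^ 2) = a * l, b ^+ (p ^ 2) = b * l ^+ 2 &
  forall x s, (0 < size s)%N -> nth (1, 0) s 0 = (1, 0) ->
    periodic s 1 = (x, 1) ->
    (forall r, (r < size s)%N -> tstep a b x (nth (1, 0) s r)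
     (nth (1, 0) s (r.+1 %% size s)) (nth (1, 0) s (r.+2 %% size s))) ->
    x ^+ (p ^ 2) * (periodic s p).2 = l * (periodic s p).1].
Proof.
move=> g2 g4 g6 eE d0 [c1 [c2 [c3 [c4 [c6 [dc jc hc]]]]]] a b.
have h0 := hasse_same_j charF p4 dc d0 jc hc.
have [b0 disc0 hs] := two_torsion_model charF p4 d0 h0 eE.
have [l l0 [nE dE aE bE]] := mul_by_p charF p4 b0 disc0 hs.
exists l => //; split=> // x s s0 sO s1 st.
apply: (torsion_frob charF p4 b0 disc0 nE dE) => //.
  by rewrite /periodic mod0n.
exact: periodic_step.
Qed.

(* [y^2 = x^3 + alpha x^2 + x] with [alpha^2 = 4 + 256/t]; the subgroup is generated
   by [(0, 0)]. *)
Lemma frob_level2 (t : F) : t != 0 -> supersingular_j p ((t + 256%:R) ^+ 3 / t ^+ 2) ->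
  t ^+ (p ^ 2) = t.
Proof.
move=> t0 ss; have [phi phiE] := frobq_morph.
have [al alE] := @nth_root_ex F 2 (4%:R + 256%:R / t) isT.
have n256 : (256%:R : F) != 0 by rewrite (natrX _ 2 8) expf_neq0 // two_ne0.
have n16 : (16%:R : F) != 0 by rewrite (natrX _ 2 4) expf_neq0 // two_ne0.
have dE : wdisc 0 al 0 1 0 = 16%:R * (256%:R / t).
  rewrite /wdisc /wb2 /wb4 /wb6 /wb8.
  transitivity (16%:R * (al ^+ 2 - 4%:R)); first by ring.
  by rewrite alE; ring.
have d0 : wdisc 0 al 0 1 0 != 0 by rewrite dE !mulf_neq0 ?invr_eq0.
have jE : wj 0 al 0 1 0 = (t + 256%:R) ^+ 3 / t ^+ 2.
  rewrite /wj dE.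
  have -> : wc4 0 al 0 1 0 = 16%:R * (al ^+ 2 - 3%:R).
    by rewrite /wc4 /wb2 /wb4; ring.
  have n4096 : (4096%:R : F) != 0 by rewrite (natrX _ 2 12) expf_neq0 // two_ne0.
  by rewrite alE; field; rewrite t0 n4096.
rewrite -jE in ss.
have e0 : 0 ^+ 3 + wg2 (0 : F) al 0 1 0 * 0 ^+ 2 + wg4 (0 : F) al 0 1 0 * 0
    + wg6 (0 : F) al 0 1 0 = 0.
  by rewrite /wg6 /wb6; ring.
have [l l0 [aE bE _]] := frobenius_model e0 d0 ss.
have aal : wg2 (0 : F) al 0 1 0 + 3%:R * 0 = al.
  by rewrite /wg2 /wb2; field; rewrite four_ne0.
have bal : wg4 (0 : F) al 0 1 0 + 2%:R * wg2 (0 : F) al 0 1 0 * 0 + 3%:R * 0 ^+ 2 = 1.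
  by rewrite /wg4 /wb4 /wg2 /wb2; field; rewrite two_ne0 four_ne0.
rewrite aal in aE; rewrite bal expr1n mul1r in bE.
rewrite -!phiE in aE *.
(* [b = 1] forces [l ^+ 2 = 1], so [al] is fixed up to sign. *)
have : phi (al ^+ 2) = al ^+ 2 by rewrite rmorphXn aE exprMn -bE mulr1.
rewrite alE rmorphD fmorph_div !rmorph_nat => /addrI /(mulfI n256) /invr_inj.
exact.
Qed.

Lemma prime_mod_neq0 N : prime N -> p != N -> (p %% N)%N != 0%N.
Proof.
move=> prN pN; rewrite -/(N %| p)%N dvdn_prime2 // ?(pcharf_prime charF) //.
by rewrite eq_sym.
Qed.

(** With [x] of weight 1, the value of the cubic, that is the square of the [y]-coordinate, has
    weight 3. *)
Lemma frob_cubic (phi : {rmorphism F -> F}) (a b l x y : F) :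
  phi a = a * l -> phi b = b * l ^+ 2 -> phi x = l * y ->
  phi (x ^+ 3 + a * x ^+ 2 + b * x) = l ^+ 3 * (y ^+ 3 + a * y ^+ 2 + b * y).
Proof.
move=> aE bE xE; rewrite 2!rmorphD [phi (a * _)]rmorphM [phi (b * _)]rmorphM.
by rewrite !rmorphXn aE bE xE; ring.
Qed.

Definition orbit3 (x : F) : seq (F * F) := [:: (1, 0); (x, 1); (x, 1)].

Lemma orbit3_step a b x : doubles a b x x ->
  forall r, (r < 3)%N -> tstep a b x (nth (1, 0) (orbit3 x) r)
     (nth (1, 0) (orbit3 x) (r.+1 %% 3)) (nth (1, 0) (orbit3 x) (r.+2 %% 3)).
Proof.
move=> dbl [|[|[|]]] //= _.
- exact: tstep_double two_ne0 dbl.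
- exact/tstepC/(tstep_double two_ne0 dbl).
- exact: tstep_origin.
Qed.

(* [y^2 = x^3 + (u x + 1)^2] with [4 u^3 = t + 27]; the points with [x = 0] have
   order 3. *)
Lemma frob_level3 (t : F) : t != 0 ->
  supersingular_j p ((t + 27%:R) * (t + 3%:R) ^+ 3 / t) -> p != 3 -> t ^+ (p ^ 2) = t.
Proof.
move=> t0 ss p3; have [phi phiE] := frobq_morph.
have four0 := four_ne0; have two0 := two_ne0.
have [u uE] := @nth_root_ex F 3 ((t + 27%:R) / 4%:R) isT.
have tE : t = 4%:R * u ^+ 3 - 27%:R by rewrite uE mulrC divfK // addrK.
have n16 : (16%:R : F) != 0 by rewrite (natrX _ 2 4) expf_neq0.
have dE : wdisc 0 (u ^+ 2) 0 (2%:R * u) 1 = 16%:R * t.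
  by rewrite /wdisc /wb2 /wb4 /wb6 /wb8 tE; ring.
have d0 : wdisc 0 (u ^+ 2) 0 (2%:R * u) 1 != 0 by rewrite dE mulf_neq0.
have jE : wj 0 (u ^+ 2) 0 (2%:R * u) 1 = (t + 27%:R) * (t + 3%:R) ^+ 3 / t.
  rewrite /wj dE.
  have -> : wc4 0 (u ^+ 2) 0 (2%:R * u) 1 = 4%:R * u * (t + 3%:R).
    by rewrite /wc4 /wb2 /wb4 tE; ring.
  have -> : (t + 27%:R) = 4%:R * u ^+ 3 by rewrite tE; ring.
  by field; rewrite t0 n16.
rewrite -jE in ss.
have [e eE] := two_torsion_ex 0 (u ^+ 2) 0 (2%:R * u) 1.
have [l l0] := frobenius_model eE d0 ss.
have g2E : wg2 0 (u ^+ 2) 0 (2%:R * u) 1 = u ^+ 2 by rewrite /wg2 /wb2; field.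
have g4E : wg4 0 (u ^+ 2) 0 (2%:R * u) 1 = 2%:R * u by rewrite /wg4 /wb4; field.
have g6E : wg6 0 (u ^+ 2) 0 (2%:R * u) 1 = 1 by rewrite /wg6 /wb6; field.
rewrite g2E g4E g6E in eE *.
set a := _ + 3%:R * e; set b := _ + 3%:R * e ^+ 2.
move=> [aE bE tors].
have dbl : doubles a b (0 - e) (0 - e).
  apply: (doubles_shift eE); last by ring.
  by rewrite !(expr0n, mulr0, add0r) oner_neq0.
have {tors} := tors (0 - e) (orbit3 (0 - e)) isT (erefl _) (erefl _) (orbit3_step dbl).
have -> : periodic (orbit3 (0 - e)) p = (0 - e, 1).
  have := prime_mod_neq0 (isT : prime 3) p3.
  by rewrite /periodic /=; case: (p %% 3)%N (ltn_pmod p (isT : 0 < 3)%N) => [|[|[|]]].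
rewrite /= mulr1 -!phiE in aE bE * => xE.
have fE : (0 - e) ^+ 3 + a * (0 - e) ^+ 2 + b * (0 - e) = 1.
  by rewrite (cubic_shift eE); ring.
have l3 : l ^+ 3 = 1.
  have := congr1 phi fE; rewrite (frob_cubic aE bE xE) fE mulr1 => ->.
  by rewrite rmorph1.
(* [u ^+ 2] and [2 * u] are Taylor coefficients of the cubic at the point of order 3, hence of
   weights 1 and 2. So [u ^+ 3] is multiplied by [l ^+ 3], which is 1 because the value of the cubic
   there is 1. *)
have e2 : phi (u ^+ 2) = l * u ^+ 2.
  have -> : u ^+ 2 = a + 3%:R * (0 - e) by rewrite /a; ring.
  by rewrite rmorphD rmorphM rmorph_nat aE xE; ring.
have e1 : phi u = l ^+ 2 * u.
  apply: (mulfI two0); rewrite -[X in X * phi u](rmorph_nat phi) -rmorphM.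
  have h2 : 2%:R * u = 3%:R * (0 - e) ^+ 2 + 2%:R * a * (0 - e) + b.
    by rewrite /a /b; ring.
  rewrite mulrCA h2 2!rmorphD [phi (3%:R * _)]rmorphM rmorphXn.
  rewrite [phi (_ * (0 - e))]rmorphM [phi (2%:R * a)]rmorphM !rmorph_nat aE bE xE.
  by ring.
rewrite tE rmorphB rmorphM !rmorph_nat; congr (_ * _ - _).
by rewrite exprS rmorphM e1 e2 -[RHS]mul1r -l3; ring.
Qed.

Definition orbit5 (x y : F) : seq (F * F) :=
  [:: (1, 0); (x, 1); (y, 1); (y, 1); (x, 1)].

Lemma orbit5_step a b x y : doubles a b x y -> addsub a b x y x y ->
  forall r, (r < 5)%N -> tstep a b x (nth (1, 0) (orbit5 x y) r)
     (nth (1, 0) (orbit5 x y) (r.+1 %% 5)) (nth (1, 0) (orbit5 x y) (r.+2 %% 5)).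
Proof.
move=> dbl add [|[|[|[|[|]]]]] //= _.
- exact: tstep_double two_ne0 dbl.
- exact: tstep_add.
- exact/tstepC/tstep_add.
- exact/tstepC/(tstep_double two_ne0 dbl).
- exact: tstep_origin.
Qed.

Lemma periodic_orbit5 x y : p != 5 -> periodic (orbit5 x y) p =
  if (p %% 5 \in [:: 1; 4])%N then (x, 1) else (y, 1).
Proof.
move=> p5; have := prime_mod_neq0 (isT : prime 5) p5; rewrite /periodic /=.
by case: (p %% 5)%N (ltn_pmod p (isT : 0 < 5)%N) => [|[|[|[|[|]]]]].
Qed.

(* Tate's curve [y^2 + (1 - s) x y - s y = x^3 - s x^2] with [s - 1/s = t + 11]; the
   multiples of [(0, 0)] have [x = 0] and [x = s]. *)
Lemma frob_level5 (t : F) : t != 0 ->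
  supersingular_j p ((t ^+ 2 + 10%:R * t + 5%:R) ^+ 3 / t) -> p != 5 ->
  t ^+ (p ^ 2) = t.
Proof.
move=> t0 ss p5; have [phi phiE] := frobq_morph.
have four0 := four_ne0; have two0 := two_ne0.
have [s sE] : exists s, s ^+ 2 - (t + 11%:R) * s - 1 = 0.
  have /closed_rootP [s /rootP] : size ('X ^+ 2 - ((t + 11%:R) *: 'X + 1%:P)) != 1%N.
    rewrite size_polyDl ?size_polyXn // size_polyN.
    rewrite (leq_ltn_trans (size_polyD _ _)) // gtn_max.
    rewrite (leq_ltn_trans (size_scale_leq _ _)) ?size_polyX //.
    by rewrite (leq_ltn_trans (size_polyC_leq1 _)).
  by rewrite !(hornerD, hornerN, hornerZ, hornerXn, hornerX, hornerC) opprD addrA;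
    exists s.
have s0 : s != 0.
  apply: contra_eqN sE => /eqP ->.
  by rewrite expr0n mulr0 subr0 add0r oppr_eq0 oner_eq0.
have stE : s * (t + 11%:R) = s ^+ 2 - 1.
  by apply/eqP; rewrite -subr_eq0 -oppr_eq0 -sE; apply/eqP; ring.
have tE : t = s - 11%:R - s^-1.
  apply: (mulfI s0); apply: (addIr (s * 11%:R)); rewrite -mulrDr stE.
  by field; rewrite s0.
have dE : wdisc (1 - s) (- s) (- s) 0 0 = s ^+ 6 * t.
  by rewrite /wdisc /wb2 /wb4 /wb6 /wb8 tE; field; rewrite s0.
have d0 : wdisc (1 - s) (- s) (- s) 0 0 != 0 by rewrite dE mulf_neq0 // expf_neq0.
have jE : wj (1 - s) (- s) (- s) 0 0 = (t ^+ 2 + 10%:R * t + 5%:R) ^+ 3 / t.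
  rewrite /wj dE.
  have -> : wc4 (1 - s) (- s) (- s) 0 0 = s ^+ 2 * (t ^+ 2 + 10%:R * t + 5%:R).
    by rewrite /wc4 /wb2 /wb4 tE; field; rewrite s0.
  by field; rewrite t0 s0.
rewrite -jE in ss.
have [e eE] := two_torsion_ex (1 - s) (- s) (- s) 0 0.
have [l l0] := frobenius_model eE d0 ss.
have g2E : wg2 (1 - s) (- s) (- s) 0 0 = (1 - 6%:R * s + s ^+ 2) / 4%:R.
  by rewrite /wg2 /wb2; congr (_ / _); ring.
have g4E : wg4 (1 - s) (- s) (- s) 0 0 = (s ^+ 2 - s) / 2%:R.
  by rewrite /wg4 /wb4; congr (_ / _); ring.
have g6E : wg6 (1 - s) (- s) (- s) 0 0 = s ^+ 2 / 4%:R.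
  by rewrite /wg6 /wb6; congr (_ / _); ring.
rewrite g2E g4E g6E in eE *.
set a := _ + 3%:R * e; set b := _ + 3%:R * e ^+ 2.
move=> [aE bE tors].
set g2 := _ / 4%:R in eE a b aE bE tors *; set g4 := _ / 2%:R in eE b bE tors *.
set g6 := s ^+ 2 / 4%:R in eE *.
have fs : s ^+ 3 + g2 * s ^+ 2 + g4 * s + g6 = s ^+ 4 / 4%:R.
  by rewrite /g2 /g4 /g6; field; rewrite two0 four0.
have f0 : 0 ^+ 3 + g2 * 0 ^+ 2 + g4 * 0 + g6 = s ^+ 2 / 4%:R.
  by rewrite /g6; ring.
have dbl01 : doubles a b (0 - e) (s - e).
  apply: (doubles_shift eE); rewrite f0; first by rewrite mulf_neq0 ?invr_eq0 ?expf_neq0.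
  by rewrite /g2 /g4 /g6; field; rewrite two0 four0.
have dbl10 : doubles a b (s - e) (0 - e).
  apply: (doubles_shift eE); rewrite fs; first by rewrite mulf_neq0 ?invr_eq0 ?expf_neq0.
  by rewrite /g2 /g4 /g6; field; rewrite two0 four0.
have add01 : addsub a b (0 - e) (s - e) (0 - e) (s - e).
  apply: (addsub_shift eE); first by rewrite eq_sym.
    by rewrite /g2 /g4 /g6; field; rewrite two0 four0.
  by rewrite /g2 /g4 /g6; field; rewrite two0 four0.
have add10 : addsub a b (s - e) (0 - e) (s - e) (0 - e) by apply/addsubC/addsubS.
have h0 := tors (0 - e) (orbit5 (0 - e) (s - e)) isT (erefl _) (erefl _)
  (orbit5_step dbl01 add01).
have h1 := tors (s - e) (orbit5 (s - e) (0 - e)) isT (erefl _) (erefl _)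
  (orbit5_step dbl10 add10).
rewrite !periodic_orbit5 // in h0 h1; rewrite -!phiE in aE bE h0 h1 *.
pose f z := z ^+ 3 + a * z ^+ 2 + b * z.
have f0E : f (0 - e) = s ^+ 2 / 4%:R by rewrite /f (cubic_shift eE) f0.
have fsE : f (s - e) = s ^+ 4 / 4%:R by rewrite /f (cubic_shift eE) fs.
(* Up to the factor 4, [t + 11] is the difference of two values of weight 3 over the cube of a
   difference of weight 1; exchanging the two [x]-coordinates changes the sign of both. *)
have W : 4%:R * (f (s - e) - f (0 - e)) = s ^+ 3 * (t + 11%:R).
  transitivity (s ^+ 2 * (s * (t + 11%:R))); last by ring.
  by rewrite stE f0E fsE; field; rewrite four0.
have sD : s = (s - e) - (0 - e) by ring.
suff [k k0 [k1 k2]] : exists2 k, k != 0 & phi s = k * s /\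
    phi (f (s - e) - f (0 - e)) = k ^+ 3 * (f (s - e) - f (0 - e)).
  have : phi (4%:R * (f (s - e) - f (0 - e))) = k ^+ 3 * (4%:R * (f (s - e) - f (0 - e))).
    by rewrite rmorphM rmorph_nat k2; ring.
  rewrite W [phi (s ^+ 3 * _)]rmorphM rmorphXn k1 mulrA -exprMn.
  have ks : (k * s) ^+ 3 != 0 by rewrite expf_neq0 // mulf_neq0.
  by move=> /(mulfI ks); rewrite rmorphD rmorph_nat => /addIr.
move: h0 h1; case: ifP => _; rewrite /= !mulr1 => h0 h1.
  exists l => //; split; first by rewrite {1}sD rmorphB h0 h1; ring.
  rewrite rmorphB /f (frob_cubic aE bE h0) (frob_cubic aE bE h1).
  by ring.
exists (- l); first by rewrite oppr_eq0.
split; first by rewrite {1}sD rmorphB h0 h1; ring.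
rewrite rmorphB /f (frob_cubic aE bE h0) (frob_cubic aE bE h1).
by ring.
Qed.

Definition orbit7 (x y z : F) : seq (F * F) :=
  [:: (1, 0); (x, 1); (y, 1); (z, 1); (z, 1); (y, 1); (x, 1)].

Lemma orbit7_step a b x y z :
  doubles a b x y -> addsub a b x y x z -> addsub a b x z y z ->
  forall r, (r < 7)%N -> tstep a b x (nth (1, 0) (orbit7 x y z) r)
     (nth (1, 0) (orbit7 x y z) (r.+1 %% 7)) (nth (1, 0) (orbit7 x y z) (r.+2 %% 7)).
Proof.
move=> dbl add1 add2 [|[|[|[|[|[|[|]]]]]]] //= _.
- exact: tstep_double two_ne0 dbl.
- exact: tstep_add.
- exact: tstep_add.
- exact/tstepC/tstep_add.
- exact/tstepC/tstep_add.
- exact/tstepC/(tstep_double two_ne0 dbl).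
- exact: tstep_origin.
Qed.

Lemma periodic_orbit7 x y z : p != 7 -> periodic (orbit7 x y z) p =
  if (p %% 7 \in [:: 1; 6])%N then (x, 1) else
  if (p %% 7 \in [:: 2; 5])%N then (y, 1) else (z, 1).
Proof.
move=> p7; have := prime_mod_neq0 (isT : prime 7) p7; rewrite /periodic /=.
by case: (p %% 7)%N (ltn_pmod p (isT : 0 < 7)%N) => [|[|[|[|[|[|[|]]]]]]].
Qed.

(* Tate's curve [y^2 + (1 - v) x y - bb y = x^3 - bb x^2] with [v = d^2 - d] and
   [bb = d^3 - d^2]; the multiples of [(0, 0)] have [x = 0, bb, v].  The permutations
   of these three values generated by Frobenius act on [d = bb / v] through
   [d -> (d - 1) / d], which fixes [t]. *)
Lemma frob_level7 (t : F) : t != 0 ->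
  supersingular_j p ((t ^+ 2 + 13%:R * t + 49%:R)
    * (t ^+ 2 + 5%:R * t + 1) ^+ 3 / t) -> p != 7 ->
  t ^+ (p ^ 2) = t.
Proof.
move=> t0 ss p7; have [phi phiE] := frobq_morph.
have four0 := four_ne0; have two0 := two_ne0.
have [d dR] : exists d, d ^+ 3 - 8%:R * d ^+ 2 + 5%:R * d + 1 = t * (d ^+ 2 - d).
  have /closed_rootP [d /rootP] : size ('X ^+ 3 + (- (8%:R + t) *: 'X ^+ 2
      + ((5%:R + t) *: 'X + 1%:P))) != 1%N.
    rewrite size_polyDl ?size_polyXn //.
    rewrite (leq_ltn_trans (size_polyD _ _)) // gtn_max.
    rewrite (leq_ltn_trans (size_scale_leq _ _)) ?size_polyXn //.
    rewrite (leq_ltn_trans (size_polyD _ _)) // gtn_max.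
    rewrite (leq_ltn_trans (size_scale_leq _ _)) ?size_polyX //.
    by rewrite (leq_ltn_trans (size_polyC_leq1 _)).
  rewrite !(hornerD, hornerN, hornerZ, hornerXn, hornerX, hornerC) => dE.
  exists d; apply/eqP; rewrite -subr_eq0; apply/eqP.
  by rewrite -[RHS]dE; ring.
have d0 : d != 0.
  apply: contra_eqN dR => /eqP ->.
  by rewrite !expr0n !mulr0 !subr0 !add0r mulr0 oner_eq0.
have d1 : d - 1 != 0.
  rewrite subr_eq0; apply: contra_eqN dR => /eqP ->.
  rewrite !expr1n subrr mulr0 !mulr1.
  rewrite (_ : 1 - 8%:R + 5%:R + 1 = - 1); last by ring.
  by rewrite oppr_eq0 oner_eq0.
have v0 : d ^+ 2 - d != 0 by rewrite expr2 -{3}[d]mulr1 -mulrBr mulf_neq0.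
have tE : t = (d ^+ 3 - 8%:R * d ^+ 2 + 5%:R * d + 1) / (d ^+ 2 - d).
  by rewrite dR mulfK.
pose v := d ^+ 2 - d; pose bb := d ^+ 3 - d ^+ 2.
have bE0 : bb = d * v by rewrite /bb /v; ring.
have DE : wdisc (1 - v) (- bb) (- bb) 0 0 = v ^+ 8 * t.
  rewrite exprSr -[v ^+ 7 * v * t]mulrA [v * t]mulrC -dR.
  by rewrite /wdisc /wb2 /wb4 /wb6 /wb8 /v /bb; ring.
have D0 : wdisc (1 - v) (- bb) (- bb) 0 0 != 0 by rewrite DE mulf_neq0 // expf_neq0.
have jE : wj (1 - v) (- bb) (- bb) 0 0 =
    (t ^+ 2 + 13%:R * t + 49%:R) * (t ^+ 2 + 5%:R * t + 1) ^+ 3 / t.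
  have e1 : v ^+ 2 * (t ^+ 2 + 13%:R * t + 49%:R) = (v + 1) ^+ 3.
    transitivity ((t * v) ^+ 2 + 13%:R * (t * v) * v + 49%:R * v ^+ 2); first by ring.
    by rewrite -dR /v; ring.
  have e2 : wc4 (1 - v) (- bb) (- bb) 0 0 =
      (v + 1) * (v ^+ 2 * (t ^+ 2 + 5%:R * t + 1)).
    transitivity ((v + 1) * ((t * v) ^+ 2 + 5%:R * (t * v) * v + v ^+ 2)); last by ring.
    by rewrite -dR /wc4 /wb2 /wb4 /v /bb; ring.
  rewrite /wj DE e2 exprMn -e1.
  by field; rewrite t0 v0.
rewrite -jE in ss.
have [e eE] := two_torsion_ex (1 - v) (- bb) (- bb) 0 0.
have [l l0] := frobenius_model eE D0 ss.
have g2E : wg2 (1 - v) (- bb) (- bb) 0 0 = ((1 - v) ^+ 2 - 4%:R * bb) / 4%:R.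
  by rewrite /wg2 /wb2; congr (_ / _); ring.
have g4E : wg4 (1 - v) (- bb) (- bb) 0 0 = (v * bb - bb) / 2%:R.
  by rewrite /wg4 /wb4; congr (_ / _); ring.
have g6E : wg6 (1 - v) (- bb) (- bb) 0 0 = bb ^+ 2 / 4%:R.
  by rewrite /wg6 /wb6; congr (_ / _); ring.
rewrite g2E g4E g6E in eE *.
set a := _ + 3%:R * e; set b := _ + 3%:R * e ^+ 2.
move=> [aE bE tors].
set g2 := _ / 4%:R in eE a b aE bE tors *; set g4 := _ / 2%:R in eE b bE tors *.
set g6 := bb ^+ 2 / 4%:R in eE *.
have bb0 : bb != 0 by rewrite bE0 mulf_neq0.
have fb : bb ^+ 3 + g2 * bb ^+ 2 + g4 * bb + g6 = (bb * v) ^+ 2 / 4%:R.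
  by rewrite /g2 /g4 /g6; field; rewrite two0 four0.
have f0 : 0 ^+ 3 + g2 * 0 ^+ 2 + g4 * 0 + g6 = bb ^+ 2 / 4%:R.
  by rewrite /g6; ring.
have fv : v ^+ 3 + g2 * v ^+ 2 + g4 * v + g6 = (v * (d - 1) ^+ 2) ^+ 2 / 4%:R.
  by rewrite /g2 /g4 /g6 /bb /v; field; rewrite two0 four0.
have fac (x : F) : x != 0 -> x ^+ 2 / 4%:R != 0.
  by move=> x0; rewrite mulf_neq0 ?invr_eq0 ?expf_neq0.
have dbl01 : doubles a b (0 - e) (bb - e).
  apply: (doubles_shift eE); rewrite f0; first exact: fac.
  by rewrite /g2 /g4 /g6 /bb /v; field; rewrite two0 four0.
have dbl12 : doubles a b (bb - e) (v - e).
  apply: (doubles_shift eE); rewrite fb; first by rewrite fac ?mulf_neq0.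
  by rewrite /g2 /g4 /g6 /bb /v; field; rewrite two0 four0.
have dbl20 : doubles a b (v - e) (0 - e).
  apply: (doubles_shift eE); rewrite fv; first by rewrite fac ?mulf_neq0 ?expf_neq0.
  by rewrite /g2 /g4 /g6 /bb /v; field; rewrite two0 four0.
have bv : bb != v.
  rewrite -subr_eq0 (_ : bb - v = (d - 1) * v) ?mulf_neq0 //.
  by rewrite /bb /v; ring.
have add01 : addsub a b (0 - e) (bb - e) (0 - e) (v - e).
  apply: (addsub_shift eE); first by rewrite eq_sym.
    by rewrite /g2 /g4 /g6 /bb /v; field; rewrite two0 four0.
  by rewrite /g2 /g4 /g6 /bb /v; field; rewrite two0 four0.
have add12 : addsub a b (bb - e) (v - e) (bb - e) (0 - e).
  apply: (addsub_shift eE) => //.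
    by rewrite /g2 /g4 /g6 /bb /v; field; rewrite two0 four0.
  by rewrite /g2 /g4 /g6 /bb /v; field; rewrite two0 four0.
have add20 : addsub a b (v - e) (0 - e) (v - e) (bb - e).
  apply: (addsub_shift eE) => //.
    by rewrite /g2 /g4 /g6 /bb /v; field; rewrite two0 four0.
  by rewrite /g2 /g4 /g6 /bb /v; field; rewrite two0 four0.
have h0 := tors (0 - e) (orbit7 (0 - e) (bb - e) (v - e)) isT (erefl _) (erefl _)
  (orbit7_step dbl01 add01 (addsubS (addsubC add20))).
have h1 := tors (bb - e) (orbit7 (bb - e) (v - e) (0 - e)) isT (erefl _) (erefl _)
  (orbit7_step dbl12 add12 (addsubS (addsubC add01))).
have h2 := tors (v - e) (orbit7 (v - e) (0 - e) (bb - e)) isT (erefl _) (erefl _)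
  (orbit7_step dbl20 add20 (addsubS (addsubC add12))).
rewrite !periodic_orbit7 // -!phiE in h0 h1 h2; rewrite -!phiE in aE bE *.
have phib : phi bb = phi (bb - e) - phi (0 - e) by rewrite -rmorphB; congr (phi _); ring.
have phiv : phi v = phi (v - e) - phi (0 - e) by rewrite -rmorphB; congr (phi _); ring.
have phid : phi d * phi v = phi bb by rewrite bE0 rmorphM.
have phit : phi t * phi v = phi d ^+ 3 - 8%:R * phi d ^+ 2 + 5%:R * phi d + 1.
  rewrite -rmorphM -dR rmorphD rmorph1 rmorphD rmorphB [phi (8%:R * _)]rmorphM.
  by rewrite [phi (5%:R * _)]rmorphM !rmorphXn !rmorph_nat.
have phiv2 : phi v = phi d ^+ 2 - phi d by rewrite /v rmorphB rmorphXn.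
have phiv0 : phi v != 0 by rewrite fmorph_eq0.
have phitE : phi t = (phi d ^+ 3 - 8%:R * phi d ^+ 2 + 5%:R * phi d + 1)
    / (phi d ^+ 2 - phi d).
  by rewrite -phit -phiv2 mulfK.
suff : phi d = d \/ phi d = (d - 1) / d \/ phi d = - (d - 1)^-1.
  rewrite phitE tE => -[->//|[->|->]].
    field; rewrite v0 d0 (_ : _ + _ = - (d - 1)) ?oppr_eq0 //; ring.
  by field; rewrite v0 d1 addrC subrK.
(* The class of [p] among the units modulo 7 up to sign, a cyclic group of order 3, decides how the
   three [x]-coordinates are permuted. *)
move: h0 h1 h2; case: ifP => _; last (case: ifP => _); rewrite /= !mulr1 => h0 h1 h2.
- left; apply: (mulIf phiv0); rewrite phid phib phiv h0 h1 h2.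
  transitivity (l * bb); first by ring.
  by rewrite bE0; ring.
- right; left; apply: (mulIf phiv0); rewrite phid phib phiv h0 h1 h2.
  by rewrite /bb /v; field; rewrite d0.
- right; right; apply: (mulIf phiv0); rewrite phid phib phiv h0 h1 h2.
  by rewrite /bb /v; field; rewrite d1.
Qed.

End Family.

(** * Characteristics 2 and 3 *)

Section SmallPrimes.
Variable F : fieldType.

Lemma hasse2 (a1 a2 a3 a4 a6 : F) : hasse_invariant 2 a1 a2 a3 a4 a6 = a1.
Proof.
rewrite /hasse_invariant /weier_poly /= expr1.
set l := a1 *: 'X + a3%:P; set h := 'X ^+ 3 + _ + _ + _.
have -> : ('X ^+ 2 + l%:P * 'X - h%:P)`_1 = l.
  by rewrite coefB coefD coefXn coefMX !coefC /= add0r subr0.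
by rewrite /l coefD coefZ coefX coefC /= mulr1 addr0.
Qed.

(** Modulo 2, [wc4] is the fourth power of the Hasse invariant [a1]; modulo 3, the Hasse invariant
    is [wb2] and [wc4] is its square. *)
Lemma ss2_j0 (j : F) : 2 \in [pchar F] -> supersingular_j 2 j -> j = 0.
Proof.
move=> c2 [a1 [a2 [a3 [a4 [a6 [_ <-]]]]]]; rewrite hasse2 => ->.
have t0 : (2%:R : F) = 0 by exact: pcharf0 c2.
rewrite /wj (_ : wc4 _ _ _ _ _ = 0) ?expr0n ?mul0r //.
rewrite /wc4 /wb2 /wb4.
transitivity (2%:R * (8%:R * a2 ^+ 2 - 12%:R * (2%:R * a4 + 0 * a3))); first by ring.
by rewrite t0 mul0r.
Qed.

Lemma hasse3 (a1 a2 a3 a4 a6 : F) :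
  hasse_invariant 3 a1 a2 a3 a4 a6 = a1 ^+ 2 - 2%:R * a2.
Proof.
rewrite /hasse_invariant /weier_poly /=.
set l := a1 *: 'X + a3%:P; set h := 'X ^+ 3 + _ + _ + _.
have sq (u v : {poly F}) : ('X ^+ 2 + u%:P * 'X - v%:P) ^+ 2
  = 'X^4 + (2%:R * u)%:P * 'X^3 + (u ^+ 2 - 2%:R * v)%:P * 'X^2
    - (2%:R * (u * v))%:P * 'X + (v ^+ 2)%:P.
  rewrite polyCB [(2%:R * (u * v))%:P]polyCM [(2%:R * u)%:P]polyCM.
  by rewrite [(2%:R * v)%:P]polyCM [(u * v)%:P]polyCM !polyC_natr !polyC_exp; ring.
rewrite sq.
set P := _ + (h ^+ 2)%:P.
have -> : P`_2 = l ^+ 2 - 2%:R * h.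
  rewrite /P !coefD coefN !mul_polyC !coefZ coefX !coefXn coefC /= !mulr0 mulr1.
  by rewrite oppr0 !addr0 add0r.
rewrite /l /h -polyC_natr coefB mul_polyC coefZ.
have -> : (a1 *: 'X + a3%:P) ^+ 2
    = (a1 ^+ 2) *: 'X^2 + (2%:R * a1 * a3) *: 'X + (a3 ^+ 2)%:P.
  by rewrite -!mul_polyC !polyC_exp [(2%:R * a1 * a3)%:P]polyCM
    [(2%:R * a1)%:P]polyCM polyC_natr; ring.
by rewrite !coefD !coefZ !coefXn !coefX !coefC /=; ring.
Qed.

Lemma ss3_j0 (j : F) : 3 \in [pchar F] -> supersingular_j 3 j -> j = 0.
Proof.
move=> c3 [a1 [a2 [a3 [a4 [a6 [_ <-]]]]]]; rewrite hasse3 => h.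
have t0 : (3%:R : F) = 0 by exact: pcharf0 c3.
rewrite /wj (_ : wc4 _ _ _ _ _ = 0) ?expr0n ?mul0r //.
rewrite /wc4 /wb2 /wb4.
have -> : a1 ^+ 2 = 2%:R * a2 by apply/eqP; rewrite -subr_eq0 h.
transitivity (3%:R * (12%:R * a2 ^+ 2 - 8%:R * (2%:R * a4 + a1 * a3))); first by ring.
by rewrite t0 mul0r.
Qed.

Lemma small_level (p N : nat) (Y : F) : p \in [pchar F] -> (p < 4)%N ->
  N \in [:: 2; 3; 5; 7]%N -> p != N -> R_N N 0 Y = 0 -> Y ^+ (p ^ 2) = Y.
Proof.
move=> cp p4 N4 pN; have := pcharf_prime cp.
have expY n (Z : F) : Z ^+ n.+1 = 0 -> Z = 0 by move/eqP; rewrite expf_eq0 => /eqP.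
case: p p4 cp pN => [|[|[|[|]]]] //= _ cp pN _.
- have t0 : (2%:R : F) = 0 by exact: pcharf0 cp.
  suff h : R_N N 0 Y = 0 -> Y = 0 by move=> /h ->; rewrite expr0n.
  move: N4 pN; rewrite !inE => /or4P [] /eqP -> //= _; rewrite /R_N.
  + rewrite (_ : _ + _ = Y ^+ 4 + 2%:R * (288%:R * Y ^+ 3 + 55296%:R * Y ^+ 2 + 3538944%:R * Y)).
      by rewrite t0 mul0r addr0; apply: expY.
    by ring.
  + rewrite (_ : Y ^+ 2 + 216%:R * Y + 144%:R = Y ^+ 2 + 2%:R * (108%:R * Y + 72%:R)); last by ring.
    by rewrite t0 !mul0r expr0n subr0 add0r addr0 -exprM; apply: expY.
  + rewrite (_ : Y ^+ 2 + 224%:R * Y + 448%:R = Y ^+ 2 + 2%:R * (112%:R * Y + 224%:R)); last by ring.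
    by rewrite t0 !mul0r expr0n subr0 add0r addr0 -exprM -exprD; apply: expY.
- have t0 : (3%:R : F) = 0 by exact: pcharf0 cp.
  move: N4 pN; rewrite !inE => /or4P [] /eqP -> //= _; rewrite /R_N.
  + rewrite (_ : Y + 144%:R = Y + 3%:R * 48%:R); last by ring.
    by rewrite t0 !mul0r expr0n subr0 add0r addr0 => /expY ->; rewrite expr0n.
  + rewrite (_ : Y ^+ 2 + 216%:R * Y + 144%:R = Y ^+ 2 + 3%:R * (72%:R * Y + 48%:R)); last by ring.
    by rewrite t0 !mul0r expr0n subr0 add0r addr0 -exprM => /expY ->; rewrite expr0n.
  (* The one case with a root other than 0: the relation becomes [Y^2 (Y + 1)^6 = 0]. *)
  + rewrite (_ : Y ^+ 2 + 224%:R * Y + 448%:R = (Y + 1) ^+ 2 + 3%:R * (74%:R * Y + 149%:R)); last by ring.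
    rewrite t0 !mul0r expr0n subr0 add0r addr0 -exprM => /eqP.
    rewrite mulf_eq0 => /orP [] /eqP /expY.
      by move=> ->; rewrite expr0n.
    move/eqP; rewrite addr_eq0 => /eqP ->.
    by rewrite (_ : (3 ^ 2 = 2 * 4 + 1)%N) // exprD exprM sqrrN !expr1n mul1r.
Qed.
End SmallPrimes.

(** * From [t] to the Fricke Hauptmodul *)

Section Hauptmodul.
Variables (F : closedFieldType) (p : nat).
Hypothesis charF : p \in [pchar F].
Hypothesis p4 : (4 < p)%N.

Lemma pair_ex (c d Y : F) : c != 0 ->
  exists t s, [/\ t != 0, s != 0, t * s = c & Y = t + s + d].
Proof.
move=> c0.
have /closed_rootP [t /rootP] : size ('X ^+ 2 - ((Y - d) *: 'X + (- c)%:P)) != 1%N.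
  rewrite size_polyDl ?size_polyXn // size_polyN.
  rewrite (leq_ltn_trans (size_polyD _ _)) // gtn_max.
  rewrite (leq_ltn_trans (size_scale_leq _ _)) ?size_polyX //.
  by rewrite (leq_ltn_trans (size_polyC_leq1 _)).
rewrite !(hornerD, hornerN, hornerZ, hornerXn, hornerX, hornerC) => tE.
exists t, (Y - d - t).
have ts : t * (Y - d - t) = c.
  by apply/eqP; rewrite -subr_eq0 -oppr_eq0 -tE; apply/eqP; ring.
by move: c0; rewrite -ts mulf_eq0 negb_or => /andP [t0 s0]; split=> //; ring.
Qed.

Lemma natF_prime N : prime N -> p != N -> (N%:R : F) != 0.
Proof.
move=> prN pN; rewrite -(dvdn_pcharf charF).
by rewrite dvdn_prime2 // ?(pcharf_prime charF) // eq_sym.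
Qed.

(** Only one of [h t], [h s] need be known to equal [j]: the product [c] is a natural number, fixed
    by Frobenius, so [t] is fixed if and only if [s] is. *)
Lemma frob_pair (c d : nat) (h : F -> F) (R : F -> F -> F) j Y :
  (c%:R : F) != 0 ->
  (forall t s, t != 0 -> t * s = c%:R ->
     R j (t + s + d%:R) = (j - h t) * (j - h s)) ->
  (forall t, t != 0 -> supersingular_j p (h t) -> t ^+ (p ^ 2) = t) ->
  supersingular_j p j -> R j Y = 0 -> Y ^+ (p ^ 2) = Y.
Proof.
move=> c0 RE frob ss; have [t [s [t0 s0 ts ->]]] := pair_ex d%:R Y c0.
rewrite (RE _ _ t0 ts) => /eqP; rewrite mulf_eq0 !subr_eq0 => ors.
have [phi phiE] := frobq_morph charF; rewrite -!phiE.
have pc : phi t * phi s = t * s by rewrite -rmorphM ts rmorph_nat.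
have [pt ps] : phi t = t /\ phi s = s.
  case/orP: ors => /eqP jE; rewrite jE in ss.
    have h1 : phi t = t by rewrite phiE frob.
    by split=> //; apply: (mulfI t0); rewrite -{1}h1.
  have h1 : phi s = s by rewrite phiE frob.
  by split=> //; apply: (mulIf s0); rewrite -{1}h1.
by rewrite !rmorphD pt ps rmorph_nat.
Qed.

Lemma natF_power N k c : prime N -> p != N -> c = (N ^ k)%N -> (c%:R : F) != 0.
Proof. by move=> prN pN ->; rewrite natrX expf_neq0 // natF_prime. Qed.

(** [t] imitates the eta quotient [(eta(tau) / eta(N tau))^(24/(N-1))], on which the Fricke
    involution acts by [t -> c/t] with [c = N^(12/(N-1))]; [h(c/t)] is the invariant of the
    [N]-isogenous curve. The shift [d] is the one for which [R_N] at [Y = 0] is [(X - 1728)^2] for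
    levels 2 and 5, and [X^2] for levels 3 and 7. *)
Lemma frob_fricke N (j Y : F) : N \in [:: 2; 3; 5; 7]%N -> p != N ->
  supersingular_j p j -> R_N N j Y = 0 -> Y ^+ (p ^ 2) = Y.
Proof.
rewrite !inE => /or4P [] /eqP -> pN.
- have n0 : (4096%:R : F) != 0 by exact: (@natF_power 2 12 _ isT pN (erefl _)).
  apply: (@frob_pair 4096 128
    (fun t => (t + 256%:R) ^+ 3 / t ^+ 2) (R_N 2)) => //;
    last first.
    exact: frob_level2.
  move=> t s t0 ts; have s0 : s != 0.
    by apply: contraNneq n0 => s0; rewrite -ts s0 mulr0.
  have -> : (s + 256%:R) ^+ 3 / s ^+ 2 = (t + 16%:R) ^+ 3 / t.
    apply/eqP; rewrite eqr_div ?expf_neq0 //; apply/eqP/(mulfI s0).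
    have e : (t + 16%:R) * s = 16%:R * (s + 256%:R) by rewrite mulrDl ts; ring.
    transitivity (((t + 16%:R) * s) ^+ 3); last by ring.
    transitivity ((t * s) * (s + 256%:R) ^+ 3); first by ring.
    by rewrite e ts; ring.
  have -> : s = 4096%:R / t by rewrite -ts mulrC mulKf.
  by rewrite /R_N; field; rewrite t0.
- have n0 : (729%:R : F) != 0 by exact: (@natF_power 3 6 _ isT pN (erefl _)).
  apply: (@frob_pair 729 54
    (fun t => (t + 27%:R) * (t + 3%:R) ^+ 3 / t) (R_N 3)) => //; last first.
    by move=> t t0 ss; apply: frob_level3.
  move=> t s t0 ts; have s0 : s != 0.
    by apply: contraNneq n0 => s0; rewrite -ts s0 mulr0.
  have -> : (s + 27%:R) * (s + 3%:R) ^+ 3 / s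
      = (t + 27%:R) * (t + 243%:R) ^+ 3 / t ^+ 3.
    apply/eqP; rewrite eqr_div ?expf_neq0 //; apply/eqP/(mulfI t0).
    have e1 : (s + 27%:R) * t = 27%:R * (t + 27%:R) by rewrite mulrDl [s * t]mulrC ts; ring.
    have e2 : (s + 3%:R) * t = 3%:R * (t + 243%:R) by rewrite mulrDl [s * t]mulrC ts; ring.
    transitivity (((s + 27%:R) * t) * ((s + 3%:R) * t) ^+ 3); first by ring.
    transitivity ((t * s) * ((t + 27%:R) * (t + 243%:R) ^+ 3)); last by ring.
    by rewrite e1 e2 ts; ring.
  have -> : s = 729%:R / t by rewrite -ts mulrC mulKf.
  by rewrite /R_N; field; rewrite t0.
- have n0 : (125%:R : F) != 0 by exact: (@natF_power 5 3 _ isT pN (erefl _)).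
  apply: (@frob_pair 125 22
    (fun t => (t ^+ 2 + 10%:R * t + 5%:R) ^+ 3 / t) (R_N 5)) => //; last first.
    by move=> t t0 ss; apply: frob_level5.
  move=> t s t0 ts; have s0 : s != 0.
    by apply: contraNneq n0 => s0; rewrite -ts s0 mulr0.
  have -> : (s ^+ 2 + 10%:R * s + 5%:R) ^+ 3 / s
      = (t ^+ 2 + 250%:R * t + 3125%:R) ^+ 3 / t ^+ 5.
    apply/eqP; rewrite eqr_div ?expf_neq0 //; apply/eqP/(mulfI t0).
    have e : (s ^+ 2 + 10%:R * s + 5%:R) * t ^+ 2
        = 5%:R * (t ^+ 2 + 250%:R * t + 3125%:R).
      transitivity ((t * s) ^+ 2 + 10%:R * (t * s) * t + 5%:R * t ^+ 2); first by ring.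
      by rewrite ts; ring.
    transitivity (((s ^+ 2 + 10%:R * s + 5%:R) * t ^+ 2) ^+ 3); first by ring.
    transitivity ((t * s) * (t ^+ 2 + 250%:R * t + 3125%:R) ^+ 3); last by ring.
    by rewrite e ts; ring.
  have -> : s = 125%:R / t by rewrite -ts mulrC mulKf.
  by rewrite /R_N; field; rewrite t0.
- have n0 : (49%:R : F) != 0 by exact: (@natF_power 7 2 _ isT pN (erefl _)).
  apply: (@frob_pair 49 13
    (fun t => (t ^+ 2 + 13%:R * t + 49%:R)
    * (t ^+ 2 + 5%:R * t + 1) ^+ 3 / t) (R_N 7)) => //; last first.
    by move=> t t0 ss; apply: frob_level7.
  move=> t s t0 ts; have s0 : s != 0.
    by apply: contraNneq n0 => s0; rewrite -ts s0 mulr0.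
  have -> : (s ^+ 2 + 13%:R * s + 49%:R) * (s ^+ 2 + 5%:R * s + 1) ^+ 3 / s
      = (t ^+ 2 + 13%:R * t + 49%:R) * (t ^+ 2 + 245%:R * t + 2401%:R) ^+ 3 / t ^+ 7.
    apply/eqP; rewrite eqr_div ?expf_neq0 //; apply/eqP/(mulfI t0).
    have e1 : (s ^+ 2 + 13%:R * s + 49%:R) * t ^+ 2
        = 49%:R * (t ^+ 2 + 13%:R * t + 49%:R).
      transitivity ((t * s) ^+ 2 + 13%:R * (t * s) * t + 49%:R * t ^+ 2); first by ring.
      by rewrite ts; ring.
    have e2 : (s ^+ 2 + 5%:R * s + 1) * t ^+ 2 = t ^+ 2 + 245%:R * t + 2401%:R.
      transitivity ((t * s) ^+ 2 + 5%:R * (t * s) * t + t ^+ 2); first by ring.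
      by rewrite ts; ring.
    transitivity (((s ^+ 2 + 13%:R * s + 49%:R) * t ^+ 2)
      * ((s ^+ 2 + 5%:R * s + 1) * t ^+ 2) ^+ 3); first by ring.
    transitivity ((t * s) * ((t ^+ 2 + 13%:R * t + 49%:R)
      * (t ^+ 2 + 245%:R * t + 2401%:R) ^+ 3)); last by ring.
    by rewrite e1 e2 ts; ring.
  have -> : s = 49%:R / t by rewrite -ts mulrC mulKf.
  by rewrite /R_N; field; rewrite t0.
Qed.
End Hauptmodul.

Theorem theorem6p1 (F : closedFieldType) (p N : nat) :
  prime p -> p \in [pchar F] -> N \in [:: 2; 3; 5; 7]%N -> p != N ->
  forall j : F, supersingular_j p j ->
  forall Y : F, R_N N j Y = 0 -> Y ^+ (p ^ 2) = Y.
Proof.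
move=> pr charF N4 pN j ss Y RY.
have [p4|p4] := ltnP 4 p; first exact: frob_fricke ss RY.
have {}p4 : (p < 4)%N by rewrite ltn_neqAle p4 andbT; apply: contraTneq pr => ->.
have j0 : j = 0.
  case: p p4 pr charF ss {pN} => [|[|[|[|]]]] //= _ _ charF ss.
    exact: ss2_j0 charF ss.
  exact: ss3_j0 charF ss.
by rewrite j0 in RY; exact: small_level charF p4 N4 pN RY.
Qed.
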